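(* Let $p\ge2$, $\frac1p+\frac1q=1$. Suppose assumptions (A1)–(A5) of the context hold, let $\rho>0$, and let the mirror descent linearized augmented Lagrangian algorithm of the context be run with $K\ge2$, $$\rho_k=\frac\rho K\ (k=0,\ldots,K-1),\qquad \eta L_\mu\le\frac12,\qquad 0<\alpha\le1,\qquad n\ge\frac{96(p-1)S_p\eta^2L_f^2}{\alpha}.$$ Then, with $\tilde\lambda^R=\lambda^R+\mu c(x^R)$, $$\mathbb E_{R;u^{[K]},\xi^{[K]}}\big[\|\mathcal G_X(x^R,\nabla f(x^R)+\nabla c(x^R)^\top\tilde\lambda^R,\eta)\|_q^2\big]\le(4L_f^2+3\eta^{-2})\nu^2\,\mathbb E_u[\|u\|_2^6]+\frac{30(p-1)\tilde\sigma^2}{n_0\alpha K}+\frac{60\alpha(p-1)\tilde\sigma^2}{n}+\frac{27\Delta_0}{\eta K}.$$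
   Context: Problem. Let $d\ge3$ and $m\ge1$. Consider $\min_{x\in X}\Phi(x):=f(x)+h(x)$ subject to $c(x)=0$, where $f(x)=\mathbb E_\xi[F(x;\xi)]$, $X\subset\mathbb R^d$ is convex, $f:\mathbb R^d\to\mathbb R$ and $c=(c_1,\ldots,c_m):\mathbb R^d\to\mathbb R^m$ are continuously differentiable, $\xi\sim\mathbb P$ is a random variable independent of $x$, $F(\cdot;\xi)$ is continuously differentiable for almost every $\xi$, and $h:\mathbb R^d\to\mathbb R\cup\{\infty\}$ is convex. Write $\nabla c(x)^\top\lambda=\sum_i\lambda_i\nabla c_i(x)$. Let $\mathbb P_u$ be the sampling distribution of a random vector $u\in\mathbb R^d$; for $\nu>0$ let $X_\nu=\{x+t\nu u: x\in X,\ t\in[0,1],\ u\text{ in the range of }\mathbb P_u\}$ and let $\mathcal O_\nu$ be an open set containing $X_\nu$. Assumptions. (A1) $X$ is nonempty, closed, convex and $\|x\|_q\le D_X$ for all $x\in X$ ($D_X>0$). $\|\nabla f(x)-\nabla f(y)\|_2\le L_f\|x-y\|_2$ and $|f(x)-f(y)|\le M_f\|x-y\|_2$ for all $x,y\in\mathcal O_\nu$ ($L_f,M_f>0$). $h$ is proper, lower semicontinuous and convex over $X$, and for all $x\in X$, $\partial h(x)\neq\emptyset$ and $\sup_{g\in\partial h(x)}\|g\|_2\le M_h$ ($M_h>0$). For $i=1,\ldots,m$ and $x,y\in X$: $|c_i(x)|\le\bar M_c$, $\|\nabla c_i(x)\|_2\le M_c$, $\|\nabla c_i(x)-\nabla c_i(y)\|_2\le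 L_c\|x-y\|_2$ ($\bar M_c,M_c,L_c>0$). $\Phi$ has a finite lower bound $\Phi_{\inf}$ over $X$. (A2) For all $x\in\mathcal O_\nu$: $\mathbb E_\xi[\nabla F(x;\xi)]=\nabla f(x)$ and $\mathbb E_\xi[\|\nabla F(x;\xi)-\nabla f(x)\|_2^2]\le\sigma^2$ ($\sigma>0$). (A3) $(\mathbb E_\xi[\|\nabla F(x;\xi)-\nabla F(y;\xi)\|_2^2])^{1/2}\le L_f\|x-y\|_2$ for all $x,y\in\mathcal O_\nu$. (A4) There is a constant $S_p\ge1$ with $\mathbb E_u[\|\langle g,u\rangle u\|_p^2]\le S_p\|g\|_2^2$ for all $g\in\mathbb R^d$; moreover $\mathbb E_u[uu^\top]=I_d$ and $\mathbb E_u[\|u\|_2^6]<\infty$. (A5) The distance-generating function $v:\mathbb R^d\to\mathbb R$ satisfies $\langle x-y,\nabla v(x)-\nabla v(y)\rangle\ge\|x-y\|_q^2$ for all $x,y\in\mathbb R^d$ and $\|\nabla v(x)-\nabla v(y)\|_p\le L_v\|x-y\|_q$ for all $x,y\in X$. Algorithm. Let $G_\nu(x;u,\xi)=\frac{F(x+\nu u;\xi)-F(x;\xi)}{\nu}u$ and $V(x,y)=v(y)-v(x)-\langle\nabla v(x),y-x\rangle$. Inputs: $x^0\in X$, $\lambda^0=0\in\mathbb R^m$, $\mu,\eta,\nu>0$, $\alpha\in(0,1]$, $\rho_k\in(0,\mu)$, positive integers $K,n_0,n$. All random directions $u_j^k\sim\mathbb P_u$ and samples $\xi_j^k\sim\mathbb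 P$ are mutually independent. For $k=0,\ldots,K-1$: $s^0=\frac1{n_0}\sum_{j=1}^{n_0}G_\nu(x^0;u_j^0,\xi_j^0)$, and for $k\ge1$, $s^k=\frac1n\sum_{j=1}^n[G_\nu(x^k;u_j^k,\xi_j^k)+(1-\alpha)(s^{k-1}-G_\nu(x^{k-1};u_j^k,\xi_j^k))]$; $x^{k+1}=\arg\min_{x\in X}\langle s^k+\nabla c(x^k)^\top(\lambda^k+\mu c(x^k)),x\rangle+h(x)+\frac1\eta V(x^k,x)$; $\lambda^{k+1}=\lambda^k+\rho_kc(x^k)$. Output $x^R$, with $R$ uniform on $\{0,\ldots,K-1\}$. $\mathbb E_{R;u^{[K]},\xi^{[K]}}$ denotes expectation over $R$ and all directions and samples of iterations $0,\ldots,K-1$. Notation. $\mathcal L(x,\lambda;\mu)=f(x)+h(x)+\lambda^\top c(x)+\frac\mu2\|c(x)\|_2^2$; $L_\mu=L_f+m(\mu M_c^2+\mu\bar M_cL_c+\rho\bar M_cL_c)$; $\Delta_0=\mathcal L(x^0,\lambda^0;\mu)-\Phi_{\inf}+2m\rho\bar M_c^2$; $\tilde\sigma^2=\nu^2L_f^2\,\mathbb E_u[\|u\|_2^6]+4S_p(\sigma^2+M_f^2)+2M_f^2$; $\mathcal G_X(x,g,\eta)=\frac1\eta(x-x^+)$ with $x^+=\arg\min_{y\in X}\langle g,y\rangle+h(y)+\frac1\eta V(x,y)$. *)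

(* Defs.v *)
From HB Require Import structures.
From mathcomp Require Import all_boot all_order all_algebra finmap.
From mathcomp Require Import all_classical all_reals all_analysis.

Set Implicit Arguments.
Unset Strict Implicit.
Unset Printing Implicit Defensive.

Import Order.TTheory GRing.Theory Num.Theory.
Import numFieldNormedType.Exports.

Local Open Scope classical_set_scope.
Local Open Scope ring_scope.

(* Matrices, hence the row vectors of R^d, carry their Borel sigma-algebra. *)
HB.instance Definition _ (R : realType) (m n : nat) :=
  @isMeasurable.Build (sigma_display (@open 'M[R]_(m, n))) 'M[R]_(m, n)
    <<s @open 'M[R]_(m, n) >>
    (@sigma_algebra0 _ setT _) (@sigma_algebraC _ _)
    (@sigma_algebra_bigcup _ setT _).

Definition dotv (R : realType) (d : nat) (x y : 'rV[R]_d) : R :=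
  \sum_(i < d) x 0 i * y 0 i.

(* The norm `|x| which the library puts on 'rV[R]_d is the sup norm. *)
Definition lpnorm (R : realType) (d : nat) (p : R) (x : 'rV[R]_d) : R :=
  (\sum_(i < d) `|x 0 i| `^ p) `^ p^-1.

Definition grad (R : realType) (d : nat) (f : 'rV[R]_d -> R) (x : 'rV[R]_d) :
    'rV[R]_d :=
  \row_(i < d) 'D_(delta_mx 0 i) f x.

Definition cont_diff (R : realType) (d : nat) (f : 'rV[R]_d -> R) : Prop :=
  (forall x, differentiable f x) /\ continuous (grad f).

(* With lambda a row of multipliers this is Jc(x)^T lambda. *)
Definition grad_constr (R : realType) (d m : nat) (c : 'rV[R]_d -> 'rV[R]_m)
    (x : 'rV[R]_d) (lambda : 'rV[R]_m) : 'rV[R]_d :=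
  \sum_(i < m) lambda 0 i *: grad (fun y => c y 0 i) x.

Definition econvex (R : realType) (d : nat) (h : 'rV[R]_d -> \bar R) : Prop :=
  forall (x y : 'rV[R]_d) (t : R), 0 <= t -> t <= 1 ->
    (h (t *: x + (1 - t) *: y)%R <= t%:E * h x + (1 - t)%:E * h y)%E.

Definition lower_semicontinuous_on (R : realType) (d : nat)
    (X : set 'rV[R]_d) (h : 'rV[R]_d -> \bar R) : Prop :=
  forall (x : 'rV[R]_d) (a : R), X x -> (a%:E < h x)%E ->
    \forall y \near within X (nbhs x), (a%:E < h y)%E.

(* Empty outside of the domain of h, as usual. *)
Definition subdifferential (R : realType) (d : nat) (h : 'rV[R]_d -> \bar R)
    (x : 'rV[R]_d) : set 'rV[R]_d :=
  [set g | h x \is a fin_num /\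
           forall y, (h x + (dotv g (y - x))%:E <= h y)%E].

(* The canonical choice of a minimiser; an arbitrary point if there is none. *)
Definition argmin (R : realType) (d : nat) (X : set 'rV[R]_d)
    (obj : 'rV[R]_d -> \bar R) : 'rV[R]_d :=
  get [set x | X x /\ forall y, X y -> (obj x <= obj y)%E].

Definition bregman (R : realType) (d : nat) (v : 'rV[R]_d -> R)
    (x y : 'rV[R]_d) : R :=
  v y - v x - dotv (grad v x) (y - x).

Definition mirror_step (R : realType) (d : nat) (X : set 'rV[R]_d)
    (h : 'rV[R]_d -> \bar R) (v : 'rV[R]_d -> R) (eta : R)
    (x g : 'rV[R]_d) : 'rV[R]_d :=
  argmin X (fun y => (dotv g y)%:E + h y + (eta^-1 * bregman v x y)%:E)%E.

Definition grad_mapping (R : realType) (d : nat) (X : set 'rV[R]_d)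
    (h : 'rV[R]_d -> \bar R) (v : 'rV[R]_d -> R)
    (x g : 'rV[R]_d) (eta : R) : 'rV[R]_d :=
  eta^-1 *: (x - mirror_step X h v eta x g).

Definition zo_grad (R : realType) (d : nat) (Xi : Type)
    (F : 'rV[R]_d -> Xi -> R) (nu : R) (x u : 'rV[R]_d) (xi : Xi) : 'rV[R]_d :=
  ((F (x + nu *: u) xi - F x xi) / nu) *: u.

Definition aug_lagrangian (R : realType) (d m : nat) (f : 'rV[R]_d -> R)
    (h : 'rV[R]_d -> \bar R) (c : 'rV[R]_d -> 'rV[R]_m)
    (x : 'rV[R]_d) (lambda : 'rV[R]_m) (mu : R) : \bar R :=
  ((f x)%:E + h x + (dotv lambda (c x))%:E
    + (mu / 2 * lpnorm 2 (c x) ^+ 2)%:E)%E.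

(* Topological support: the range of values of a random vector of law P. *)
Definition msupport (R : realType) (d : nat) (P : probability 'rV[R]_d R) :
    set 'rV[R]_d :=
  [set x | forall U : set 'rV[R]_d, open U -> U x -> (0 < P U)%E].

Definition smoothing_region (R : realType) (d : nat) (X : set 'rV[R]_d)
    (Pu : probability 'rV[R]_d R) (nu : R) : set 'rV[R]_d :=
  [set z | exists x t u, [/\ X x, 0 <= t <= 1, msupport Pu u
                           & z = x + (t * nu) *: u]].

Record iterate (R : realType) (d m : nat) := Iterate {
  it_x : 'rV[R]_d ;
  it_lambda : 'rV[R]_m ;
  it_s : 'rV[R]_d }.

Definition batch (n0 n k : nat) : nat := if k is 0 then n0 else n.

(* The triple (x^k, lambda^k, s^k) along one realisation u, xi of the samples; *)
(* u k j and xi k j are used for j < batch n0 n k only.                        *)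
Fixpoint mdlal (R : realType) (d m : nat) (Xi : Type)
    (F : 'rV[R]_d -> Xi -> R) (h : 'rV[R]_d -> \bar R)
    (c : 'rV[R]_d -> 'rV[R]_m) (v : 'rV[R]_d -> R) (X : set 'rV[R]_d)
    (x0 : 'rV[R]_d) (mu eta nu alpha : R) (rho_ : nat -> R) (n0 n : nat)
    (u : nat -> nat -> 'rV[R]_d) (xi : nat -> nat -> Xi) (k : nat) :
    iterate R d m :=
  match k with
  | 0 =>
    Iterate x0 0
      (n0%:R^-1 *: \sum_(j < n0) zo_grad F nu x0 (u 0 j) (xi 0 j))
  | k'.+1 =>
    let: Iterate x lambda s :=
      mdlal F h c v X x0 mu eta nu alpha rho_ n0 n u xi k' in
    let x' :=
      mirror_step X h v eta x (s + grad_constr c x (lambda + mu *: c x)) in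
    Iterate x' (lambda + rho_ k' *: c x)
      (n%:R^-1 *: \sum_(j < n)
        (zo_grad F nu x' (u k j) (xi k j)
         + (1 - alpha) *: (s - zo_grad F nu x (u k j) (xi k j))))
  end.

Definition mutually_independent (dO : measure_display)
    (Omega : measurableType dO) (R : realType) (P : probability Omega R)
    (I : choiceType) (D : set I) (G : I -> set (set Omega)) : Prop :=
  forall (J : {fset I}) (A : I -> set Omega),
    [set` J] `<=` D -> (forall i, i \in J -> G i (A i)) ->
    P (\bigcap_(i in [set` J]) A i) = (\prod_(i <- J) fine (P (A i)))%:E.

(* A source of randomness: inl (inl (k, j)) is the direction u_j^k,  *)
(* inl (inr (k, j)) the sample xi_j^k, and inr tt the output index.  *)
Definition source : choiceType := (nat * nat + nat * nat + unit)%type.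

Definition sources (K n0 n : nat) : set source :=
  [set i | match i with
           | inl (inl (k, j)) | inl (inr (k, j)) =>
               (k < K)%N && (j < batch n0 n k)%N
           | inr _ => true
           end].

Definition source_sigma_algebra (dO dX : measure_display)
    (Omega : measurableType dO) (Xi : measurableType dX) (R : realType)
    (d : nat) (u : nat -> nat -> Omega -> 'rV[R]_d)
    (xi : nat -> nat -> Omega -> Xi) (idx : Omega -> nat) (i : source) :
    set (set Omega) :=
  match i with
  | inl (inl (k, j)) => preimage_set_system setT (u k j) measurable
  | inl (inr (k, j)) => preimage_set_system setT (xi k j) measurable
  | inr _ => preimage_set_system setT idx measurable
  end.

(* Main.v *)
(* Idea. The squared l^p norm is 2-smooth with constant p - 1, so E|a + Z|_p^2  *)
(* <= |a|_p^2 + (p - 1) E|Z|_p^2 for centred Z. Let g(x) be the mean of          *)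
(* G_nu(x; u, xi) and eps_k = s^k - g(x^k). The recursive momentum estimator     *)
(* satisfies eps_k = (1 - alpha) eps_(k-1) + an average of n centred increments  *)
(* whose second moment is O(alpha^2 sigma2) + O((1 - alpha)^2 |x^k - x^(k-1)|^2),*)
(* while |g - grad f| = O(nu); the samples of iteration k being fresh, this is a *)
(* recursion for E|eps_k|_p^2. Pathwise, the optimality condition of the mirror  *)
(* step makes the augmented Lagrangian decrease by                               *)
(* 3/(8 eta) |x^k - x^(k+1)|_q^2 up to (2 eta/3) |s^k - grad f(x^k)|_p^2. The    *)
(* lower bound on n lets the two averages absorb each other, and the gradient    *)
(* mapping is at most 7/3 |s^k - grad f(x^k)|_p^2 + 7/4 |x^k - x^(k+1)|_q^2 /    *)
(* eta^2, the mirror step being eta-Lipschitz in the gradient.                   *)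

Require Import Defs.
From HB Require Import structures.
From mathcomp Require Import all_boot all_order all_algebra finmap ring lra.
From mathcomp Require Import all_classical all_reals all_analysis measurable_realfun.

Set Implicit Arguments.
Unset Strict Implicit.
Unset Printing Implicit Defensive.

Import Order.TTheory GRing.Theory Num.Theory.
Import numFieldNormedType.Exports.

Local Open Scope classical_set_scope.
Local Open Scope ring_scope.

(** Three mean squares feed one another: that of the error eps_k of the estimator around the
    smoothed gradient (l^p norm), of the step x^k - x^(k+1) (l^q norm), and of s^k - grad f(x^k)
    (l^p norm). Let A, B, E be their sums over k < K, and M = nu^2 E|u|^6. The summed momentum
    recursion gives A <= Q + K M / (8 eta^2) + B / (16 eta^2), where Q collects the noise of the
    first batch and of the later ones; the bias bound gives E <= 2 A + K L_f^2 M / 2; descent gives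
    B / eta^2 <= 8/3 Delta0 / eta + 16/9 E. Around this loop E is multiplied by 2/9, the product of
    2, 1/16 and 16/9, so everything is bounded by Q, Delta0 and M ([complexity_arithmetic]).

    The recursion rests on [pnorm_smooth], whose constant p - 1 comes from the scalar inequality
    [two_point]. The square of the part already known keeps coefficient 1 there, so samples can be
    added one at a time and a batch of N costs (p - 1) / N without compounding
    ([batch_average_bound]). The moments of a single sample come from splitting the estimator into
    <grad F, u> u and a Taylor remainder times u: the anisotropy bound controls the first,
    [L2_remainder] and the sixth moment of u the second ([G_variance], [G_difference], [gbar_bias]).

    Descent is deterministic along each realisation: [one_step_descent] is summed in
    [trajectory_sum], the multipliers staying below rho Mbar_c.

    Conditioning is expressed by [fresh_sample]: a sample not yet used can be integrated out with
    the current state frozen. Finally F, which is C^1 for almost every sample only, is replaced by a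
    version that is C^1 for every sample; almost surely the run is the same. *)

(** * l^p norms *)

(* A sealed copy of lpnorm: without it, failing conversion tests between two  *)
(* norms unfold the real powers.                                              *)
HB.lock Definition pnorm (R : realType) (d : nat) (p : R) (x : 'rV[R]_d) : R :=
  lpnorm p x.

Section lpnorm_theory.
Context {R : realType} {d : nat}.
Implicit Types (x y z : 'rV[R]_d) (p q r : R).

Lemma one_powR r : 1 `^ r = 1 :> R.
Proof. by rewrite powR1. Qed.

Lemma ler_powR_base r (a b : R) : 0 <= r -> 0 <= a -> a <= b -> a `^ r <= b `^ r.
Proof.
by move=> r0 a0 ab; apply: ge0_ler_powR => //; rewrite nnegrE// (le_trans a0).
Qed.

Lemma powR_le1 r (a : R) : 0 <= r -> 0 <= a -> a <= 1 -> a `^ r <= 1.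
Proof. by move=> r0 a0 a1; rewrite -(one_powR r) ler_powR_base// one_powR. Qed.

Lemma powR_convex r (t a b : R) : 1 <= r -> 0 <= t -> t <= 1 -> 0 <= a -> 0 <= b ->
  (t * a + (1 - t) * b) `^ r <= t * a `^ r + (1 - t) * b `^ r.
Proof.
move=> r1 t0 t1 a0 b0; have := @convex_powR R r r1 (Itv01 t0 t1) a b.
by rewrite !inE/= !in_itv/= a0 b0 => /(_ isT isT); rewrite !convRE.
Qed.

Lemma lpnormE : @lpnorm R d = @pnorm R d.
Proof. by rewrite pnorm.unlock. Qed.

Lemma pnormE p x : pnorm p x = (\sum_(i < d) `|x 0 i| `^ p) `^ p^-1.
Proof. by rewrite -lpnormE. Qed.

Lemma dotvE x y : dotv x y = \sum_(i < d) x 0 i * y 0 i.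
Proof. by []. Qed.

Lemma pnorm_ge0 p x : 0 <= pnorm p x.
Proof. by rewrite pnormE powR_ge0. Qed.

Lemma sum_powR_ge0 p x : 0 <= \sum_(i < d) `|x 0 i| `^ p.
Proof. by apply: sumr_ge0 => i _; exact: powR_ge0. Qed.

Lemma powR_pnorm p x : p != 0 -> pnorm p x `^ p = \sum_(i < d) `|x 0 i| `^ p.
Proof. by move=> p0; rewrite !pnormE -powRrM mulVf// powRr1// sum_powR_ge0. Qed.

Lemma pnormZ p a x : p != 0 -> pnorm p (a *: x) = `|a| * pnorm p x.
Proof.
move=> p0; rewrite !pnormE.
under eq_bigr do rewrite mxE normrM powRM//.
rewrite -mulr_sumr powRM ?powR_ge0 ?sum_powR_ge0// -powRrM mulfV//.
by rewrite powRr1.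
Qed.

Lemma pnorm0 p : p != 0 -> pnorm p (0 : 'rV[R]_d) = 0.
Proof. by move=> p0; rewrite -[0 in LHS](scale0r 0) pnormZ// normr0 mul0r. Qed.

Lemma pnormN p x : p != 0 -> pnorm p (- x) = pnorm p x.
Proof. by move=> p0; rewrite -scaleN1r pnormZ// normrN1 mul1r. Qed.

Lemma pnorm_distC p x y : p != 0 -> pnorm p (x - y) = pnorm p (y - x).
Proof. by move=> p0; rewrite -opprB pnormN. Qed.

Lemma norm_coord_pnorm p x i : 0 < p -> `|x 0 i| <= pnorm p x.
Proof.
move=> p0; rewrite -[leLHS](@powRr1 _ `|x 0 i|)// -[X in _ `^ X](@mulfV _ p) ?gt_eqF//.
rewrite powRrM pnormE ler_powR_base ?invr_ge0 ?powR_ge0 ?(ltW p0)//.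
by rewrite (bigD1 i)//= lerDl sumr_ge0// => j _; exact: powR_ge0.
Qed.

Lemma pnorm_eq0 p x : 0 < p -> pnorm p x = 0 -> x = 0.
Proof.
move=> p0 x0; apply/rowP => i; rewrite mxE; apply/eqP.
by rewrite -normr_eq0 eq_le normr_ge0 andbT -x0 norm_coord_pnorm.
Qed.

Lemma pnorm_gt0 p x : 0 < p -> x != 0 -> 0 < pnorm p x.
Proof.
move=> p0 x0; rewrite lt_neqAle pnorm_ge0 andbT eq_sym.
by apply: contra x0 => /eqP/(pnorm_eq0 p0)->.
Qed.

Lemma pnorm_unit p x : 0 < p -> x != 0 ->
  pnorm p ((pnorm p x)^-1 *: x) = 1.
Proof.
move=> p0 x0; rewrite pnormZ ?gt_eqF// ger0_norm ?invr_ge0 ?pnorm_ge0//.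
by rewrite mulVf// gt_eqF// pnorm_gt0.
Qed.

Lemma dotvC x y : dotv x y = dotv y x.
Proof. by apply: eq_bigr => i _; rewrite mulrC. Qed.

Lemma dotvDr x y z : dotv x (y + z) = dotv x y + dotv x z.
Proof. by rewrite /dotv -big_split; apply: eq_bigr => i _ /=; rewrite mxE mulrDr. Qed.

Lemma dotvDl x y z : dotv (y + z) x = dotv y x + dotv z x.
Proof. by rewrite dotvC dotvDr !(dotvC x). Qed.

Lemma dotvZr a x y : dotv x (a *: y) = a * dotv x y.
Proof. by rewrite /dotv mulr_sumr; apply: eq_bigr => i _ /=; rewrite mxE mulrCA. Qed.

Lemma dotvZl a x y : dotv (a *: x) y = a * dotv x y.
Proof. by rewrite dotvC dotvZr dotvC. Qed.

Lemma dotvNr x y : dotv x (- y) = - dotv x y.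
Proof. by rewrite -scaleN1r dotvZr mulN1r. Qed.

Lemma dotvNl x y : dotv (- x) y = - dotv x y.
Proof. by rewrite dotvC dotvNr dotvC. Qed.

Lemma dotvBr x y z : dotv x (y - z) = dotv x y - dotv x z.
Proof. by rewrite dotvDr dotvNr. Qed.

Lemma dotvBl x y z : dotv (y - z) x = dotv y x - dotv z x.
Proof. by rewrite dotvDl dotvNl. Qed.

Lemma dotv0r x : dotv x 0 = 0.
Proof. by rewrite -(scale0r 0) dotvZr mul0r. Qed.

Lemma dotv0l x : dotv 0 x = 0.
Proof. by rewrite dotvC dotv0r. Qed.

(** Both sides are homogeneous in x and in y, so unit norms may be assumed. Young's inequality in
    each coordinate then sums to 1/p + 1/q = 1. *)
Lemma hoelder_dotv p q x y : 0 < p -> 0 < q -> p^-1 + q^-1 = 1 ->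
  `|dotv x y| <= pnorm p x * pnorm q y.
Proof.
move=> p0 q0 pq.
have [->|x0] := eqVneq x 0; first by rewrite dotv0l normr0 mulr_ge0 ?pnorm_ge0.
have [->|y0] := eqVneq y 0; first by rewrite dotv0r normr0 mulr_ge0 ?pnorm_ge0.
wlog : x y x0 y0 / pnorm p x = 1 /\ pnorm q y = 1 => [wl|[x1 y1]].
  set a := pnorm p x; set b := pnorm q y.
  have a0 : 0 < a by exact: pnorm_gt0.
  have b0 : 0 < b by exact: pnorm_gt0.
  have ax0 : a^-1 *: x != 0 by rewrite scaler_eq0 invr_eq0 negb_or (gt_eqF a0).
  have by0 : b^-1 *: y != 0 by rewrite scaler_eq0 invr_eq0 negb_or (gt_eqF b0).
  have {wl} := wl _ _ ax0 by0 (conj (pnorm_unit p0 x0) (pnorm_unit q0 y0)).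
  rewrite (pnorm_unit p0 x0) (pnorm_unit q0 y0).
  clearbody a b.
  rewrite mul1r dotvZl dotvZr !normrM.
  rewrite (ger0_norm (ltW (_ : 0 < a^-1))) ?invr_gt0//.
  rewrite (ger0_norm (ltW (_ : 0 < b^-1))) ?invr_gt0//.
  by rewrite mulrA -invfM mulrC ler_pdivrMr ?mulr_gt0// mul1r mulrC (mulrC b).
rewrite x1 y1 mulr1 -pq; apply: (le_trans (ler_norm_sum _ _ _)).
apply: (@le_trans _ _ (\sum_(i < d) (`|x 0 i| `^ p / p + `|y 0 i| `^ q / q))).
  by apply: ler_sum => i _; rewrite normrM conjugate_powR.
rewrite big_split/= -!mulr_suml -!powR_pnorm ?gt_eqF// x1 y1 !one_powR.
by rewrite !div1r.
Qed.

(** With a and b the two norms, (x + y) / (a + b) is the convex combination, with weight a / (a +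
    b), of the unit vectors x / a and y / b; convexity of the r-th power in each coordinate keeps it
    in the unit ball. *)
Lemma pnormD r x y : 1 <= r -> pnorm r (x + y) <= pnorm r x + pnorm r y.
Proof.
move=> r1; have r0 : 0 < r by exact: lt_le_trans r1.
have [->|x0] := eqVneq x 0; first by rewrite add0r pnorm0 ?gt_eqF// add0r.
have [->|y0] := eqVneq y 0; first by rewrite addr0 pnorm0 ?gt_eqF// addr0.
set a := pnorm r x; set b := pnorm r y.
have a0 : 0 < a by exact: pnorm_gt0.
have b0 : 0 < b by exact: pnorm_gt0.
have x1 : pnorm r (a^-1 *: x) = 1 by exact: pnorm_unit.
have y1 : pnorm r (b^-1 *: y) = 1 by exact: pnorm_unit.
clearbody a b.
have ab0 : 0 < a + b by exact: addr_gt0.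
rewrite -[leRHS]mulr1 -ler_pdivrMl//.
rewrite -[(a + b)^-1]ger0_norm ?invr_ge0 ?(ltW ab0)// -pnormZ ?gt_eqF//.
rewrite !pnormE; apply: powR_le1; rewrite ?invr_ge0 ?sum_powR_ge0 ?(ltW r0)//.
pose t := a / (a + b).
have t0 : 0 <= t by rewrite divr_ge0 ?ltW.
have t1 : t <= 1 by rewrite ler_pdivrMr// mul1r lerDl ltW.
have t1E : 1 - t = b / (a + b).
  by rewrite -[1 in LHS](@divff _ (a + b)) ?gt_eqF// -mulrBl addrC addKr.
apply: (@le_trans _ _
    (\sum_(i < d) (t * (`|(a^-1 *: x) 0 i| `^ r) + (1 - t) * (`|(b^-1 *: y) 0 i| `^ r)))).
  apply: ler_sum => i _.
  apply: le_trans (powR_convex r1 t0 t1 (normr_ge0 _) (normr_ge0 _)).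
  rewrite ler_powR_base ?(ltW r0)//.
  have N (u : R) : 0 < u -> `|u^-1| = u^-1 by move=> u0; rewrite gtr0_norm ?invr_gt0.
  have E (u v w : R) : 0 < u -> (u / w) * (u^-1 * v) = w^-1 * v.
    by move=> u0; rewrite mulrA (mulrAC u) mulfV ?mul1r// gt_eqF.
  by rewrite t1E !mxE !normrM !N// !E// -mulrDr ler_pM2l ?invr_gt0// ler_normD.
rewrite big_split/= -!mulr_sumr -!powR_pnorm ?gt_eqF// x1 y1.
by rewrite !one_powR !mulr1 subrKC.
Qed.

Lemma pnormB r x y : 1 <= r -> pnorm r (x - y) <= pnorm r x + pnorm r y.
Proof.
move=> r1; apply: (le_trans (pnormD _ _ r1)); rewrite pnormN//.
by rewrite gt_eqF// (lt_le_trans _ r1).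
Qed.

(** After scaling to unit l^p norm every coordinate is at most 1 in absolute value, where a larger
    exponent gives a smaller power. *)
Lemma pnorm_le p r x : 0 < p -> p <= r -> pnorm r x <= pnorm p x.
Proof.
move=> p0 pr; have r0 : 0 < r by exact: lt_le_trans pr.
have [->|x0] := eqVneq x 0; first by rewrite !pnorm0 ?gt_eqF.
set a := pnorm p x; have a0 : 0 < a by exact: pnorm_gt0.
have x1 : pnorm p (a^-1 *: x) = 1 by exact: pnorm_unit.
clearbody a.
rewrite -[leRHS]mulr1 -ler_pdivrMl//.
rewrite -[a^-1]ger0_norm ?invr_ge0 ?(ltW a0)// -pnormZ ?gt_eqF//.
rewrite !pnormE; apply: powR_le1; rewrite ?invr_ge0 ?sum_powR_ge0 ?(ltW r0)//.
rewrite -[leRHS](one_powR p) -[X in _ <= X `^ _]x1 powR_pnorm ?gt_eqF//.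
apply: ler_sum => i _.
have : `|(a^-1 *: x) 0 i| <= 1.
  by rewrite -x1 norm_coord_pnorm.
have [->|xi0] := eqVneq `|(a^-1 *: x) 0 i| 0; first by rewrite !powR0 ?gt_eqF.
by move=> xi1; apply: ger_powR => //; rewrite xi1 lt_neqAle eq_sym xi0 normr_ge0.
Qed.

Lemma pnorm2_sqr x : pnorm 2 x ^+ 2 = dotv x x.
Proof.
rewrite -powR_mulrn ?pnorm_ge0// powR_pnorm//; apply: eq_bigr => i _.
by rewrite powR_mulrn// real_normK ?num_real// expr2.
Qed.

Lemma dotv_sqrE x : dotv x x = pnorm 2 x ^+ 2.
Proof. by rewrite pnorm2_sqr. Qed.

Lemma cauchy_dotv x y : `|dotv x y| <= pnorm 2 x * pnorm 2 y.
Proof. by apply: hoelder_dotv => //; field. Qed.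

Lemma pnorm_le_sum p x : 1 <= p -> pnorm p x <= \sum_(i < d) `|x 0 i|.
Proof.
move=> p1; apply: (le_trans (pnorm_le _ ltr01 p1)).
by rewrite !pnormE invr1 powRr1 ?sum_powR_ge0//; under eq_bigr do rewrite powRr1//.
Qed.

End lpnorm_theory.

Ltac gen_norms := repeat (match goal with
  | |- context [pnorm ?p ?x] => let a := fresh "n" in move: (pnorm p x) => a
  | |- context [dotv ?x ?y] => let a := fresh "n" in move: (dotv x y) => a end).

(** * Scalar two-point inequality *)

Section two_point.
Context {R : realType}.
Implicit Types (a b p r : R).

Lemma is_derive_le (f df : R -> R) a b : a <= b ->
  (forall x, a <= x <= b -> is_derive x 1 f (df x)) ->
  (forall x, a < x < b -> 0 <= df x) -> f a <= f b.
Proof.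
move=> ab fdf df0; apply: (@ger0_derive1_ndecr R f a b) => //.
- by move=> x; rewrite in_itv/= => /andP[/ltW ax /ltW xb];
    apply: ex_derive; apply: fdf; rewrite ax.
- move=> x; rewrite in_itv/= => /andP[ax xb].
  have dx : is_derive x 1 f (df x) by apply: fdf; rewrite !ltW.
  by rewrite derive1E derive_val; apply: df0; rewrite ax.
- apply: derivable_within_continuous => x; rewrite in_itv/= => xab.
  by apply: ex_derive; exact: fdf.
Qed.

Lemma is_derive_powR_onep r b : -1 < b ->
  is_derive b 1 (fun b => (1 + b) `^ r) (r * (1 + b) `^ (r - 1)).
Proof.
move=> b1; have b0 : 0 < 1 + b by rewrite -ltrBlDl sub0r.
have d : is_derive b 1 (fun b => 1 + b) 1.
  by apply: is_derive_eq; rewrite /GRing.scale/=; ring.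
have := is_derive1_comp (is_derive1_powR r b0) d.
by rewrite mulr1.
Qed.

Lemma is_derive_powR_onem r b : b < 1 ->
  is_derive b 1 (fun b => (1 - b) `^ r) (- (r * (1 - b) `^ (r - 1))).
Proof.
move=> b1; have b0 : 0 < 1 - b by rewrite subr_gt0.
have d : is_derive b 1 (fun b => 1 - b) (- 1).
  by apply: is_derive_eq; rewrite /GRing.scale/=; ring.
have := @is_derive1_comp _ (@powR R ^~ r) (fun b => 1 - b) b _ _ (is_derive1_powR r b0) d.
by rewrite mulrN1.
Qed.

Lemma is_derive_powR_sqr r c b : 0 <= c ->
  is_derive b 1 (fun b => (1 + c * b ^+ 2) `^ r)
    (r * (1 + c * b ^+ 2) `^ (r - 1) * (2 * c * b)).
Proof.
move=> c0; have b0 : 0 < 1 + c * b ^+ 2.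
  by rewrite ltr_pwDl// mulr_ge0// sqr_ge0.
have d : is_derive b 1 (fun b => 1 + c * b ^+ 2) (2 * c * b).
  by apply: is_derive_eq; rewrite /GRing.scale/=; ring.
exact: (@is_derive1_comp _ (@powR R ^~ r) (fun b => 1 + c * b ^+ 2) b _ _ (is_derive1_powR r b0) d).
Qed.

(** With r = p - 1 this expression carries the sign of the derivative studied in [two_point]. It
    vanishes at b = 0, and its own derivative [dF] is nonnegative because the exponent r - 1 is. *)
Lemma powR_onep_onem_ge0 r b : 1 <= r -> 0 <= b -> b < 1 ->
  0 <= (1 + b) `^ r * (r * b - 1) + (1 - b) `^ r * (r * b + 1).
Proof.
move=> r1 b0 b1.
pose F b := (1 + b) `^ r * (r * b - 1) + (1 - b) `^ r * (r * b + 1).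
have F0 : F 0 = 0 by rewrite /F mulr0 addr0 subr0 !one_powR; ring.
rewrite -F0 -/(F b).
pose dF b := r * (r + 1) * b * ((1 + b) `^ (r - 1) - (1 - b) `^ (r - 1)).
apply: (@is_derive_le F dF) => // x /andP[x0 x1].
- have xb : x < 1 by rewrite (le_lt_trans x1).
  have x_gt : -1 < x by rewrite (lt_le_trans _ x0)// oppr_lt0.
  have d1 := is_derive_powR_onep r x_gt; have d2 := is_derive_powR_onem r xb.
  have d3 : is_derive x 1 (fun b => r * b - 1) r.
    by apply: is_derive_eq; rewrite /GRing.scale/=; ring.
  have d4 : is_derive x 1 (fun b => r * b + 1) r.
    by apply: is_derive_eq; rewrite /GRing.scale/=; ring.
  apply: (is_derive_eq (is_deriveD (is_deriveM d1 d3) (is_deriveM d2 d4))).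
  rewrite /GRing.scale/= /dF.
  have -> : (1 + x) `^ r = (1 + x) * (1 + x) `^ (r - 1) by rewrite mulr_powRB1//; lra.
  have -> : (1 - x) `^ r = (1 - x) * (1 - x) `^ (r - 1) by rewrite mulr_powRB1//; lra.
  by ring.
- rewrite /dF mulr_ge0//; first by apply: mulr_ge0; [nra|lra].
  rewrite subr_ge0 ler_powR_base//; lra.
Qed.

Lemma powR_mulB1 r a : 0 < a -> a `^ r = a * a `^ (r - 1).
Proof.
move=> a0; rewrite powRB ?(gt_eqF a0) ?implybT// powRr1 ?(ltW a0)//.
by rewrite mulrCA mulfV ?mulr1// gt_eqF.
Qed.

(** The endpoint b = 1 of [two_point]. With s = p / 2 and logarithms it reads (s - 1) ln 2 <= s ln
    s, which follows from ln s >= 1 - 1/s and ln 2 <= 1. *)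
Lemma two_pow_le p : 2 <= p -> 2 `^ p <= 2 * p `^ (p / 2).
Proof.
move=> p2; pose s := p / 2; have pE : p = 2 * s by rewrite /s; field.
have s1 : 1 <= s by rewrite /s; lra.
have s0 : 0 < s by lra.
have p0 : 0 < p by lra.
rewrite -/s pE powRM ?(ltW s0)//.
have -> : 2 `^ (2 * s) = 2 `^ s * 2 `^ s :> R.
  by rewrite -powRD ?implybT//; [congr powR; ring | apply/implyP].
rewrite mulrCA ler_pM2l ?powR_gt0//.
rewrite -[leLHS]lnK ?posrE ?powR_gt0// -[leRHS]lnK ?posrE ?mulr_gt0 ?powR_gt0//.
rewrite ler_expR lnM ?posrE ?powR_gt0// !ln_powR.
have ls : 1 - s^-1 <= ln s.
  have : ln (s^-1) <= s^-1 - 1.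
    have := @le_ln1Dx R (s^-1 - 1); rewrite subrKC; apply.
    by rewrite ltrBrDl subrr invr_gt0.
  by rewrite lnV ?posrE//; lra.
have l2 : ln 2 <= 1 :> R.
  by have := @le_ln1Dx R 1; rewrite (_ : 1 + 1 = 2); [apply; lra|ring].
have : s * (1 - s^-1) <= s * ln s by rewrite ler_pM2l.
have : s * s^-1 = 1 by rewrite mulfV// gt_eqF.
nra.
Qed.

(** The quotient of the left side by (1 + (p - 1) b^2)^(p/2) equals 2 at b = 0 and does not increase
    on [0, 1); [F] is its opposite. The endpoint b = 1 is treated apart, since differentiating the
    real power (1 - b)^p requires 1 - b > 0. *)
Lemma two_point p b : 2 <= p -> 0 <= b -> b <= 1 ->
  (1 + b) `^ p + (1 - b) `^ p <= 2 * (1 + (p - 1) * b ^+ 2) `^ (p / 2).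
Proof.
move=> p2 b0; rewrite le_eqVlt => /predU1P[->|b1].
  rewrite subrr powR0 ?addr0; last by apply/eqP; lra.
  rewrite expr1n mulr1 subrKC; exact: two_pow_le.
have c0 : 0 <= p - 1 by lra.
pose A x := (1 + x) `^ p + (1 - x) `^ p.
pose F x := - (A x * (1 + (p - 1) * x ^+ 2) `^ (- (p / 2))).
pose dA x := p * ((1 + x) `^ (p - 1) - (1 - x) `^ (p - 1)).
pose dB x := - (p / 2) * (1 + (p - 1) * x ^+ 2) `^ (- (p / 2) - 1) * (2 * (p - 1) * x).
pose dF x := - (A x * dB x + (1 + (p - 1) * x ^+ 2) `^ (- (p / 2)) * dA x).
have FF : F 0 <= F b.
  apply: (@is_derive_le F dF) => // x /andP[x0 x1].
  - have xb : x < 1 by rewrite (le_lt_trans x1).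
    have x_gt : -1 < x by rewrite (lt_le_trans _ x0)// oppr_lt0.
    have d1 := is_derive_powR_onep p x_gt; have d2 := is_derive_powR_onem p xb.
    have d3 := is_derive_powR_sqr (- (p / 2)) x c0.
    have d4 : is_derive x 1 A (dA x).
      by apply: (is_derive_eq (is_deriveD d1 d2)); rewrite /dA; ring.
    apply: (is_derive_eq (is_deriveN (is_deriveM d4 d3))).
    by rewrite /GRing.scale/= /dF /dB; ring.
  - set q := 1 + (p - 1) * x ^+ 2; have qE : q = 1 + (p - 1) * x ^+ 2 by [].
    have q0 : 0 < q by rewrite ltr_pwDl// mulr_ge0// sqr_ge0.
    have x01 : 0 < x by [].
    have xb : x < 1 by rewrite (lt_trans x1).
    have r1 : 1 <= p - 1 by lra.
    have := powR_onep_onem_ge0 r1 (ltW x01) xb.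
    rewrite /dF /dB /dA /A -/q.
    rewrite (powR_mulB1 (- (p / 2)) q0).
    clearbody q.
    have -> : (1 + x) `^ p = (1 + x) * (1 + x) `^ (p - 1) by rewrite mulr_powRB1//; lra.
    have -> : (1 - x) `^ p = (1 - x) * (1 - x) `^ (p - 1) by rewrite mulr_powRB1//; lra.
    set a := (1 + x) `^ (p - 1); set c := (1 - x) `^ (p - 1).
    have : 0 <= q `^ (- (p / 2) - 1) by exact: powR_ge0.
    set Q := q `^ _ => Q0 H.
    (* Once a factor [q] is extracted from the power, the derivative is a nonnegative multiple of
       the expression of [powR_onep_onem_ge0] at r = p - 1. *)
    rewrite (_ : - _ = p * Q * (a * ((p - 1) * x - 1) + c * ((p - 1) * x + 1))).
      by rewrite !mulr_ge0//; lra.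
    by rewrite qE; field.
have q0 : 0 < 1 + (p - 1) * b ^+ 2 by rewrite ltr_pwDl// mulr_ge0// sqr_ge0.
move: FF; rewrite /F /A expr0n/= mulr0 addr0 subr0 !one_powR mulr1 lerN2.
by rewrite powRN ler_pdivrMr ?powR_gt0.
Qed.

(** By homogeneity this is [two_point] at b / a. One may assume |b| <= |a|: the left side is
    symmetric, and exchanging the two so that the larger comes first only lowers the right side, as
    p - 1 >= 1. *)
Lemma two_point_abs p a b : 2 <= p ->
  `|a + b| `^ p + `|a - b| `^ p <= 2 * (a ^+ 2 + (p - 1) * b ^+ 2) `^ (p / 2).
Proof.
move=> p2.
have p0 : 0 <= p by lra.
wlog ab : a b / `|b| <= `|a|.
  move=> W; have [/W//|/ltW ab] := leP `|b| `|a|.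
  rewrite (addrC a b) -(opprB b a) normrN; apply: (le_trans (W _ _ ab)).
  rewrite ler_pM2l// ler_powR_base//; first lra.
    by apply: addr_ge0; [exact: sqr_ge0|apply: mulr_ge0; [lra|exact: sqr_ge0]].
  have : b ^+ 2 >= a ^+ 2 by rewrite -(real_normK (num_real a)) -(real_normK (num_real b)) ler_sqr ?nnegrE.
  nra.
wlog a0 : a b ab / 0 <= a.
  move=> W; have [/(W _ _ ab)//|/ltW a0] := leP 0 a.
  have := W (- a) (- b); rewrite !normrN => /(_ ab); rewrite oppr_ge0 => /(_ a0).
  by rewrite -!opprD !normrN !sqrrN.
wlog b0 : b ab / 0 <= b.
  move=> W; have [/(W _ ab)//|/ltW b0] := leP 0 b.
  have := W (- b); rewrite !normrN => /(_ ab); rewrite oppr_ge0 => /(_ b0).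
  by rewrite opprK sqrrN addrC.
move: ab; rewrite (ger0_norm a0) (ger0_norm b0) => ba.
have ab0 : 0 <= a - b by rewrite subr_ge0.
rewrite (ger0_norm (addr_ge0 a0 b0)) (ger0_norm ab0).
have [a00|a_neq0] := eqVneq a 0.
  have -> : b = 0 by apply/eqP; rewrite eq_le b0 -a00 ba.
  rewrite a00 addr0 subr0 powR0; last by apply/eqP; lra.
  by rewrite addr0 mulr_ge0// powR_ge0.
have a_gt0 : 0 < a by rewrite lt_neqAle eq_sym a_neq0.
have c0 : 0 <= b / a by rewrite divr_ge0.
have c1 : b / a <= 1 by rewrite ler_pdivrMr// mul1r.
have := two_point p2 c0 c1.
rewrite -(ler_pM2l (powR_gt0 p a_gt0)) mulrDr -!powRM//; [|lra|lra].
have -> : a * (1 + b / a) = a + b by field.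
have -> : a * (1 - b / a) = a - b by field.
have -> : a `^ p = (a ^+ 2) `^ (p / 2).
  by rewrite -powR_mulrn// -powRrM; congr powR; field.
rewrite mulrCA -powRM ?sqr_ge0//; last first.
  by apply: addr_ge0; [exact: ler01|apply: mulr_ge0; [lra|exact: sqr_ge0]].
by congr (_ <= 2 * _ `^ _); field.
Qed.

End two_point.

(** * Two-uniform smoothness of the squared l^p norm *)

Section uniform_smoothness.
Context {R : realType} {d : nat}.
Implicit Types (x y z : 'rV[R]_d) (p q r s : R).

Lemma ler_powR_inv s (a b : R) : 0 < s -> 0 <= a -> 0 <= b -> a `^ s <= b `^ s -> a <= b.
Proof.
move=> s0 a0 b0 ab; rewrite -[a]powRr1// -[b]powRr1// -(@mulfV _ s) ?gt_eqF//.
by rewrite !powRrM ler_powR_base ?invr_ge0 ?powR_ge0// ltW.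
Qed.

Definition sqrv x : 'rV[R]_d := \row_i x 0 i ^+ 2.

Lemma pnorm_sqrv p x : 0 < p -> pnorm (p / 2) (sqrv x) = pnorm p x ^+ 2.
Proof.
move=> p0; rewrite -powR_mulrn ?pnorm_ge0// !pnormE -powRrM.
congr (_ `^ _); last by field; exact: lt0r_neq0.
apply: eq_bigr => i _; rewrite mxE normrX -powR_mulrn// -powRrM.
by congr (_ `^ _); field.
Qed.

(** Raise the half-sum to the power s = p/2: convexity bounds it by the half-sum of p-th powers,
    [two_point_abs] applies in each coordinate, and what results is the s-th power of the l^s norm
    of [z]. Minkowski in l^s, legitimate as s >= 1, then splits [z] into the squares of x and of
    y. *)
Lemma two_point_pnorm p x y : 2 <= p ->
  pnorm p (x + y) ^+ 2 + pnorm p (x - y) ^+ 2 <=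
  2 * (pnorm p x ^+ 2 + (p - 1) * pnorm p y ^+ 2).
Proof.
move=> p2; have half (a b : R) : 2^-1 * a <= b -> a <= 2 * b by lra.
have p0 : 0 < p by lra.
have p_neq0 : p != 0 by rewrite gt_eqF.
have [s sE] : exists s, s = p / 2 by exists (p / 2).
have s1 : 1 <= s by rewrite sE; lra.
have s0 : 0 < s by lra.
have [z zdef] : exists z : 'rV[R]_d, z = sqrv x + (p - 1) *: sqrv y by eexists.
have zE : pnorm s z <= pnorm p x ^+ 2 + (p - 1) * pnorm p y ^+ 2.
  rewrite zdef; apply: (le_trans (pnormD _ _ s1)).
  rewrite pnormZ ?(gt_eqF s0)// sE !pnorm_sqrv// ger0_norm//; lra.
have := pnorm_ge0 p (x + y); have := pnorm_ge0 p (x - y).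
have := powR_pnorm (x + y) p_neq0; have := powR_pnorm (x - y) p_neq0.
move: (pnorm p (x + y)) (pnorm p (x - y)) => A B BE AE B0 A0.
apply: half; apply: le_trans zE.
apply: (@ler_powR_inv s) => //; rewrite ?pnorm_ge0//.
  by rewrite mulr_ge0 ?invr_ge0// addr_ge0// exprn_ge0.
have -> : 2^-1 * (A ^+ 2 + B ^+ 2) = 2^-1 * A ^+ 2 + (1 - 2^-1) * B ^+ 2 by field.
have h0 : 0 <= 2^-1 :> R by rewrite invr_ge0.
have h1 : 2^-1 <= 1 :> R by rewrite invf_le1// ler1n.
apply: (le_trans (powR_convex s1 h0 h1 (sqr_ge0 _) (sqr_ge0 _))).
have sqE C : 0 <= C -> (C ^+ 2) `^ s = C `^ p.
  by move=> C0; rewrite -powR_mulrn// -powRrM; congr (_ `^ _); rewrite sE; field.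
rewrite !sqE// (_ : 1 - 2^-1 = 2^-1); last by field.
rewrite -mulrDr ler_pdivrMl// AE BE powR_pnorm ?(gt_eqF s0)// -big_split/= mulr_sumr.
apply: ler_sum => i _; rewrite zdef !mxE (@ger0_norm _ (_ ^+ 2 + _)).
  by rewrite sE two_point_abs.
by apply: addr_ge0; [exact: sqr_ge0|apply: mulr_ge0; [lra|exact: sqr_ge0]].
Qed.

(* The gradient of |.|_p^2; the junk value 0 `^ (2 - p) is harmless as the    *)
(* last factor vanishes at x = 0.                                             *)
Definition dual_map p x : 'rV[R]_d :=
  \row_i (2 * pnorm p x `^ (2 - p) * (`|x 0 i| `^ (p - 2) * x 0 i)).

Lemma dual_map0 p : dual_map p 0 = 0.
Proof. by apply/rowP => i; rewrite !mxE !mulr0. Qed.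

Lemma powR_shift p (a : R) : 0 < p -> `|a| `^ (p - 2) * a * a = `|a| `^ p.
Proof.
move=> p0; have [->|a0] := eqVneq a 0; first by rewrite mulr0 normr0 powR0 ?gt_eqF.
rewrite -mulrA -expr2 -(real_normK (num_real a)) -powR_mulrn//.
by rewrite -powRD ?subrK// normr_eq0 a0 implybT.
Qed.

Lemma dual_map_id p x : 0 < p -> dotv (dual_map p x) x = 2 * pnorm p x ^+ 2.
Proof.
move=> p0; have [->|x0] := eqVneq x 0.
  by rewrite dotv0r pnorm0 ?gt_eqF// expr0n/= mulr0.
have N0 := pnorm_gt0 p0 x0.
transitivity (2 * pnorm p x `^ (2 - p) * pnorm p x `^ p).
  rewrite powR_pnorm ?gt_eqF// mulr_sumr dotvE; apply: eq_bigr => i _.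
  by rewrite mxE -mulrA powR_shift.
rewrite -mulrA -powRD ?subrK ?powR_mulrn ?pnorm_ge0//.
by rewrite (gt_eqF N0) implybT.
Qed.

Lemma pnorm_dual_map p q x : 2 <= p -> p^-1 + q^-1 = 1 ->
  pnorm q (dual_map p x) = 2 * pnorm p x.
Proof.
move=> p2 pq; have p0 : 0 < p by lra.
have qV : q^-1 = 1 - p^-1 by rewrite -pq addrC addKr.
have pV : p^-1 <= 2^-1 by rewrite lef_pV2 ?posrE.
have q0 : 0 < q by rewrite -invr_gt0 qV; lra.
have [->|x0] := eqVneq x 0.
  by rewrite dual_map0 !pnorm0 ?gt_eqF// mulr0.
have N0 := pnorm_gt0 p0 x0.
have qE : (p - 1) * q = p.
  by apply: (mulIf (invr_neq0 (lt0r_neq0 q0))); rewrite mulfK ?gt_eqF// qV; field; exact: lt0r_neq0.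
have q_neq0 : q != 0 by rewrite gt_eqF.
have p_neq0 : p != 0 by rewrite gt_eqF.
have SE := powR_pnorm x (lt0r_neq0 p0).
have -> : dual_map p x =
    (2 * pnorm p x `^ (2 - p)) *: \row_i (`|x 0 i| `^ (p - 2) * x 0 i).
  by apply/rowP => i; rewrite !mxE.
have C0 : 0 <= 2 * pnorm p x `^ (2 - p) by rewrite mulr_ge0// powR_ge0.
rewrite (pnormZ _ _ q_neq0) (ger0_norm C0) -mulrA.
have -> : pnorm q (\row_i (`|x 0 i| `^ (p - 2) * x 0 i)) = pnorm p x `^ (p - 1).
  rewrite pnormE.
  have -> : \sum_(i < d) `|(\row_j (`|x 0 j| `^ (p - 2) * x 0 j) : 'rV[R]_d) 0 i| `^ q =
      pnorm p x `^ p.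
    rewrite SE; apply: eq_bigr => i _; rewrite mxE normrM (ger0_norm (powR_ge0 _ _)).
    have [->|xi0] := eqVneq (x 0 i) 0; first by rewrite normr0 mulr0 !powR0.
    rewrite -[X in _ * X]powRr1// -powRD; last by rewrite normr_eq0 xi0 implybT.
    by rewrite -powRrM (_ : p - 2 + 1 = p - 1) ?qE//; ring.
  by rewrite -powRrM qV mulrBr mulr1 mulfV// lt0r_neq0.
move: (pnorm p x) N0 => N N0; rewrite -powRD ?(gt_eqF N0) ?implybT//.
by rewrite (_ : 2 - p + (p - 1) = 1) ?powRr1 ?(ltW N0)//; ring.
Qed.

(** Hölder gives <dual_map x, x + y> <= 2 |x| |x + y| <= |x|^2 + |x + y|^2, while <dual_map x, x> =
    2 |x|^2. *)
Lemma dual_map_subgradient p x y : 2 <= p ->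
  pnorm p x ^+ 2 + dotv (dual_map p x) y <= pnorm p (x + y) ^+ 2.
Proof.
move=> p2; have p0 : 0 < p by lra.
pose q := (1 - p^-1)^-1.
have pV : p^-1 <= 2^-1 by rewrite lef_pV2 ?posrE.
have pq : p^-1 + q^-1 = 1 by rewrite /q invrK subrKC.
have q0 : 0 < q by rewrite /q invr_gt0; lra.
have := hoelder_dotv (dual_map p x) (x + y) q0 p0; rewrite addrC pq => /(_ erefl).
rewrite (pnorm_dual_map _ p2 pq) dotvDr dual_map_id// => /(le_trans (ler_norm _)).
have := sqr_ge0 (pnorm p (x + y) - pnorm p x).
rewrite sqrrB; clear; gen_norms; lra.
Qed.

(** No second derivative is taken. The remainder [r t] of the first-order expansion along t y is
    nonnegative, and the two-point inequality centred at x + t y gives r(2t) <= 2 r(t) + 2 c t^2.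
    Iterating the doubling from t = 2^-N up to 1, with r(t) = O(t^2) at the start, leaves r(1) <= c
    in the limit. *)
Lemma pnorm_smooth p x y : 2 <= p ->
  pnorm p (x + y) ^+ 2 <=
  pnorm p x ^+ 2 + dotv (dual_map p x) y + (p - 1) * pnorm p y ^+ 2.
Proof.
move=> p2; have p0 : 0 < p by lra.
have p_neq0 : p != 0 by rewrite gt_eqF.
pose c := (p - 1) * pnorm p y ^+ 2.
have c0 : 0 <= c by apply: mulr_ge0; [lra|exact: sqr_ge0].
pose r t := pnorm p (x + t *: y) ^+ 2 - pnorm p x ^+ 2 - t * dotv (dual_map p x) y.
have r_ge0 t : 0 <= r t.
  have := dual_map_subgradient x (t *: y) p2; rewrite dotvZr /r; clear; gen_norms; lra.
have normt t : pnorm p (t *: y) ^+ 2 = t ^+ 2 * pnorm p y ^+ 2.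
  by rewrite pnormZ// exprMn real_normK ?num_real.
have r_double t : r (2 * t) <= 2 * r t + 2 * (c * t ^+ 2).
  have := two_point_pnorm (x + t *: y) (t *: y) p2.
  rewrite normt addrK -addrA -scalerDl (_ : t + t = 2 * t); last by ring.
  rewrite /r /c; clear; gen_norms; lra.
have r_small t : r t <= 2 * (c * t ^+ 2).
  have := two_point_pnorm x (t *: y) p2; have := r_ge0 (- t).
  rewrite normt /r /c scaleNr; clear; gen_norms; lra.
have r1 N : r 1 <= 2 ^+ N * r (2 ^- N) + c * (1 - 2 ^- N).
  elim: N => [|N IH]; first by rewrite expr0 invr1 mul1r subrr mulr0 addr0.
  apply: (le_trans IH).
  have e0 : 0 < 2 ^+ N :> R by rewrite exprn_gt0.
  have := r_double (2 ^- N.+1).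
  have -> : 2 * 2 ^- N.+1 = 2 ^- N :> R.
    by rewrite exprS invfM mulrA mulfV ?mul1r// pnatr_eq0.
  move=> /(ler_wpM2l (ltW e0)); rewrite exprS.
  move: (r (2 ^- N)) (r _) e0 => r' r''; move: (2 ^+ N) => e e0 H.
  have wE : e * (2 * (c * (2 * e)^-1 ^+ 2)) = c * (2 * e)^-1.
    by field; exact: lt0r_neq0.
  have eV : e^-1 = 2 * (2 * e)^-1 by field; exact: lt0r_neq0.
  move: H; rewrite eV mulrDr wE; move: (_^-1) => w; clear; lra.
have r1c : r 1 <= c.
  apply/ler_addgt0Pr => e e0.
  have [N HN] : exists N : nat, 2 * c / e <= N%:R.
    by exists (Num.truncn (2 * c / e)).+1; apply/ltW/truncnS_gt.
  have N2 : N%:R <= 2 ^+ N :> R by rewrite -natrX ler_nat ltnW// ltn_expl.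
  apply: (le_trans (r1 N)).
  have e2 : 0 < 2 ^+ N :> R by rewrite exprn_gt0.
  have := ler_wpM2l (ltW e2) (r_small (2 ^- N)).
  have : 2 * c <= e * 2 ^+ N.
    by rewrite (mulrC e) -ler_pdivrMr// (le_trans HN).
  move: (r _) e2 => r'; move: (2 ^+ N) => E E0 H1 H2.
  have H3 : 2 * c * E^-1 <= e by rewrite ler_pdivrMr.
  have H4 : E * (2 * (c * E^-1 ^+ 2)) = 2 * c * E^-1 by field; exact: lt0r_neq0.
  have : 0 <= c * E^-1 by rewrite mulr_ge0// invr_ge0 ltW.
  by move: H2 H3; rewrite H4; clear; lra.
move: r1c; rewrite /r scale1r mul1r /c; clear; gen_norms; lra.
Qed.

Lemma pnorm_sqrD_le p x y : 1 <= p ->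
  pnorm p (x + y) ^+ 2 <= 2 * pnorm p x ^+ 2 + 2 * pnorm p y ^+ 2.
Proof.
move=> p1; have := pnormD x y p1; have := pnorm_ge0 p (x + y) => h0 h1.
have := sqr_ge0 (pnorm p x - pnorm p y).
have : pnorm p (x + y) ^+ 2 <= (pnorm p x + pnorm p y) ^+ 2.
  by rewrite ler_sqr ?nnegrE// (le_trans h0).
rewrite sqrrB sqrrD; clear; gen_norms; lra.
Qed.

End uniform_smoothness.

(** * Borel structure of row vectors *)

Section borel_rows.
Context {R : realType} {d : nat}.
Implicit Types (x y : 'rV[R]_d).

(** Half-open cubes of side 1/(n+1), indexed by integer rows. They are countably many and measurable
    coordinate by coordinate, and every point of an open set lies in one that is contained in it;
    all measurability questions on rows reduce to them. *)
Definition cell n (g : 'rV[int]_d) : set 'rV[R]_d :=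
  [set x | forall i, Num.floor (n.+1%:R * x 0 i) = g 0 i].

Definition cell_of n x : 'rV[int]_d := \row_i Num.floor (n.+1%:R * x 0 i).

Definition cell_pt n (g : 'rV[int]_d) : 'rV[R]_d := \row_i ((g 0 i)%:~R / n.+1%:R).

Lemma cell_ofP n x : cell n (cell_of n x) x.
Proof. by move=> i; rewrite mxE. Qed.

Lemma cell_uniq n g x : cell n g x -> cell_of n x = g.
Proof. by move=> gx; apply/rowP => i; rewrite mxE gx. Qed.

Lemma cell_near n g x y i : cell n g x -> cell n g y -> `|x 0 i - y 0 i| < n.+1%:R^-1.
Proof.
move=> /(_ i) gx /(_ i) gy.
have n0 : 0 < n.+1%:R :> R by rewrite ltr0n.
have := floor_itv (n.+1%:R * x 0 i); have := floor_itv (n.+1%:R * y 0 i).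
rewrite gx gy intrD => /andP[y1 y2] /andP[x1 x2].
rewrite -(ltr_pM2l n0) mulfV ?lt0r_neq0// -[X in X * `|_|]gtr0_norm// -normrM mulrBr.
rewrite ltr_norml; apply/andP; split; lra.
Qed.

Lemma cell_pt_near n x i : `|x 0 i - cell_pt n (cell_of n x) 0 i| < n.+1%:R^-1.
Proof.
apply: (@cell_near n (cell_of n x)); first exact: cell_ofP.
by move=> j; rewrite !mxE mulrC divfK ?intrKfloor// pnatr_eq0.
Qed.

Lemma open_cell (U : set 'rV[R]_d) x : open U -> U x ->
  exists n g, cell n g x /\ cell n g `<=` U.
Proof.
move=> oU Ux; have /nbhs_ballP[e /= e0 xeU] : nbhs x U by exact: open_nbhs_nbhs.
have [n ne] : exists n : nat, n.+1%:R^-1 < e.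
  exists (Num.truncn e^-1); rewrite invf_plt ?posrE//; exact: truncnS_gt.
exists n, (cell_of n x); split; first exact: cell_ofP.
move=> y xy; apply: xeU; split=> // i j.
by rewrite (ord1 i) /ball/=; apply: lt_trans ne; apply: cell_near xy; exact: cell_ofP.
Qed.

Lemma measurable_preimage_cell d' (T : measurableType d') (f : T -> 'rV[R]_d) n g :
  (forall i, measurable_fun setT (fun t => f t 0 i)) -> measurable (f @^-1` cell n g).
Proof.
move=> mf.
rewrite (_ : _ @^-1` _ = ~` (\bigcup_(i : 'I_d)
   ~` ((fun t => n.+1%:R * f t 0 i) @^-1` `[(g 0 i)%:~R, (g 0 i + 1)%:~R[%classic))).
  apply: measurableC; apply: countable_bigcupT_measurable; first exact: countableP.
  move=> i; apply: measurableC; rewrite -[X in measurable X]setTI.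
  by apply: measurable_funM => //; exact: measurable_cst.
apply/seteqP; split=> [t ft [i _]|t nt i].
  by apply; rewrite /= in_itv/= -(ft i) floor_itv.
have : ~ ~ (`[(g 0 i)%:~R, (g 0 i + 1)%:~R[%classic (n.+1%:R * f t 0 i)).
  by move=> h; apply: nt; exists i.
by move/contrapT; rewrite /= in_itv/=; exact: floor_def.
Qed.

(** The preimage of an open set is the countable union of the preimages of the cells it contains. *)
Lemma measurable_rowP d' (T : measurableType d') (f : T -> 'rV[R]_d) :
  (forall i, measurable_fun setT (fun t => f t 0 i)) -> measurable_fun setT f.
Proof.
move=> mf; apply: (@measurability _ _ _ _ setT f open erefl) => _ [U oU <-].
pose C (k : nat * 'rV[int]_d) := if `[< cell k.1 k.2 `<=` U >] then f @^-1` cell k.1 k.2 else set0.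
rewrite setTI (_ : _ @^-1` _ = \bigcup_k C k).
  apply: countable_bigcupT_measurable; first exact: countableP.
  by move=> k; rewrite /C; case: ifP => // _; exact: measurable_preimage_cell.
apply/seteqP; split=> [t Ut|t [k _]].
  have [n [g [gt gU]]] := open_cell oU Ut.
  by exists (n, g) => //; rewrite /C; case: asboolP.
by rewrite /C; case: asboolP => // kU /kU.
Qed.

Lemma continuous_measurable_row (f : 'rV[R]_d -> R) : continuous f -> measurable_fun setT f.
Proof.
move=> /continuousP cf; apply: (measurability _ (RGenOpens.measurableE R)).
move=> _ [_ [a [b ->] <-]]; rewrite setTI; apply: sub_sigma_algebra.
by apply: cf; exact: interval_open.
Qed.

Lemma measurable_coord i : measurable_fun setT (fun x : 'rV[R]_d => x 0 i).
Proof. by apply: continuous_measurable_row; exact: coord_continuous. Qed.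

Section operations.
Context d' (T : measurableType d').
Implicit Types f g : T -> 'rV[R]_d.

Lemma measurable_row_coord f i : measurable_fun setT f ->
  measurable_fun setT (fun t => f t 0 i).
Proof. by move=> mf; exact: (measurableT_comp (measurable_coord i) mf). Qed.

Lemma measurable_rowD f g : measurable_fun setT f -> measurable_fun setT g ->
  measurable_fun setT (fun t => f t + g t).
Proof.
move=> mf mg; apply: measurable_rowP => i; under eq_fun do rewrite mxE.
by apply: measurable_funD; exact: measurable_row_coord.
Qed.

Lemma measurable_rowZ (a : T -> R) f : measurable_fun setT a -> measurable_fun setT f ->
  measurable_fun setT (fun t => a t *: f t).
Proof.
move=> ma mf; apply: measurable_rowP => i; under eq_fun do rewrite mxE.
by apply: measurable_funM => //; exact: measurable_row_coord.
Qed.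

Lemma measurable_rowB f g : measurable_fun setT f -> measurable_fun setT g ->
  measurable_fun setT (fun t => f t - g t).
Proof.
move=> mf mg; apply: measurable_rowP => i; under eq_fun do rewrite !mxE.
by apply: measurable_funB; exact: measurable_row_coord.
Qed.

Lemma measurable_row_sum n (f : 'I_n -> T -> 'rV[R]_d) :
  (forall i, measurable_fun setT (f i)) ->
  measurable_fun setT (fun t => \sum_(i < n) f i t).
Proof.
move=> mf; apply: measurable_rowP => i; under eq_fun do rewrite summxE.
by apply: measurable_sum => j; exact: measurable_row_coord.
Qed.

Lemma measurable_dotv f g : measurable_fun setT f -> measurable_fun setT g ->
  measurable_fun setT (fun t => dotv (f t) (g t)).
Proof.
move=> mf mg; under eq_fun do rewrite dotvE; apply: measurable_sum => i.
by apply: measurable_funM; exact: measurable_row_coord.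
Qed.

Lemma measurable_pnorm p f : measurable_fun setT f ->
  measurable_fun setT (fun t => pnorm p (f t)).
Proof.
move=> mf; under eq_fun do rewrite pnormE.
apply: (measurableT_comp (measurable_powR p^-1)); apply: measurable_sum => i.
apply: (measurableT_comp (measurable_powR p)).
by apply: measurableT_comp => //; exact: measurable_row_coord.
Qed.

Lemma measurable_pnorm_sqr p f : measurable_fun setT f ->
  measurable_fun setT (fun t => pnorm p (f t) ^+ 2).
Proof. by move=> mf; apply: measurable_funX; exact: measurable_pnorm. Qed.

End operations.

Lemma cvg_cell_pt x : (fun n => cell_pt n (cell_of n x)) @ \oo --> x.
Proof.
apply/cvg_ballP => e e0; near=> n; split=> // i j.
rewrite (ord1 i) /ball/=; apply: lt_trans (cell_pt_near n x j) _.
rewrite invf_plt ?posrE//; apply: (@lt_le_trans _ _ (Num.truncn e^-1).+1%:R).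
  exact: truncnS_gt.
rewrite ler_nat ltnS; near: n; exact: nbhs_infty_ge.
Unshelve. all: by end_near. Qed.

(** Rounding the row to the corner of its cell turns F into a function that is measurable cell by
    cell; by continuity in the row these functions converge pointwise to F. *)
Lemma caratheodory_fun_measurable d' (Z : measurableType d') (F : 'rV[R]_d -> Z -> R) :
  (forall x, measurable_fun setT (F x)) -> (forall z, continuous (F^~ z)) ->
  measurable_fun setT (fun w : 'rV[R]_d * Z => F w.1 w.2).
Proof.
move=> mF cF.
apply: (@measurable_fun_cvg _ _ _ setT
  (fun n (w : 'rV[R]_d * Z) => F (cell_pt n (cell_of n w.1)) w.2)); last first.
  by move=> [x z] _; exact: (cvg_comp _ _ (@cvg_cell_pt x) (cF z x)).
move=> n _ Y mY; rewrite setTI.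
rewrite (_ : _ @^-1` _ = \bigcup_(g : 'rV[int]_d) (cell n g `*` (F (cell_pt n g) @^-1` Y))).
  apply: countable_bigcupT_measurable; first exact: countableP.
  move=> g; apply: measurableX.
    by apply: (@measurable_preimage_cell _ _ id) => i; exact: measurable_coord.
  by rewrite -[X in measurable X]setTI; exact: mF.
apply/seteqP; split=> [[x z] /= Yx|[x z] [g _ [/= gx Yx]]].
  by exists (cell_of n x) => //; split => //; exact: cell_ofP.
by rewrite /= (cell_uniq gx).
Qed.

Lemma cvg_diff_quotient (f : 'rV[R]_d -> R) x e : derivable f x e ->
  (fun n => n.+1%:R * (f (n.+1%:R^-1 *: e + x) - f x)) @ \oo --> 'D_e f x.
Proof.
move=> df; have h0 : (fun n => n.+1%:R^-1 : R) @ \oo --> (0 : R)^'.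
  move=> A A0.
  have H : \forall n \near \oo, n.+1%:R^-1 != 0 :> R -> A n.+1%:R^-1 := @cvg_harmonic R _ A0.
  change (\forall n \near \oo, A n.+1%:R^-1); apply: filterS H => n; apply.
  by rewrite invr_neq0// pnatr_eq0.
have := cvg_comp _ _ h0 df; rewrite /comp/=.
by under eq_fun do rewrite invrK.
Qed.

Lemma measurable_derive d' (Z : measurableType d') (F : 'rV[R]_d -> Z -> R) e :
  (forall x, measurable_fun setT (F x)) -> (forall z, continuous (F^~ z)) ->
  (forall x z, derivable (F^~ z) x e) ->
  measurable_fun setT (fun w : 'rV[R]_d * Z => 'D_e (F^~ w.2) w.1).
Proof.
move=> mF cF dF.
apply: (@measurable_fun_cvg _ _ _ setT (fun n (w : 'rV[R]_d * Z) =>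
    n.+1%:R * (F (n.+1%:R^-1 *: e + w.1) w.2 - F w.1 w.2))); last first.
  by move=> [x z] _ /=; exact: (cvg_diff_quotient (dF x z)).
move=> n; apply: measurable_funM; first exact: measurable_cst.
apply: measurable_funB; last exact: caratheodory_fun_measurable.
apply: (measurableT_comp (caratheodory_fun_measurable mF cF)
  (_ : measurable_fun setT (fun w : 'rV[R]_d * Z => (n.+1%:R^-1 *: e + w.1, w.2)))).
apply: measurable_fun_pair; last exact: measurable_snd.
by apply: measurable_rowD; [exact: measurable_cst|exact: measurable_fst].
Qed.

Lemma measurable_grad2 d' (Z : measurableType d') (F : 'rV[R]_d -> Z -> R) :
  (forall x, measurable_fun setT (F x)) -> (forall x z, differentiable (F^~ z) x) ->
  measurable_fun setT (fun w : 'rV[R]_d * Z => grad (F^~ w.2) w.1).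
Proof.
move=> mF dF; apply: measurable_rowP => i; under eq_fun do rewrite mxE.
apply: measurable_derive => //.
- by move=> z x; exact: differentiable_continuous.
- by move=> x z; exact: diff_derivable.
Qed.

Lemma measurable_grad (f : 'rV[R]_d -> R) : (forall x, differentiable f x) ->
  measurable_fun setT (grad f).
Proof.
move=> df; have := @measurable_grad2 _ unit (fun x _ => f x)
  (fun x => @measurable_cst _ _ _ _ setT (f x)) (fun x _ => df x).
by move=> /measurable_fun_pair1 => /(_ tt).
Qed.

Lemma differentiable_measurable_row (f : 'rV[R]_d -> R) :
  (forall x, differentiable f x) -> measurable_fun setT f.
Proof.
by move=> df; apply: continuous_measurable_row => x; exact: differentiable_continuous.
Qed.

(** A point outside the support has a null open neighbourhood, hence lies in a null cell; there are
    countably many cells. *)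
Lemma msupport_full (P : probability 'rV[R]_d R) :
  exists N, [/\ measurable N, P N = 0%E & ~` N `<=` msupport P].
Proof.
pose C (k : nat * 'rV[int]_d) : set 'rV[R]_d :=
  if (P (cell k.1 k.2) == 0)%E then cell k.1 k.2 else set0.
have mcell n g : measurable (cell n g).
  by apply: (@measurable_preimage_cell _ _ id) => i; exact: measurable_coord.
have mC k : measurable (C k) by rewrite /C; case: ifP.
exists (\bigcup_k C k); split.
- by apply: countable_bigcupT_measurable; first exact: countableP.
- apply/negligibleP; first by apply: countable_bigcupT_measurable; first exact: countableP.
  (* An enumeration of the indices of cells. A code that decodes to nothing is sent to an arbitrary
     index, which merely repeats a null set. *)
  pose g n : nat * 'rV[int]_d := odflt (0%N, 0) (choice.unpickle n).
  apply: (@negligibleS _ _ _ P (\bigcup_n C (g n))).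
    by move=> x [k _ kx]; exists (choice.pickle k) => //; rewrite /g choice.pickleK.
  apply: negligible_bigcup => n; apply/negligibleP => //.
  by rewrite /C; case: ifPn => [/eqP//|_]; exact: measure0.
- move=> x /= Cx U oU Ux; rewrite lt0e measure_ge0 andbT.
  apply/negP => PU0; apply: Cx.
  have [n [c [cx cU]]] := open_cell oU Ux.
  exists (n, c) => //; rewrite /C/=; case: ifPn => // /negP[].
  rewrite -measure_le0 -(eqP PU0); apply: le_measure => //; rewrite inE//.
  exact: sub_sigma_algebra.
Qed.

End borel_rows.

(** * Calculus along segments *)

Section line_calculus.
Context {R : realType}.

Lemma le_of_eq (a b : R) : a = b -> a <= b.
Proof. by move->. Qed.

Lemma is_derive_bound (f df : R -> R) (a b C : R) : a <= b ->
  (forall x, a <= x <= b -> is_derive x 1 f (df x)) ->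
  (forall x, a < x < b -> `|df x| <= C) -> `|f b - f a| <= C * (b - a).
Proof.
move=> ab fdf dfC.
have id1 (x : R) : is_derive x 1 ( *%R C) C.
  by apply: is_derive_eq; rewrite /GRing.scale/=; ring.
have H1 : C * a - f a <= C * b - f b.
  apply: (@is_derive_le _ (fun x => C * x - f x) (fun x => C - df x)) => //.
    by move=> x /fdf dx; apply: is_deriveB.
  by move=> x /dfC; rewrite ler_norml subr_ge0 => /andP[].
have H2 : C * a + f a <= C * b + f b.
  apply: (@is_derive_le _ (fun x => C * x + f x) (fun x => C + df x)) => //.
    by move=> x /fdf dx; apply: is_deriveD.
  by move=> x /dfC; rewrite ler_norml -lerBlDl sub0r => /andP[].
rewrite ler_norml; apply/andP; split; lra.
Qed.

Lemma is_derive_taylor (f df : R -> R) (M : R) :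
  (forall x : R, 0 <= x <= 1 -> is_derive x 1 f (df x)) ->
  (forall x : R, 0 < x < 1 -> `|df x - df 0| <= M * x) ->
  `|f 1 - f 0 - df 0| <= M / 2.
Proof.
move=> fdf dfM.
have id2 (x : R) : is_derive x 1 (fun x => M / 2 * x ^+ 2) (M * x).
  by apply: is_derive_eq; rewrite /GRing.scale/=; field.
have id1 (x : R) : is_derive x 1 (fun x => df 0 * x) (df 0).
  by apply: is_derive_eq; rewrite /GRing.scale/=; ring.
have H1 : M / 2 * 0 ^+ 2 - (f 0 - df 0 * 0) <= M / 2 * 1 ^+ 2 - (f 1 - df 0 * 1).
  apply: (@is_derive_le _ (fun x => M / 2 * x ^+ 2 - (f x - df 0 * x))
    (fun x => M * x - (df x - df 0))) => //.
    by move=> x /fdf dx; apply: is_deriveB; apply: is_deriveB.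
  by move=> x /dfM; rewrite ler_norml subr_ge0 => /andP[].
have H2 : M / 2 * 0 ^+ 2 + (f 0 - df 0 * 0) <= M / 2 * 1 ^+ 2 + (f 1 - df 0 * 1).
  apply: (@is_derive_le _ (fun x => M / 2 * x ^+ 2 + (f x - df 0 * x))
    (fun x => M * x + (df x - df 0))) => //.
    by move=> x /fdf dx; apply: is_deriveD; apply: is_deriveB.
  by move=> x /dfM; rewrite ler_norml => /andP[h1 h2]; lra.
rewrite ler_norml; apply/andP; split; lra.
Qed.

Lemma continuous_unif_01 (g : R -> R) (e : R) : continuous g -> 0 < e ->
  \forall n \near \oo, forall x s : R, 0 <= x <= 1 -> `|s - x| <= n.+1%:R^-1 -> `|g s - g x| <= e.
Proof.
move=> cg e0.
pose P (n : nat) (x : R) := forall s, `|s - x| <= n.+1%:R^-1 -> `|g s - g x| <= e.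
have /compact_near_coveringP/(_ nat \oo P _) : compact `[0 : R, 1]%classic.
  exact: segment_compact.
move=> /(_ _)[].
  move=> x _.
  have /cvgrPdist_le/(_ (e / 2)) := cg x; rewrite divr_gt0// => /(_ isT).
  move=> /nbhs_ballP[r /= r0 xr].
  have n0 : \forall n \near \oo, n.+1%:R^-1 < r / 2.
    have := @cvg_harmonic R; move=> /cvgr0Pnorm_lt/(_ (r / 2)); rewrite divr_gt0// => /(_ isT).
    by apply: filterS => n; rewrite /harmonic/= ger0_norm ?invr_ge0.
  exists (ball x (r / 2), [set n | n.+1%:R^-1 < r / 2]) => /=.
    by split => //; apply: nbhsx_ballx; rewrite divr_gt0.
  move=> [x' n] /= [xx' nr] s sx'.
  have xs : `|x - s| < r.
    rewrite -(subrK x' x) -addrA (le_lt_trans (ler_normD _ _))//.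
    by rewrite (splitr r) ltrD// distrC (le_lt_trans sx').
  have xx'r : `|x - x'| < r.
    by apply: lt_trans xx' _; rewrite ltr_pdivrMr// ltr_pMr// ltr1n.
  have := xr _ xs; have := xr _ xx'r => /= h1 h2.
  rewrite -(subrK (g x) (g s)) -addrA (le_trans (ler_normD _ _))//.
  by rewrite (splitr e) lerD// distrC.
move=> N _ HN; exists N => // n Nn x s x01.
by apply: HN => //=; rewrite in_itv.
Qed.

(** The increment of f telescopes over the subdivision, and on each piece the mean value bound
    compares it with the slope at the left end, uniformly by continuity of [df]. Riemann sums rather
    than an integral in t let Fatou's lemma be applied later. *)
Lemma riemann_sum_cvg (f df : R -> R) :
  (forall x : R, is_derive x 1 f (df x)) -> continuous df ->
  (fun n => \sum_(k < n.+1) df (k%:R / n.+1%:R) / n.+1%:R) @ \oo --> f 1 - f 0.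
Proof.
move=> fdf cdf; apply/cvgrPdist_le => e e0.
have := continuous_unif_01 cdf e0; apply: filterS => n Hn.
pose N : R := n.+1%:R; have N0 : 0 < N by rewrite /N ltr0n.
pose a k : R := k%:R / N.
have -> : f 1 - f 0 = \sum_(k < n.+1) (f (a k.+1) - f (a k)).
  rewrite -(big_mkord xpredT (fun k => f (a k.+1) - f (a k))) telescope_sumr//.
  by rewrite /a mul0r mulfV// gt_eqF.
rewrite -sumrB (le_trans (ler_norm_sum _ _ _))//.
have -> : e = \sum_(k < n.+1) (e / N).
  by rewrite sumr_const card_ord -mulr_natr divfK// gt_eqF.
apply: ler_sum => k _; rewrite -/N -/(a k).
have akE : a k.+1 - a k = N^-1 by rewrite /a -mulrBl -natrB// subSnn mul1r.
have ak : a k <= a k.+1 by rewrite -subr_ge0 akE invr_ge0 ltW.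
have := @is_derive_bound (fun x => f x - df (a k) * x) (fun x => df x - df (a k)) _ _ e ak.
rewrite akE => H; apply: le_trans (H _ _).
- by apply: le_of_eq; congr `|_|; rewrite -akE; ring.
- move=> x _; have dx := fdf x.
  by apply: is_derive_eq; rewrite /GRing.scale/=; ring.
- move=> x /andP[x1 x2]; apply: Hn.
    rewrite divr_ge0 ?(ltW N0)//= ler_pdivrMr// mul1r ler_nat ltnW//.
  rewrite ger0_norm ?subr_ge0 ?(ltW x1)//; rewrite -akE lerB// ltW//.
Qed.

End line_calculus.

Section directional.
Context {R : realType} {d : nat}.
Implicit Types (x w : 'rV[R]_d).

Lemma derive_grad (f : 'rV[R]_d -> R) x w : differentiable f x ->
  'D_w f x = dotv (grad f x) w.
Proof.
move=> df; rewrite deriveE// [in LHS](row_sum_delta w) linear_sum dotvE/=.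
by apply: eq_bigr => i _; rewrite linearZ/= mxE deriveE// mulrC.
Qed.

Lemma is_derive_line (f : 'rV[R]_d -> R) x w (t : R) :
  differentiable f (x + t *: w) ->
  is_derive t 1 (fun t => f (x + t *: w)) (dotv (grad f (x + t *: w)) w).
Proof.
move=> df.
have E : (fun h : R => h^-1 *: (f (x + (h *: (1 : R) + t) *: w) - f (x + t *: w)))
    = (fun h : R => h^-1 *: (f (h *: w + (x + t *: w)) - f (x + t *: w))).
  apply/funext => h; have -> : h *: (1 : R) = h := mulr1 h.
  by rewrite scalerDl addrCA.
split; first by rewrite /derivable E; exact: diff_derivable.
by rewrite -derive_grad// /derive E.
Qed.

Lemma smooth_taylor (f : 'rV[R]_d -> R) x w (L : R) :
  (forall t : R, 0 <= t <= 1 -> differentiable f (x + t *: w)) ->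
  (forall t : R, 0 <= t <= 1 ->
    pnorm 2 (grad f (x + t *: w) - grad f x) <= L * (t * pnorm 2 w)) ->
  `|f (x + w) - f x - dotv (grad f x) w| <= L / 2 * pnorm 2 w ^+ 2.
Proof.
move=> df Lf.
have := @is_derive_taylor R (fun t => f (x + t *: w))
  (fun t => dotv (grad f (x + t *: w)) w) (L * pnorm 2 w ^+ 2).
rewrite scale0r addr0 scale1r mulrAC; apply.
  by move=> t /df; exact: is_derive_line.
move=> t /andP[/ltW t0 /ltW t1]; rewrite -dotvBl (le_trans (cauchy_dotv _ _))//.
have := Lf t; rewrite t0 t1 => /(_ isT) H.
by apply: le_trans (ler_wpM2r (pnorm_ge0 _ _) H) _; apply: le_of_eq; ring.
Qed.

(** The direction tested is the gradient g itself: |g|^2 is the derivative along g, a limit of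
    quotients bounded by M |g| since O is open. *)
Lemma lipschitz_grad (f : 'rV[R]_d -> R) (M : R) (O : set 'rV[R]_d) x : 0 <= M ->
  open O -> O x -> differentiable f x ->
  (forall y z, O y -> O z -> `|f y - f z| <= M * pnorm 2 (y - z)) ->
  pnorm 2 (grad f x) <= M.
Proof.
move=> M0 oO Ox df fM; set g := grad f x.
have [g0|g0] := eqVneq g 0; first by rewrite g0 pnorm0// pnatr_eq0.
have gp : 0 < pnorm 2 g by apply: pnorm_gt0.
suff : dotv g g <= M * pnorm 2 g by rewrite dotv_sqrE expr2 ler_pM2r.
rewrite -derive_grad//.
have Oline : \forall h \near 0^', O (h *: g + x).
  have c : {for (0 : R), continuous (fun h : R => h *: g + x)}.
    by apply: cvgD; [exact: cvgZr_tmp|exact: cvg_cst].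
  apply: cvg_within; apply: c; rewrite scale0r add0r; exact: open_nbhs_nbhs.
apply: limr_le; first exact: diff_derivable.
near=> h.
have h0 : h != 0 by near: h; exact: nbhs_dnbhs_neq.
apply: (le_trans (ler_norm _)); rewrite normrM normfV.
rewrite ler_pdivrMl ?normr_gt0// mulrCA -pnormZ ?pnatr_eq0//.
rewrite -[X in pnorm 2 X](addrK x).
apply: fM => //; near: h; exact: Oline.
Unshelve. all: by end_near. Qed.

End directional.

(** * Integral bounds *)

Section integral_bounds.
Context {R : realType} {dT : measure_display} {T : measurableType dT}.
Implicit Types (mu : {measure set T -> \bar R}) (P : probability T R).
Local Open Scope ereal_scope.

(* The integral of a nonnegative function is the supremum over the simple     *)
(* functions below it, whether or not the function is measurable.             *)
Lemma ge0_le_integral_any mu (f g : T -> \bar R) :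
  (forall x, 0 <= f x) -> (forall x, f x <= g x) ->
  \int[mu]_x f x <= \int[mu]_x g x.
Proof.
move=> f0 fg; have g0 x : 0 <= g x by exact: le_trans (fg x).
rewrite !ge0_integralTE//; apply: ereal_sup_le => _ [h /= hf <-].
by exists h => // x; exact: le_trans (fg x).
Qed.

Lemma ge0_integral_le2 mu (f g1 g2 : T -> R) (a b : R) :
  (0 <= a)%R -> (0 <= b)%R ->
  measurable_fun setT g1 -> measurable_fun setT g2 ->
  (forall x, 0 <= f x)%R -> (forall x, 0 <= g1 x)%R -> (forall x, 0 <= g2 x)%R ->
  (forall x, f x <= a * g1 x + b * g2 x)%R ->
  \int[mu]_x (f x)%:E <= a%:E * \int[mu]_x (g1 x)%:E + b%:E * \int[mu]_x (g2 x)%:E.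
Proof.
move=> a0 b0 mg1 mg2 f0 g10 g20 fg.
have mE1 : measurable_fun setT (EFin \o g1) by exact/measurable_EFinP.
have mE2 : measurable_fun setT (EFin \o g2) by exact/measurable_EFinP.
rewrite -!ge0_integralZl_EFin//; try by move=> x _; rewrite lee_fin.
rewrite -ge0_integralD//.
- by apply: ge0_le_integral_any => x; rewrite lee_fin.
- by move=> x _; rewrite lee_fin mulr_ge0.
- exact: measurable_funeM.
- by move=> x _; rewrite lee_fin mulr_ge0.
- exact: measurable_funeM.
Qed.

Lemma ge0_integral_le1 mu (f g : T -> R) (a : R) :
  (0 <= a)%R -> measurable_fun setT g ->
  (forall x, 0 <= f x)%R -> (forall x, 0 <= g x)%R -> (forall x, f x <= a * g x)%R ->
  \int[mu]_x (f x)%:E <= a%:E * \int[mu]_x (g x)%:E.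
Proof.
move=> a0 mg f0 g0 fg; rewrite -ge0_integralZl_EFin//.
- by apply: ge0_le_integral_any => x; rewrite lee_fin.
- by move=> x _; rewrite lee_fin.
- exact/measurable_EFinP.
Qed.

Lemma integral_probability_cst P (r : R) : \int[P]_x r%:E = r%:E.
Proof.
transitivity (r%:E * P setT); first exact: integral_cst.
by rewrite probability_setT mule1.
Qed.

Lemma ge0_integral_le_cst P (f : T -> R) (a b : R) (g : T -> R) :
  (0 <= a)%R -> (0 <= b)%R -> measurable_fun setT g ->
  (forall x, 0 <= f x)%R -> (forall x, 0 <= g x)%R -> (forall x, f x <= a + b * g x)%R ->
  \int[P]_x (f x)%:E <= a%:E + b%:E * \int[P]_x (g x)%:E.
Proof.
move=> a0 b0 mg f0 g0 fg; rewrite -[X in X + _]mule1 -(integral_probability_cst P 1).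
apply: ge0_integral_le2 => // x.
by rewrite mulr1.
Qed.

(** Here f may fail to be measurable. It lies everywhere below the function equal to +oo on N and to
    g elsewhere, which is measurable and almost everywhere equal to g. *)
Lemma ae_ge0_le_integral_any mu (f g : T -> \bar R) (N : set T) :
  measurable N -> mu N = 0 -> measurable_fun setT g ->
  (forall x, 0 <= f x) -> (forall x, 0 <= g x) -> (forall x, ~ N x -> f x <= g x) ->
  \int[mu]_x f x <= \int[mu]_x g x.
Proof.
move=> mN N0 mg f0 g0 fg.
have h0 x : 0 <= (if x \in N then +oo else g x) by case: ifP.
apply: (@le_trans _ _ (\int[mu]_x (if x \in N then +oo else g x))).
  apply: ge0_le_integral_any => // x; case: ifPn => [_|]; first by rewrite leey.
  by rewrite notin_setE; exact: fg.
apply: ae_ge0_le_integral => //.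
  apply: measurable_fun_ifT => //.
  apply: (measurable_fun_bool true); rewrite setTI (_ : _ @^-1` _ = N)//.
  by apply/seteqP; split=> x /= => [/set_mem|/mem_set].
exists N; split => // x /= /not_implyP[_]; apply: contra_notP => Nx.
by rewrite memNset//; exact: fg.
Qed.

Lemma limn_einf_le (u : (\bar R)^nat) (c : \bar R) : (forall n, u n <= c) -> limn_einf u <= c.
Proof.
move=> uc; rewrite limn_einf_lim; apply: lime_le; first exact: is_cvg_einfs.
by apply: nearW => n; apply: le_trans (uc n); apply: ereal_inf_lbound; exists n => /=.
Qed.

Lemma fatou_sqr mu (X : nat -> T -> R) (Y : T -> R) (c : \bar R) :
  (forall n, measurable_fun setT (X n)) -> (forall t, X ^~ t @ \oo --> Y t) ->
  (forall n, \int[mu]_t (X n t ^+ 2)%:E <= c) -> \int[mu]_t (Y t ^+ 2)%:E <= c.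
Proof.
move=> mX XY Xc.
have <- : \int[mu]_t limn_einf (fun n => (X n t ^+ 2)%:E) = \int[mu]_t (Y t ^+ 2)%:E.
  apply: eq_integral => t _.
  have c2 : (fun n => (X n t ^+ 2)%:E) @ \oo --> (Y t ^+ 2)%:E.
    by apply: cvg_EFin; [exact: nearW|rewrite /comp/=]; apply: cvgM; exact: XY.
  rewrite is_cvg_limn_einfE; first exact/cvg_lim.
  by apply/cvg_ex; eexists; exact: c2.
apply: (le_trans (fatou mu measurableT _ _)).
- by move=> n; apply/measurable_EFinP; exact: measurable_funX.
- by move=> n t _; rewrite lee_fin sqr_ge0.
- exact: limn_einf_le.
Qed.

End integral_bounds.

(** * Mean square of a Taylor remainder *)

Section L2_remainder.
Context {R : realType} {dT : measure_display} {T : measurableType dT}.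

(** Expand the nonnegative weighted sum of the (x_i - S/B)^2; the total weight is only assumed to be
    at most B. *)
Lemma weighted_cauchy n (b x : 'I_n -> R) (B : R) : 0 < B ->
  (forall i, 0 <= b i) -> \sum_i b i <= B ->
  (\sum_i b i * x i) ^+ 2 <= B * \sum_i b i * x i ^+ 2.
Proof.
move=> B0 b0 bB; set S := \sum_i b i * x i; set Q := \sum_i b i * x i ^+ 2.
have : 0 <= \sum_i b i * (x i - S / B) ^+ 2.
  by apply: sumr_ge0 => i _; rewrite mulr_ge0// sqr_ge0.
have -> : \sum_i b i * (x i - S / B) ^+ 2 =
    Q - 2 * (S / B) * S + (S / B) ^+ 2 * \sum_i b i.
  rewrite /Q /S mulr_sumr mulr_sumr -sumrB -big_split/=; apply: eq_bigr => i _; ring.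
clearbody S Q; move=> H.
have H2 : (S / B) ^+ 2 * \sum_i b i <= (S / B) ^+ 2 * B by rewrite ler_wpM2l// sqr_ge0.
have E1 : (S / B) ^+ 2 * B = S ^+ 2 / B by field; exact: lt0r_neq0.
have E2 : 2 * (S / B) * S = 2 * (S ^+ 2 / B) by field; exact: lt0r_neq0.
rewrite mulrC -ler_pdivrMr//; lra.
Qed.

Lemma sum_natr_le n : \sum_(k < n) k%:R <= n%:R ^+ 2 / 2 :> R.
Proof.
elim: n => [|n IH]; first by rewrite big_ord0 expr0n mul0r.
by rewrite big_ord_recr/= -natr1; lra.
Qed.

(** The remainder is the integral over [0, 1] of g(t) = dphi(t) - dphi(0). Cauchy-Schwarz with
    weight t bounds its square by 1/2 times the integral of g(t)^2 / t, whose mean is at most the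
    integral of M t, that is M / 2; hence M / 4. The argument is run on Riemann sums and passed to
    the limit by Fatou. *)
Lemma L2_remainder (mu : {measure set T -> \bar R}) (phi dphi : R -> T -> R) (M : R) :
  (forall z (t : R), is_derive t 1 (phi^~ z) (dphi t z)) ->
  (forall z, continuous (dphi^~ z)) ->
  (forall t, measurable_fun setT (dphi t)) ->
  (forall t : R, (0 <= t <= 1)%R ->
    \int[mu]_z ((dphi t z - dphi 0 z) ^+ 2)%:E <= (M * t ^+ 2)%:E)%E ->
  (\int[mu]_z ((phi 1 z - phi 0 z - dphi 0 z) ^+ 2)%:E <= (M / 4)%:E)%E.
Proof.
move=> Dphi cdphi mdphi HM.
pose X (n : nat) z : R :=
  \sum_(k < n.+1) dphi (k%:R / n.+1%:R) z / n.+1%:R - dphi 0 z.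
apply: (@fatou_sqr _ _ _ mu X).
- move=> n; apply: measurable_funB => //; apply: measurable_sum => k.
  by apply: measurable_funM => //; exact: measurable_cst.
- move=> z; apply: cvgB; last exact: cvg_cst.
  exact: (@riemann_sum_cvg R (phi^~ z) (dphi^~ z)).
move=> n; have [N NE] : exists N : R, N = n.+1%:R by eexists.
have N0 : 0 < N by rewrite NE ltr0n.
have N_neq0 : N != 0 by rewrite gt_eqF.
(* The discretised weight t dt at t = k / N, of total mass at most 1/2; [x] is the increment divided
   by t. At k = 0 the inverse of 0 is 0, which is harmless because the weight and the increment both
   vanish. *)
pose b (k : 'I_n.+1) : R := k%:R / N ^+ 2.
pose x z (k : 'I_n.+1) : R := (dphi (k%:R / N) z - dphi 0 z) * (N / k%:R).
have b0 k : 0 <= b k by rewrite /b divr_ge0// exprn_ge0// ltW.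
have sumN : \sum_(k < n.+1) (k%:R : R) <= N ^+ 2 / 2.
  by rewrite NE; exact: sum_natr_le.
have bB : \sum_k b k <= 2^-1.
  by rewrite -mulr_suml ler_pdivrMr ?exprn_gt0// mulrC.
have XE z : X n z = \sum_k b k * x z k.
  rewrite /X -NE.
  have -> : dphi 0 z = \sum_(k < n.+1) dphi 0 z / N.
    by rewrite sumr_const card_ord -mulr_natr -NE divfK.
  rewrite -sumrB; apply: eq_bigr => k _; rewrite /b /x.
  have [k0|k0] := eqVneq (k%:R : R) 0; first by rewrite k0 !mul0r subrr.
  by field; rewrite ?N_neq0 ?k0.
have mx k : measurable_fun setT (fun z => x z k ^+ 2).
  apply: measurable_funX; apply: measurable_funM; last exact: measurable_cst.
  exact: measurable_funB.
apply: (@le_trans _ _ (\int[mu]_z (2^-1%:E * \sum_k (b k * x z k ^+ 2)%:E))%E).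
  apply: ge0_le_integral_any => z; first by rewrite lee_fin sqr_ge0.
  by rewrite sumEFin -EFinM lee_fin XE; exact: weighted_cauchy.
rewrite ge0_integralZl_EFin//; last 2 first.
- by move=> z _; apply: sume_ge0 => k _; rewrite lee_fin mulr_ge0// sqr_ge0.
- apply: emeasurable_sum => k; apply/measurable_EFinP; apply: measurable_funM => //.
rewrite ge0_integral_sum//; last 2 first.
- move=> k; apply/measurable_EFinP; apply: measurable_funM => //.
- by move=> k z _; rewrite lee_fin mulr_ge0// sqr_ge0.
have M0 : 0 <= M.
  have := HM 1; rewrite ler01 lexx expr1n mulr1 => /(_ isT); rewrite -lee_fin.
  by apply: le_trans; apply: integral_ge0 => z _; rewrite lee_fin sqr_ge0.
apply: (@le_trans _ _ (2^-1%:E * \sum_(k < n.+1) (M * b k)%:E)%E).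
  rewrite lee_wpmul2l//; apply: lee_sum => k _.
  have [k0|k0] := eqVneq (k%:R : R) 0.
    by rewrite /b k0 mul0r mulr0; under eq_integral do rewrite mul0r; rewrite integral0.
  have kN : 0 <= k%:R / N <= 1.
    by rewrite divr_ge0 ?(ltW N0)//= ler_pdivrMr// mul1r NE ler_nat ltnW.
  apply: (@le_trans _ _ ((b k * (N / k%:R) ^+ 2)%:E * \int[mu]_z ((dphi (k%:R / N) z - dphi 0 z) ^+ 2)%:E)%E).
    rewrite -ge0_integralZl_EFin//.
    - apply: ge0_le_integral_any => z; first by rewrite lee_fin mulr_ge0// sqr_ge0.
      by rewrite -EFinM lee_fin /x exprMn; apply: le_of_eq; ring.
    - by move=> z _; rewrite lee_fin sqr_ge0.
    - by apply/measurable_EFinP; apply: measurable_funX; exact: measurable_funB.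
    - by rewrite mulr_ge0// sqr_ge0.
  apply: (le_trans (lee_wpmul2l _ (HM _ kN))); first by rewrite lee_fin mulr_ge0// sqr_ge0.
  rewrite -EFinM lee_fin; apply: le_of_eq; rewrite /b; field.
  by rewrite ?N_neq0 ?k0.
rewrite sumEFin -EFinM lee_fin -mulr_sumr.
have : M * \sum_k b k <= M * 2^-1 by rewrite ler_wpM2l.
lra.
Qed.

End L2_remainder.

(** * Square integrable random rows *)

Section random_rows.
Context {R : realType} {d : nat} {dT : measure_display} {T : measurableType dT}.
Variable P : probability T R.
Implicit Types (Z : T -> 'rV[R]_d).

Definition mean_row Z : 'rV[R]_d := \row_i fine (\int[P]_t (Z t 0 i)%:E).

Definition square_integrable p Z :=
  measurable_fun setT Z /\ (\int[P]_t (pnorm p (Z t) ^+ 2)%:E < +oo)%E.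

Lemma integrable_pnorm_sqr p Z : square_integrable p Z ->
  P.-integrable setT (fun t => (pnorm p (Z t) ^+ 2)%:E).
Proof.
move=> [mZ Z2]; apply/integrableP; split.
  by apply/measurable_EFinP; exact: measurable_pnorm_sqr.
by under eq_integral do rewrite gee0_abs ?lee_fin ?sqr_ge0//.
Qed.

Lemma integrable_coord p Z i : 0 < p -> square_integrable p Z ->
  P.-integrable setT (fun t => (Z t 0 i)%:E).
Proof.
move=> p0 sZ; have [mZ _] := sZ.
apply: (@le_integrable _ _ _ P setT measurableT _ (fun t => (1 + pnorm p (Z t) ^+ 2)%:E)).
- by apply/measurable_EFinP; exact: measurable_row_coord.
- move=> t _; rewrite !abse_EFin lee_fin.
  rewrite (@ger0_norm _ (1 + _)); last by rewrite addr_ge0// sqr_ge0.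
  apply: (le_trans (norm_coord_pnorm (Z t) i p0)).
  have := sqr_ge0 (pnorm p (Z t) - 1); have := pnorm_ge0 p (Z t).
  move: (pnorm p (Z t)) => a a0; rewrite sqrrB; nra.
- have i1 : P.-integrable setT (fun=> 1%:E) by exact: finite_measure_integrable_cst.
  exact: (integrableD measurableT i1 (integrable_pnorm_sqr sZ)).
Qed.

Lemma square_integrableD p Z W : 1 <= p ->
  square_integrable p Z -> square_integrable p W ->
  square_integrable p (fun t => Z t + W t).
Proof.
move=> p1 [mZ Z2] [mW W2]; split; first exact: measurable_rowD.
apply: (@le_lt_trans _ _ (2%:E * \int[P]_t (pnorm p (Z t) ^+ 2)%:E +
    2%:E * \int[P]_t (pnorm p (W t) ^+ 2)%:E)%E).
  apply: ge0_integral_le2 => // [||x|x|x|x]; rewrite ?sqr_ge0//.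
  - exact: measurable_pnorm_sqr.
  - exact: measurable_pnorm_sqr.
  - exact: pnorm_sqrD_le.
by rewrite lte_add_pinfty// lte_mul_pinfty.
Qed.

Lemma square_integrableZ p a Z : p != 0 -> square_integrable p Z ->
  square_integrable p (fun t => a *: Z t).
Proof.
move=> p0 [mZ Z2]; split.
  by apply: measurable_rowZ => //; exact: measurable_cst.
apply: (@le_lt_trans _ _ ((a ^+ 2)%:E * \int[P]_t (pnorm p (Z t) ^+ 2)%:E)%E).
  apply: ge0_integral_le1 => // [||x|x|x]; rewrite ?sqr_ge0//.
    exact: measurable_pnorm_sqr.
  by rewrite pnormZ// exprMn real_normK ?num_real.
by rewrite lte_mul_pinfty// lee_fin sqr_ge0.
Qed.

Lemma square_integrable_cst p (a : 'rV[R]_d) : square_integrable p (fun=> a).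
Proof.
split; first exact: measurable_cst.
by rewrite integral_probability_cst ltry.
Qed.

Lemma integrable_dotv p J Z : 0 < p -> square_integrable p Z ->
  P.-integrable setT (fun t => (dotv J (Z t))%:E).
Proof.
move=> p0 sZ.
rewrite (_ : (fun t => _) = (fun t => \sum_(i < d) ((J 0 i)%:E * (Z t 0 i)%:E))%E).
  by apply: integrable_sum => // i _; apply: integrableZl => //; exact: integrable_coord sZ.
by apply/funext => t; rewrite dotvE -sumEFin; apply: eq_bigr => i _; rewrite EFinM.
Qed.

Lemma mean_rowE p Z i : 0 < p -> square_integrable p Z ->
  (\int[P]_t (Z t 0 i)%:E = (mean_row Z 0 i)%:E)%E.
Proof.
move=> p0 sZ; rewrite mxE fineK//; apply: integrable_fin_num => //.
exact: integrable_coord sZ.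
Qed.

Lemma integral_dotv p J Z : 0 < p -> square_integrable p Z ->
  (\int[P]_t (dotv J (Z t))%:E = (dotv J (mean_row Z))%:E)%E.
Proof.
move=> p0 sZ.
rewrite (eq_integral (fun t => \sum_(i < d) ((J 0 i)%:E * (Z t 0 i)%:E))%E); last first.
  by move=> t _; rewrite dotvE -sumEFin; apply: eq_bigr => i _; rewrite EFinM.
rewrite integral_sum//; last first.
  by move=> i; apply: integrableZl => //; exact: integrable_coord sZ.
rewrite dotvE -sumEFin; apply: eq_bigr => i _.
rewrite integralZl//; last exact: integrable_coord sZ.
by rewrite (mean_rowE i p0 sZ) EFinM.
Qed.

Lemma mean_rowD p Z W : 0 < p -> square_integrable p Z -> square_integrable p W ->
  mean_row (fun t => Z t + W t) = mean_row Z + mean_row W.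
Proof.
move=> p0 sZ sW; apply/rowP => i; rewrite !mxE.
under eq_integral do rewrite mxE EFinD.
rewrite integralD//; [|exact: integrable_coord sZ|exact: integrable_coord sW].
by rewrite fineD// (mean_rowE i p0 sZ, mean_rowE i p0 sW).
Qed.

Lemma mean_rowZ p a Z : 0 < p -> square_integrable p Z ->
  mean_row (fun t => a *: Z t) = a *: mean_row Z.
Proof.
move=> p0 sZ; apply/rowP => i; rewrite !mxE.
under eq_integral do rewrite mxE EFinM.
rewrite integralZl//; last exact: integrable_coord sZ.
by rewrite fineM// (mean_rowE i p0 sZ).
Qed.

Lemma mean_row_cst (a : 'rV[R]_d) : mean_row (fun=> a) = a.
Proof. by apply/rowP => i; rewrite mxE integral_probability_cst. Qed.

Lemma mean_row_center p Z : 0 < p -> 1 <= p -> square_integrable p Z ->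
  square_integrable p (fun t => Z t - mean_row Z) /\
  mean_row (fun t => Z t - mean_row Z) = 0.
Proof.
move=> p0 p1 sZ.
have sN := square_integrable_cst p (- mean_row Z).
split; first exact: square_integrableD.
by rewrite (mean_rowD p0 sZ sN) mean_row_cst subrr.
Qed.

(** Integrate [pnorm_smooth]: the linear term has mean zero. *)
Lemma pnorm_sqrD_mean0 p (a : 'rV[R]_d) Z : 2 <= p -> square_integrable p Z ->
  mean_row Z = 0 ->
  (\int[P]_t (pnorm p (a + Z t) ^+ 2)%:E <=
   (pnorm p a ^+ 2)%:E + (p - 1)%:E * \int[P]_t (pnorm p (Z t) ^+ 2)%:E)%E.
Proof.
move=> p2 sZ Z0; have p0 : 0 < p by lra.
have iZ := integrable_pnorm_sqr sZ.
have iJ := integrable_dotv (dual_map p a) p0 sZ.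
have ia : P.-integrable setT (fun t : T => (pnorm p a ^+ 2)%:E).
  exact: finite_measure_integrable_cst.
have iZ' : P.-integrable setT (fun t => ((p - 1)%:E * (pnorm p (Z t) ^+ 2)%:E)%E).
  exact: integrableZl.
apply: (@le_trans _ _ (\int[P]_t (((pnorm p a ^+ 2)%:E + (dotv (dual_map p a) (Z t))%:E) +
    (p - 1)%:E * (pnorm p (Z t) ^+ 2)%:E))%E).
  apply: ge0_le_integral_any => t; first by rewrite lee_fin sqr_ge0.
  by rewrite -EFinM -!EFinD lee_fin; exact: pnorm_smooth.
rewrite integralD//; last exact: integrableD.
rewrite integralD// integral_probability_cst (integral_dotv _ p0 sZ) Z0 dotv0r adde0.
by rewrite integralZl.
Qed.

(** Integrate the subgradient inequality of the squared norm at the mean. *)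
Lemma jensen_pnorm_sqr p Z : 2 <= p -> square_integrable p Z ->
  ((pnorm p (mean_row Z) ^+ 2)%:E <= \int[P]_t (pnorm p (Z t) ^+ 2)%:E)%E.
Proof.
move=> p2 sZ; have p0 : 0 < p by lra.
have p1 : 1 <= p by lra.
have [sC C0] := mean_row_center p0 p1 sZ.
set a := mean_row Z in sC C0 *.
have iJ := integrable_dotv (dual_map p a) p0 sC.
have ia : P.-integrable setT (fun t : T => (pnorm p a ^+ 2)%:E).
  exact: finite_measure_integrable_cst.
have <- : (\int[P]_t ((pnorm p a ^+ 2)%:E + (dotv (dual_map p a) (Z t - a))%:E) =
    (pnorm p a ^+ 2)%:E)%E.
  by rewrite integralD// integral_probability_cst (integral_dotv _ p0 sC) C0 dotv0r adde0.
apply: le_integral => //; [exact: integrableD|exact: integrable_pnorm_sqr|].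
move=> t _; rewrite -EFinD lee_fin.
by have := dual_map_subgradient a (Z t - a) p2; rewrite subrKC.
Qed.

Lemma centered_pnorm_sqr p Z : 2 <= p -> square_integrable p Z ->
  (\int[P]_t (pnorm p (Z t - mean_row Z) ^+ 2)%:E <=
   2%:E * \int[P]_t (pnorm p (Z t) ^+ 2)%:E + (2 * pnorm p (mean_row Z) ^+ 2)%:E)%E.
Proof.
move=> p2 sZ; have [mZ _] := sZ.
rewrite addeC; apply: ge0_integral_le_cst => // [||x|x|x]; rewrite ?sqr_ge0//.
- by rewrite mulr_ge0// sqr_ge0.
- exact: measurable_pnorm_sqr.
- have p1 : 1 <= p by lra.
  have p_neq0 : p != 0 by apply: lt0r_neq0; lra.
  apply: (le_trans (pnorm_sqrD_le _ _ p1)); rewrite (pnormN _ p_neq0).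
  by clear; gen_norms; lra.
Qed.

(** In place of a Hilbert variance identity: the triangle inequality gives 2 and 2, and Jensen
    merges them into 4. *)
Lemma centered_pnorm_sqr4 p Z : 2 <= p -> square_integrable p Z ->
  (\int[P]_t (pnorm p (Z t - mean_row Z) ^+ 2)%:E <=
   4%:E * \int[P]_t (pnorm p (Z t) ^+ 2)%:E)%E.
Proof.
move=> p2 sZ; apply: (le_trans (centered_pnorm_sqr p2 sZ)).
have := jensen_pnorm_sqr p2 sZ; have [_ Z2] := sZ.
have : (0 <= \int[P]_t (pnorm p (Z t) ^+ 2)%:E)%E.
  by apply: integral_ge0 => t _; rewrite lee_fin sqr_ge0.
move: (\int[P]_t _)%E Z2 => [r| |]// _ _; rewrite -!EFinM -EFinD !lee_fin.
by move: (pnorm p _ ^+ 2) => a; lra.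
Qed.

End random_rows.

(** * The mirror step *)

Section row_topology.
Context {R : realType} {d : nat}.
Implicit Types (x y : 'rV[R]_d).

Lemma norm_coord_le x i : `|x 0 i| <= `|x|.
Proof.
have /mapP[j Hj ->] : `|x 0 i| \in [seq `|x k.1 k.2| | k : 'I_1 * 'I_d].
  by apply/mapP; exists (0, i) => //=; rewrite mem_enum.
by rewrite [leRHS]/Num.Def.normr /= mx_normrE; apply/bigmax_geP; right => /=; exists j.
Qed.

Lemma pnorm_le_norm p x : 1 <= p -> pnorm p x <= d%:R * `|x|.
Proof.
move=> p1; apply: (le_trans (pnorm_le_sum x p1)).
apply: (@le_trans _ _ (\sum_(i < d) `|x|)); first by apply: ler_sum => i _; exact: norm_coord_le.
by rewrite sumr_const card_ord -[leLHS]mulr_natl.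
Qed.

Lemma norm_le_pnorm p x : 0 < p -> `|x| <= pnorm p x.
Proof.
move=> p0; rewrite [leLHS]/Num.Def.normr /= mx_normrE; apply/bigmax_leP; split; first exact: pnorm_ge0.
by move=> [i j] _ /=; rewrite (ord1 i); exact: norm_coord_pnorm.
Qed.

Lemma lipschitz_within_continuous p (f : 'rV[R]_d -> R) (A : set 'rV[R]_d) (C : R) :
  1 <= p -> (forall x y, A x -> A y -> `|f x - f y| <= C * pnorm p (x - y)) ->
  {within A, continuous f}.
Proof.
move=> p1 fC.
wlog C0 : C fC / 0 < C.
  move=> W; apply: (W (Num.max C 1)); last by rewrite lt_max ltr01 orbT.
  move=> x y Ax Ay; apply: (le_trans (fC x y Ax Ay)).
  by rewrite ler_wpM2r ?pnorm_ge0// le_max lexx.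
apply/subspace_continuousP => x Ax; apply/cvgrPdist_le => e e0.
have D0 : 0 < C * (d%:R + 1) by rewrite mulr_gt0// ltr_wpDl.
have r0 : 0 < e / (C * (d%:R + 1)) by rewrite divr_gt0.
rewrite near_withinE; apply: filterS (nbhsx_ballx x _ r0) => y xy Ay.
rewrite -ball_normE /= in xy; move/ltW: xy => xy.
 apply: (le_trans (fC x y Ax Ay)).
apply: (le_trans (ler_wpM2l (ltW C0) (pnorm_le_norm _ p1))).
rewrite ler_pdivlMr// mulrC in xy; apply: le_trans xy.
by rewrite -mulrA ler_pM2l// ler_wpM2r// lerDl.
Qed.

Lemma lipschitz_continuous_row p (f : 'rV[R]_d -> R) (C : R) : 1 <= p ->
  (forall x y, `|f x - f y| <= C * pnorm p (x - y)) -> continuous f.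
Proof.
move=> p1 fC; apply/continuous_subspace_setT.
by apply: (@lipschitz_within_continuous p f setT C) => // x y _ _; exact: fC.
Qed.

Lemma compact_row p (A : set 'rV[R]_d) (D : R) : 0 < p -> closed A ->
  (forall x, A x -> pnorm p x <= D) -> compact A.
Proof.
move=> p0 cA AD; apply: bounded_closed_compact => //.
exists D; split; first exact: num_real.
move=> M DM x Ax; apply: (le_trans (norm_le_pnorm x p0)).
by apply: (le_trans (AD _ Ax)); exact: ltW.
Qed.

Lemma convex_setP (A : set 'rV[R]_d) x y (t : R) : convex_set A ->
  0 <= t -> t <= 1 -> A x -> A y -> A (t *: x + (1 - t) *: y).
Proof.
move=> cA t0 t1 Ax Ay; have := cA x y (Itv01 t0 t1) (mem_set Ax) (mem_set Ay).
by move/set_mem.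
Qed.

End row_topology.

(** * The proximal map: existence, stability, descent *)

Section mirror.
Context {R : realType} {d : nat}.
Variables (p q : R) (X : set 'rV[R]_d) (h : 'rV[R]_d -> \bar R) (v : 'rV[R]_d -> R).
Variables (D_X M_h eta : R).
Hypotheses (p_gt0 : 0 < p) (q_ge1 : 1 <= q) (pq : p^-1 + q^-1 = 1).
Hypotheses (X_neq0 : X !=set0) (X_closed : closed X) (X_convex : convex_set X).
Hypothesis X_bounded : forall x, X x -> pnorm q x <= D_X.
Hypothesis h_convex : econvex h.
Hypothesis h_subdifferential_neq0 : forall x, X x -> subdifferential h x !=set0.
Hypothesis h_subdifferential_bounded : forall x g, X x -> subdifferential h x g ->
  pnorm 2 g <= M_h.
Hypothesis v_differentiable : forall x, differentiable v x.
Hypothesis v_strongly_convex : forall x y,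
  pnorm q (x - y) ^+ 2 <= dotv (x - y) (grad v x - grad v y).
Hypothesis eta_gt0 : 0 < eta.
Implicit Types (x y z g : 'rV[R]_d).

Let hr x := fine (h x).

Let q_gt0 : 0 < q. Proof. exact: lt_le_trans q_ge1. Qed.

Lemma h_fin x : X x -> h x = (hr x)%:E.
Proof. by move=> /h_subdifferential_neq0[g [hx _]]; rewrite /hr fineK. Qed.

Lemma h_lipschitz x y : X x -> X y -> `|hr x - hr y| <= M_h * pnorm 2 (x - y).
Proof.
have half x' y' : X x' -> X y' -> hr x' - hr y' <= M_h * pnorm 2 (x' - y').
  move=> Xx Xy; have [g gx] := h_subdifferential_neq0 Xx.
  have := h_subdifferential_bounded Xx gx; have := gx.2 y'.
  rewrite (h_fin Xx) (h_fin Xy) -EFinD lee_fin => H gM.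
  have := cauchy_dotv g (y' - x'); rewrite ler_norml => /andP[C1 C2].
  rewrite pnorm_distC ?pnatr_eq0//.
  have := ler_wpM2r (pnorm_ge0 2 (y' - x')) gM.
  move: H C1 C2; gen_norms; lra.
move=> Xx Xy; rewrite ler_norml; apply/andP; split; last exact: half.
by have := half _ _ Xy Xx; rewrite pnorm_distC ?pnatr_eq0//; lra.
Qed.

Definition prox_obj z y : \bar R := ((dotv z y)%:E + h y + (eta^-1 * v y)%:E)%E.

Definition prox z : 'rV[R]_d := argmin X (prox_obj z).

(** Up to a constant, the Bregman term is v plus a linear term that can be absorbed into g. The
    mirror step is thus a function of one row, and its joint measurability in x and g follows from
    the continuity of [prox]. *)
Lemma mirror_stepE x g : mirror_step X h v eta x g = prox (g - eta^-1 *: grad v x).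
Proof.
rewrite /mirror_step /prox /argmin; congr get; apply/seteqP.
pose C := eta^-1 * (v x - dotv (grad v x) x).
have E y : X y -> ((dotv g y)%:E + h y + (eta^-1 * bregman v x y)%:E)%E =
    (prox_obj (g - eta^-1 *: grad v x) y - C%:E)%E.
  move=> /h_fin hE; rewrite /prox_obj hE -EFinN -!EFinD; congr EFin.
  rewrite /bregman /C dotvBl dotvZl dotvBr; clear; gen_norms.
  by move=> *; ring.
by split=> y [Xy ymin]; split=> // z Xz; move: (ymin z Xz);
  rewrite !E// leeD2rE.
Qed.

(** X is compact, and h is Lipschitz on X because its subgradients there are bounded, so the
    objective is continuous on X. *)
Lemma prox_exists z : exists x, X x /\ forall y, X y -> (prox_obj z x <= prox_obj z y)%E.
Proof.
have cX := compact_row q_gt0 X_closed X_bounded.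
have co : {within X, continuous (fun y => dotv z y + hr y + eta^-1 * v y)}.
  have ch : {within X, continuous hr}.
    by apply: (@lipschitz_within_continuous _ _ 2 hr X M_h) h_lipschitz; rewrite ler1n.
  have cd : continuous (dotv z).
    apply: (@lipschitz_continuous_row _ _ 2 _ (pnorm 2 z)); first by rewrite ler1n.
    by move=> x y; rewrite -dotvBr; exact: cauchy_dotv.
  have cv0 : continuous v by move=> y; exact: differentiable_continuous.
  have cv : continuous (fun y => eta^-1 * v y).
    by move=> y; exact: (@cvgMr _ _ (nbhs y) _ v (eta^-1) (v y) (cv0 y)).
  move=> y; apply: cvgD; first apply: cvgD.
  - exact: (continuous_subspaceT cd).
  - exact: ch.
  - exact: (continuous_subspaceT cv).
have [x xX xmin] := compact_EVT_min X_neq0 cX co.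
move/set_mem: xX => Xx; exists x; split => // y Xy.
by rewrite /prox_obj !h_fin// -!EFinD lee_fin; apply: xmin; exact: mem_set.
Qed.

Lemma prox_min z : X (prox z) /\ forall y, X y -> (prox_obj z (prox z) <= prox_obj z y)%E.
Proof.
exact: (@getPex _ [set x | X x /\ forall y, X y -> (prox_obj z x <= prox_obj z y)%E]
  (prox_exists z)).
Qed.

Lemma prox_in z : X (prox z). Proof. by have [] := prox_min z. Qed.

(** Compare the minimiser x with x + t (y - x) for t = 1/(n+1). Convexity of h makes its
    contribution linear in t; dividing by t and letting n grow leaves the derivative of v. *)
Lemma prox_variational z y : X y ->
  0 <= dotv (z + eta^-1 *: grad v (prox z)) (y - prox z) + hr y - hr (prox z).
Proof.
move=> Xy; have [Xx xmin] := prox_min z; set x := prox z in Xx xmin *.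
pose A := dotv z (y - x) + hr y - hr x.
have c : (fun n => A + eta^-1 * (n.+1%:R * (v (n.+1%:R^-1 *: (y - x) + x) - v x))) @ \oo -->
    A + eta^-1 * 'D_(y - x) v x.
  apply: cvgD; first exact: cvg_cst.
  by apply: cvgMr; apply: cvg_diff_quotient; exact: diff_derivable.
have -> : dotv (z + eta^-1 *: grad v x) (y - x) + hr y - hr x = A + eta^-1 * 'D_(y - x) v x.
  by rewrite derive_grad// /A dotvDl dotvZl; ring.
apply: (cvgr_to_ge c); apply: nearW => n.
have [t tE] : exists t : R, t = n.+1%:R^-1 by eexists.
have nE : n.+1%:R = t^-1 by rewrite tE invrK.
rewrite -tE nE.
have t0 : 0 < t by rewrite tE invr_gt0 ltr0n.
have t1 : t <= 1 by rewrite tE invf_le1 ?ltr0n// ler1n.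
have yE : t *: (y - x) + x = t *: y + (1 - t) *: x.
  by rewrite scalerBr scalerBl scale1r -addrA (addrC _ x).
have Xt : X (t *: y + (1 - t) *: x) by apply: convex_setP => //; exact: ltW.
have := xmin _ Xt; have := h_convex y x (ltW t0) t1.
rewrite /prox_obj (h_fin Xt) (h_fin Xx) (h_fin Xy) -!EFinM -!EFinD !lee_fin -yE.
rewrite !dotvDr !dotvZr => H1 H2.
rewrite -(pmulr_rge0 _ t0) mulrDr mulrCA mulVKf ?gt_eqF// /A.
move: H1 H2; move: (v (t *: (y - x) + x)) (hr (t *: (y - x) + x)).
rewrite dotvBr; gen_norms; move=> a b; nra.
Qed.

(** Test each variational inequality at the other minimiser and add: h cancels, strong convexity of
    v bounds one side below and Hölder the other above. *)
Lemma prox_lipschitz z z' : pnorm q (prox z - prox z') <= eta * pnorm p (z - z').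
Proof.
have := prox_variational z (prox_in z'); have := prox_variational z' (prox_in z).
move: (prox z) (prox z') => x x'.
have := v_strongly_convex x x'; have := hoelder_dotv (z - z') (x' - x) p_gt0 q_gt0 pq.
rewrite (pnorm_distC x' x (lt0r_neq0 q_gt0)) ler_norml => /andP[_ H1] H2 H3 H4.
have [->|n0] := eqVneq (pnorm q (x - x')) 0; first by rewrite mulr_ge0 ?pnorm_ge0// ltW.
have ngt : 0 < pnorm q (x - x') by rewrite lt_neqAle eq_sym n0 pnorm_ge0.
rewrite -(ler_pM2r ngt) -expr2 -mulrA -ler_pdivrMl//.
apply: le_trans H1.
apply: (@le_trans _ _ (eta^-1 * dotv (x - x') (grad v x - grad v x'))).
  by rewrite ler_pM2l ?invr_gt0.
move: H3 H4; rewrite -(opprB x' x); move: (x' - x) (grad v x) (grad v x') => w a b.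
rewrite !dotvNr !dotvNl (dotvC w) !dotvDl !dotvZl !dotvNl; gen_norms.
move: (eta^-1) => t; lra.
Qed.

Lemma measurable_prox : measurable_fun setT prox.
Proof.
have p1 : 1 <= p.
  have : p^-1 <= 1 by rewrite -pq lerDl invr_ge0 ltW.
  by rewrite invf_le1.
apply: measurable_rowP => i; apply: continuous_measurable_row.
apply: (@lipschitz_continuous_row _ _ p _ eta) => // x y.
apply: le_trans (prox_lipschitz x y).
by have := norm_coord_pnorm (prox x - prox y) i q_gt0; rewrite !mxE.
Qed.

Lemma mirror_step_in x g : X (mirror_step X h v eta x g).
Proof. by rewrite mirror_stepE; exact: prox_in. Qed.

Lemma mirror_step_lipschitz x g g' :
  pnorm q (mirror_step X h v eta x g - mirror_step X h v eta x g') <=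
  eta * pnorm p (g - g').
Proof.
by rewrite !mirror_stepE; apply: le_trans (prox_lipschitz _ _) _; rewrite opprD addrACA subrr addr0.
Qed.

Lemma measurable_mirror_step d' (T : measurableType d') (x g : T -> 'rV[R]_d) :
  measurable_fun setT x -> measurable_fun setT g ->
  measurable_fun setT (fun t => mirror_step X h v eta (x t) (g t)).
Proof.
move=> mx mg; under eq_fun do rewrite mirror_stepE.
apply: (measurableT_comp measurable_prox); apply: measurable_rowB => //.
apply: measurable_rowZ; first exact: measurable_cst.
by apply: measurableT_comp mx; exact: measurable_grad.
Qed.

(** The variational inequality tested at y = x, where strong convexity of v supplies the square. *)
Lemma mirror_step_descent x g : X x ->
  dotv g (mirror_step X h v eta x g - x) + hr (mirror_step X h v eta x g) - hr x <=
  - (eta^-1 * pnorm q (x - mirror_step X h v eta x g) ^+ 2).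
Proof.
move=> Xx; have := prox_variational (g - eta^-1 *: grad v x) Xx.
rewrite -mirror_stepE; move: (mirror_step _ _ _ _ _ _) => x'.
have := v_strongly_convex x x'; move/(ler_wpM2l (_ : 0 <= eta^-1)).
rewrite invr_ge0 ltW// => /(_ isT).
rewrite -(opprB x x'); move: (x - x') (grad v x) (grad v x') => w a b.
rewrite !dotvNr (dotvC w) !dotvDl !dotvNl !dotvZl; gen_norms.
move: (eta^-1) => t; lra.
Qed.

End mirror.

(** * Descent of the augmented Lagrangian *)

Section descent.
Context {R : realType} {d m : nat}.
Variables (p q : R) (X : set 'rV[R]_d) (h : 'rV[R]_d -> \bar R) (v : 'rV[R]_d -> R).
Variables (f : 'rV[R]_d -> R) (c : 'rV[R]_d -> 'rV[R]_m).
Variables (D_X M_h eta mu rho L_f Mbar_c M_c L_c Phi_inf : R).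
Hypotheses (p_ge2 : 2 <= p) (q_ge1 : 1 <= q) (q_le2 : q <= 2) (pq : p^-1 + q^-1 = 1).
Hypotheses (X_neq0 : X !=set0) (X_closed : closed X) (X_convex : convex_set X).
Hypothesis X_bounded : forall x, X x -> pnorm q x <= D_X.
Hypothesis h_convex : econvex h.
Hypothesis h_subdifferential_neq0 : forall x, X x -> subdifferential h x !=set0.
Hypothesis h_subdifferential_bounded : forall x g, X x -> subdifferential h x g ->
  pnorm 2 g <= M_h.
Hypothesis v_differentiable : forall x, differentiable v x.
Hypothesis v_strongly_convex : forall x y,
  pnorm q (x - y) ^+ 2 <= dotv (x - y) (grad v x - grad v y).
Hypothesis f_differentiable : forall x, differentiable f x.
Hypothesis c_differentiable : forall i x, differentiable (fun y => c y 0 i) x.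
Hypothesis f_smooth : forall x y, X x -> X y ->
  pnorm 2 (grad f x - grad f y) <= L_f * pnorm 2 (x - y).
Hypothesis c_bounded : forall i x, X x -> `|c x 0 i| <= Mbar_c.
Hypothesis grad_c_bounded : forall i x, X x -> pnorm 2 (grad (fun z => c z 0 i) x) <= M_c.
Hypothesis c_smooth : forall i x y, X x -> X y ->
  pnorm 2 (grad (fun z => c z 0 i) x - grad (fun z => c z 0 i) y) <= L_c * pnorm 2 (x - y).
Hypothesis Phi_bounded : forall x, X x -> (Phi_inf%:E <= (f x)%:E + h x)%E.
Hypotheses (eta_gt0 : 0 < eta) (mu_gt0 : 0 < mu) (rho_gt0 : 0 < rho).
Hypotheses (L_f_gt0 : 0 < L_f) (Mbar_c_gt0 : 0 < Mbar_c) (L_c_gt0 : 0 < L_c).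
Let L_mu := L_f + m%:R * (mu * M_c ^+ 2 + mu * Mbar_c * L_c + rho * Mbar_c * L_c).
Hypothesis eta_L_mu : eta * L_mu <= 2^-1.
Implicit Types (x y z g s : 'rV[R]_d) (l : 'rV[R]_m).

Let hr x := fine (h x).

Lemma segment_in x y (t : R) : X x -> X y -> 0 <= t <= 1 -> X (x + t *: (y - x)).
Proof.
move=> Xx Xy /andP[t0 t1].
have -> : x + t *: (y - x) = t *: y + (1 - t) *: x.
  by rewrite scalerBr scalerBl scale1r addrCA.
exact: convex_setP.
Qed.

Lemma smooth_on_taylor (phi : 'rV[R]_d -> R) (L : R) x y : X x -> X y ->
  (forall x, differentiable phi x) ->
  (forall x y, X x -> X y -> pnorm 2 (grad phi x - grad phi y) <= L * pnorm 2 (x - y)) ->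
  `|phi y - phi x - dotv (grad phi x) (y - x)| <= L / 2 * pnorm 2 (y - x) ^+ 2.
Proof.
move=> Xx Xy dphi Lphi; rewrite -[X in phi X](subrKC x).
apply: smooth_taylor => // t t01; apply: (le_trans (Lphi _ _ (segment_in Xx Xy t01) Xx)).
move: t01 => /andP[t0 _].
by rewrite addrC addKr pnormZ ?pnatr_eq0// ger0_norm.
Qed.

Lemma c_lipschitz i x y : X x -> X y -> `|c y 0 i - c x 0 i| <= M_c * pnorm 2 (y - x).
Proof.
move=> Xx Xy; pose phi z := c z 0 i.
have := @is_derive_bound R (fun t => phi (x + t *: (y - x)))
  (fun t => dotv (grad phi (x + t *: (y - x))) (y - x)) 0 1 (M_c * pnorm 2 (y - x)) ler01.
rewrite scale0r addr0 scale1r subrKC subr0 mulr1; apply.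
  by move=> t t01; apply: is_derive_line; exact: c_differentiable.
move=> t /andP[/ltW t0 /ltW t1]; apply: (le_trans (cauchy_dotv _ _)).
rewrite ler_wpM2r ?pnorm_ge0//; apply: grad_c_bounded; apply: segment_in => //.
by rewrite t0.
Qed.

Lemma dotv_grad_constr x l w :
  dotv (grad_constr c x l) w = \sum_(i < m) l 0 i * dotv (grad (fun z => c z 0 i) x) w.
Proof.
rewrite /grad_constr; elim/big_ind2 : _ => [|a a' b b' <- <-|i _].
- by rewrite dotv0l.
- by rewrite dotvDl.
- by rewrite dotvZl.
Qed.

Definition psi l x := f x + dotv l (c x) + mu / 2 * pnorm 2 (c x) ^+ 2.

Lemma psi_taylor l x y : X x -> X y -> (forall i, `|l 0 i| <= rho * Mbar_c) ->
  psi l y - psi l x - dotv (grad f x + grad_constr c x (l + mu *: c x)) (y - x) <=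
  L_mu / 2 * pnorm 2 (y - x) ^+ 2.
Proof.
move=> Xx Xy lM; rewrite dotvDl dotv_grad_constr.
have Hf := smooth_on_taylor Xx Xy f_differentiable f_smooth.
set D := pnorm 2 (y - x) in Hf *.
have D0 : 0 <= D by exact: pnorm_ge0.
pose B := (mu * M_c ^+ 2 + mu * Mbar_c * L_c + rho * Mbar_c * L_c) / 2 * D ^+ 2.
have Hc i : l 0 i * c y 0 i - l 0 i * c x 0 i + mu / 2 * (c y 0 i ^+ 2 - c x 0 i ^+ 2)
    - (l + mu *: c x) 0 i * dotv (grad (fun z => c z 0 i) x) (y - x) <= B.
  have := smooth_on_taylor Xx Xy (c_differentiable i) (@c_smooth i).
  have := c_lipschitz i Xx Xy; have := c_bounded i Xx; have := lM i.
  rewrite !mxE -/D; move: (dotv _ _) (c x 0 i) (c y 0 i) (l 0 i) => G a b t.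
  move=> tM aM ab T.
  (* The penalty is expanded exactly around a = c_i(x). The multiplier t + mu a then meets the
     Taylor remainder of c_i, which gives the two [L_c] terms, and the remaining square gives mu
     M_c^2. *)
  have E : t * b - t * a + mu / 2 * (b ^+ 2 - a ^+ 2) - (t + mu * a) * G =
      (t + mu * a) * (b - a - G) + mu / 2 * (b - a) ^+ 2 by field.
  have h1 : (t + mu * a) * (b - a - G) <= (rho * Mbar_c + mu * Mbar_c) * (L_c / 2 * D ^+ 2).
    apply: (le_trans (ler_norm _)); rewrite normrM ler_pM//.
    apply: (le_trans (ler_normD _ _)); apply: lerD => //.
    by rewrite normrM gtr0_norm// ler_pM2l.
  have h2 : mu / 2 * (b - a) ^+ 2 <= mu / 2 * (M_c * D) ^+ 2.
    rewrite ler_pM2l ?divr_gt0// -real_normK ?num_real// ler_sqr ?nnegrE//.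
    exact: le_trans ab.
  rewrite E /B; move: h1 h2; rewrite exprMn; move: (D ^+ 2) (M_c ^+ 2) => D2 M2; nra.
have HS : \sum_(i < m) (l 0 i * c y 0 i - l 0 i * c x 0 i + mu / 2 * (c y 0 i ^+ 2 - c x 0 i ^+ 2)
    - (l + mu *: c x) 0 i * dotv (grad (fun z => c z 0 i) x) (y - x)) <= \sum_(i < m) B.
  by apply: ler_sum => i _; exact: Hc.
rewrite sumr_const card_ord -[leRHS]mulr_natl in HS.
rewrite /psi.
have E : \sum_(i < m) (l 0 i * c y 0 i - l 0 i * c x 0 i + mu / 2 * (c y 0 i ^+ 2 - c x 0 i ^+ 2)
    - (l + mu *: c x) 0 i * dotv (grad (fun z => c z 0 i) x) (y - x)) =
  dotv l (c y) - dotv l (c x) + mu / 2 * (pnorm 2 (c y) ^+ 2 - pnorm 2 (c x) ^+ 2) -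
  \sum_i (l + mu *: c x) 0 i * dotv (grad (fun z => c z 0 i) x) (y - x).
  rewrite -!dotv_sqrE (dotvE l (c y)) (dotvE l (c x)) (dotvE (c y)) (dotvE (c x)).
  by rewrite -!sumrB mulr_sumr -big_split/= -sumrB; apply: eq_bigr => i _; rewrite !expr2.
rewrite E in HS.
move: Hf; rewrite ler_norml => /andP[_ Hf].
move: HS Hf; rewrite /B /L_mu.
move: (\sum_i _) (dotv l (c y)) (dotv l (c x)) (pnorm 2 (c y) ^+ 2) (pnorm 2 (c x) ^+ 2).
move=> S1 S2 S3 S4 S5; move: (dotv (grad f x) (y - x)) (D ^+ 2) => G D2.
move: (f x) (f y) => fx fy H1 H2; lra.
Qed.

Definition step x g := mirror_step X h v eta x g.

Let p_gt0 : 0 < p. Proof. by apply: lt_le_trans p_ge2. Qed.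
Let q_gt0 : 0 < q. Proof. exact: lt_le_trans q_ge1. Qed.

(** The mirror step gains D^2 / eta. Out of this 1/4 pays for the curvature, as eta L_mu <= 1/2, and
    3/8 for the gradient error through Young's inequality [Y]; 3/8 is left. *)
Lemma one_step_descent l x s (x' := step x (s + grad_constr c x (l + mu *: c x))) :
  X x -> (forall i, `|l 0 i| <= rho * Mbar_c) ->
  psi l x' + hr x' <= psi l x + hr x + 2 / 3 * eta * pnorm p (s - grad f x) ^+ 2
    - 3 / 8 * eta^-1 * pnorm q (x - x') ^+ 2.
Proof.
move=> Xx lM; have Xx' : X x' by exact: (@mirror_step_in _ _ q _ _ _ D_X M_h).
have := @mirror_step_descent _ _ q _ _ v D_X M_h eta q_ge1 X_neq0 X_closed X_convex
  X_bounded h_convex h_subdifferential_neq0 h_subdifferential_bounded v_differentiable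
  v_strongly_convex eta_gt0 x (s + grad_constr c x (l + mu *: c x)) Xx.
rewrite -/(step _ _) -/x' -/(hr x') -/(hr x).
have := psi_taylor Xx Xx' lM; clearbody x'.
have := hoelder_dotv (s - grad f x) (x' - x) p_gt0 q_gt0 pq.
rewrite (pnorm_distC x' x (lt0r_neq0 q_gt0)) ler_norml => /andP[+ _].
have : pnorm 2 (x' - x) ^+ 2 <= pnorm q (x - x') ^+ 2.
  by rewrite pnorm_distC ?pnatr_eq0// ler_sqr ?nnegrE ?pnorm_ge0// pnorm_le.
have := pnorm_ge0 q (x - x'); have := sqr_ge0 (pnorm 2 (x' - x)).
move: (pnorm 2 (x' - x) ^+ 2) (pnorm q (x - x')) => D2 D.
move: (pnorm p (s - grad f x)) => e.
rewrite dotvBl (dotvDl _ (grad f x)) (dotvDl _ s).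
move: (dotv (grad f x) _) (dotv s _) (dotv (grad_constr _ _ _) _) => a b g0.
move: (psi l x') (psi l x) (hr x') (hr x) => P1 P2 h1 h2.
move=> D20 D0 DD H1 H2 H3.
have Lm : L_mu / 2 * D2 <= eta^-1 / 4 * D ^+ 2.
  have L1 : L_mu / 2 <= eta^-1 / 4.
    have : L_mu <= eta^-1 * 2^-1 by rewrite ler_pdivlMl.
    by lra.
  have E0 : 0 <= eta^-1 / 4 by rewrite divr_ge0// invr_ge0 ltW.
  by apply: (le_trans (ler_wpM2r D20 L1)); rewrite ler_wpM2l.
have Y : e * D <= 2 / 3 * eta * e ^+ 2 + 3 / 8 * eta^-1 * D ^+ 2.
  have : 0 <= eta * (2 / 3) * (e - 3 / 4 * eta^-1 * D) ^+ 2.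
    by rewrite mulr_ge0 ?sqr_ge0// mulr_ge0// ltW.
  have -> : eta * (2 / 3) * (e - 3 / 4 * eta^-1 * D) ^+ 2 =
      2 / 3 * eta * e ^+ 2 + 3 / 8 * eta^-1 * D ^+ 2 - e * D.
    by field; exact: lt0r_neq0.
  by rewrite subr_ge0.
by move: H1 H2 H3 Lm Y; move: (L_mu / 2 * D2) => ?; lra.
Qed.

(** The two mirror steps, with the estimated and with the exact gradient, differ by at most eta
    times the gradient error. *)
Lemma grad_mapping_le l x s (x' := step x (s + grad_constr c x (l + mu *: c x))) :
  pnorm q (grad_mapping X h v x (grad f x + grad_constr c x (l + mu *: c x)) eta) ^+ 2 <=
  7 / 3 * pnorm p (s - grad f x) ^+ 2 + 7 / 4 * (eta ^- 2 * pnorm q (x - x') ^+ 2).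
Proof.
rewrite /grad_mapping pnormZ ?(lt0r_neq0 q_gt0)// gtr0_norm ?invr_gt0//.
have := @mirror_step_lipschitz _ _ p q _ _ v D_X M_h eta p_gt0 q_ge1 pq X_neq0 X_closed X_convex
  X_bounded h_convex h_subdifferential_neq0 h_subdifferential_bounded v_differentiable
  v_strongly_convex eta_gt0 x (s + grad_constr c x (l + mu *: c x))
  (grad f x + grad_constr c x (l + mu *: c x)).
rewrite -/(step _ _) -/x' -/(step _ _); clearbody x'.
rewrite opprD addrACA subrr addr0.
move: (step x _) => y; have := pnormD (x - x') (x' - y) q_ge1.
have -> : x - x' + (x' - y) = x - y by rewrite addrA subrK.
have := pnorm_ge0 q (x - y); have := pnorm_ge0 q (x - x'); have := pnorm_ge0 p (s - grad f x).
move: (pnorm q (x - y)) (pnorm q (x - x')) (pnorm q (x' - y)) (pnorm p _) => A D B e.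
move=> e0 D0 A0 AB Be.
have i0 : 0 < eta^-1 by rewrite invr_gt0.
have H : eta^-1 * A <= eta^-1 * D + e.
  rewrite -[X in _ + X](mulKf (lt0r_neq0 eta_gt0)) -mulrDr ler_pM2l//.
  by apply: (le_trans AB); rewrite lerD2l.
have H2 : (eta^-1 * A) ^+ 2 <= (eta^-1 * D + e) ^+ 2.
  by rewrite ler_sqr// nnegrE; rewrite ?addr_ge0 ?mulr_ge0// ltW.
apply: (le_trans H2); rewrite -exprVn -exprMn.
(* The difference 7/3 e^2 + 7/4 w^2 - (w + e)^2 equals (4 e - 3 w)^2 / 12. *)
move: (eta^-1 * D) => w; have := sqr_ge0 (4 * e - 3 * w); nra.
Qed.

(** * Summing the descent along one realisation *)

Section trajectory.
Variables (K : nat) (x : nat -> 'rV[R]_d) (l : nat -> 'rV[R]_m) (s : nat -> 'rV[R]_d).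
Hypothesis K_gt0 : (0 < K)%N.
Hypothesis x0X : X (x 0%N).
Hypothesis l0 : l 0%N = 0.
Hypothesis xS : forall k, (k < K)%N ->
  x k.+1 = step (x k) (s k + grad_constr c (x k) (l k + mu *: c (x k))).
Hypothesis lS : forall k, (k < K)%N -> l k.+1 = l k + (rho / K%:R) *: c (x k).

Lemma trajectory_in k : (k <= K)%N -> X (x k).
Proof. by case: k => // k kK; rewrite xS//; exact: (@mirror_step_in _ _ q _ _ _ D_X M_h). Qed.

Let Kr_gt0 : 0 < K%:R :> R. Proof. by rewrite ltr0n. Qed.

Lemma multiplier_bound k i : (k <= K)%N -> `|l k 0 i| <= k%:R * (rho / K%:R * Mbar_c).
Proof.
elim: k => [_|k IH kK]; first by rewrite l0 mxE normr0 mul0r.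
rewrite lS// !mxE (le_trans (ler_normD _ _))// -natr1 mulrDl mul1r lerD//; first exact/IH/ltnW.
rewrite normrM gtr0_norm ?divr_gt0// ler_pM2l ?divr_gt0//.
by apply: c_bounded; exact/trajectory_in/ltnW.
Qed.

Lemma multiplier_bound_rho k i : (k <= K)%N -> `|l k 0 i| <= rho * Mbar_c.
Proof.
move=> kK; apply: (le_trans (multiplier_bound i kK)).
rewrite mulrA ler_pM2r// mulrCA -[leRHS]mulr1 ler_pM2l//.
by rewrite ler_pdivrMr// mul1r ler_nat.
Qed.

Lemma dotv_c_bound (a : 'rV[R]_m) y (B : R) : X y -> 0 <= B -> (forall i, `|a 0 i| <= B) ->
  `|dotv a (c y)| <= m%:R * (B * Mbar_c).
Proof.
move=> Xy B0 aB; rewrite dotvE (le_trans (ler_norm_sum _ _ _))//.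
apply: (@le_trans _ _ (\sum_(i < m) B * Mbar_c)).
  by apply: ler_sum => i _; rewrite normrM ler_pM// c_bounded.
by rewrite sumr_const card_ord mulr_natl.
Qed.

(** Updating the multiplier raises the Lagrangian by (rho / K) <c(x^k), c(x^(k+1))>, at most m rho
    Mbar_c^2 / K per iteration. *)
Lemma lyapunov_sum k : (k <= K)%N ->
  psi (l k) (x k) + hr (x k) +
    3 / 8 * eta^-1 * \sum_(i < k) pnorm q (x i - x i.+1) ^+ 2 <=
  psi (l 0%N) (x 0%N) + hr (x 0%N) + k%:R * (m%:R * (rho / K%:R * Mbar_c * Mbar_c))
    + 2 / 3 * eta * \sum_(i < k) pnorm p (s i - grad f (x i)) ^+ 2.
Proof.
elim: k => [_|k IH kK]; first by rewrite !big_ord0 !mulr0 !mul0r !addr0.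
have {IH} := IH (ltnW kK).
have Xk := trajectory_in (ltnW kK); have XSk := trajectory_in kK.
have := @one_step_descent (l k) (x k) (s k) Xk (fun i => multiplier_bound_rho i (ltnW kK)).
rewrite -xS//.
have E : psi (l k.+1) (x k.+1) =
    psi (l k) (x k.+1) + dotv ((rho / K%:R) *: c (x k)) (c (x k.+1)).
  by rewrite /psi lS// dotvDl; ring.
have := @dotv_c_bound ((rho / K%:R) *: c (x k)) (x k.+1) (rho / K%:R * Mbar_c) XSk.
rewrite mulr_ge0 ?divr_ge0 ?(ltW rho_gt0) ?(ltW Mbar_c_gt0)// => /(_ isT).
have H i : `|((rho / K%:R) *: c (x k)) 0 i| <= rho / K%:R * Mbar_c.
  by rewrite mxE normrM gtr0_norm ?divr_gt0// ler_pM2l ?divr_gt0// c_bounded.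
move=> /(_ H); rewrite ler_norml => /andP[_].
rewrite E !big_ord_recr/= -natr1.
move: (psi (l k) (x k.+1)) (psi (l k) (x k)) (psi (l 0%N) _) => P2 P3 P4.
move: (hr (x k.+1)) (hr (x k)) (hr (x 0%N)) (dotv _ _) => h1 h2 h3 G.
move: (pnorm q (x k - x k.+1) ^+ 2) (pnorm p (s k - grad f (x k)) ^+ 2) => D e.
move: (\sum_(i < k) _) (\sum_(i < k) _) => SD Se.
move: (m%:R * _) => B; nra.
Qed.

(** The term 2 m rho Mbar_c^2 has two halves: the K multiplier updates cost one, and the final
    <lambda^K, c(x^K)>, which may be negative, costs the other. The final penalty is nonnegative and
    is dropped. *)
Lemma trajectory_sum :
  3 / 8 * eta^-1 * \sum_(k < K) pnorm q (x k - x k.+1) ^+ 2 <=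
  f (x 0%N) + hr (x 0%N) + mu / 2 * pnorm 2 (c (x 0%N)) ^+ 2 - Phi_inf
    + 2 * m%:R * rho * Mbar_c ^+ 2
    + 2 / 3 * eta * \sum_(k < K) pnorm p (s k - grad f (x k)) ^+ 2.
Proof.
have := lyapunov_sum (leqnn K); have XK := trajectory_in (leqnn K).
rewrite {1 2}/psi l0 dotv0l addr0.
have hfin : h (x K) = (hr (x K))%:E by exact: (h_fin h_subdifferential_neq0 XK).
have := Phi_bounded XK; rewrite hfin -EFinD lee_fin.
have := @dotv_c_bound (l K) (x K) (rho * Mbar_c) XK (mulr_ge0 (ltW rho_gt0) (ltW Mbar_c_gt0))
  (fun i => multiplier_bound_rho i (leqnn K)).
rewrite ler_norml => /andP[H _].
have : 0 <= mu / 2 * pnorm 2 (c (x K)) ^+ 2 by rewrite mulr_ge0 ?sqr_ge0// divr_ge0// ltW.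
have -> : K%:R * (m%:R * (rho / K%:R * Mbar_c * Mbar_c)) = m%:R * rho * Mbar_c ^+ 2.
  by field; exact: lt0r_neq0.
move: H; rewrite (_ : m%:R * (rho * Mbar_c * Mbar_c) = m%:R * rho * Mbar_c ^+ 2); last by ring.
rewrite (_ : 2 * m%:R * rho * Mbar_c ^+ 2 = 2 * (m%:R * rho * Mbar_c ^+ 2)); last by ring.
move: (m%:R * rho * Mbar_c ^+ 2) (dotv (l K) (c (x K))) (f (x K)) (hr (x K)) => B G fK hK.
move: (mu / 2 * pnorm 2 (c (x K)) ^+ 2) (mu / 2 * _) => mK m0.
move: (3 / 8 * eta^-1 * _) (2 / 3 * eta * _) (f (x 0%N)) (hr (x 0%N)) => SD Se f0 h0.
lra.
Qed.

End trajectory.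

End descent.

(** * Moments of the zeroth-order estimator *)

Section gradient_estimator.
Context {R : realType} {d : nat} {dX : measure_display} {Xi : measurableType dX}.
Variables (Pxi : probability Xi R) (Pu : probability 'rV[R]_d R).
Variables (F : 'rV[R]_d -> Xi -> R) (f : 'rV[R]_d -> R).
Variables (X O : set 'rV[R]_d) (p nu L M sigma S : R).
Hypothesis p_ge2 : 2 <= p.
Hypothesis F_measurable : forall x, measurable_fun setT (F x).
Hypothesis F_integrable : forall x, Pxi.-integrable setT (fun z => (F x z)%:E).
Hypothesis F_mean : forall x, (\int[Pxi]_z (F x z)%:E = (f x)%:E)%E.
Hypothesis F_C1 : forall z, cont_diff (F^~ z).
Hypothesis f_differentiable : forall x, differentiable f x.
Hypotheses (nu_gt0 : 0 < nu) (L_gt0 : 0 < L) (M_gt0 : 0 < M) (S_ge1 : 1 <= S).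
Hypothesis O_open : open O.
Hypothesis O_region : forall x (t : R) u, X x -> 0 <= t <= 1 -> msupport Pu u ->
  O (x + (t * nu) *: u).
Hypothesis X_sub_O : X `<=` O.
Hypothesis f_smooth : forall x y, O x -> O y ->
  pnorm 2 (grad f x - grad f y) <= L * pnorm 2 (x - y).
Hypothesis f_lipschitz : forall x y, O x -> O y -> `|f x - f y| <= M * pnorm 2 (x - y).
Let gF x z := grad (F^~ z) x.
Hypothesis F_variance : forall x, O x ->
  (\int[Pxi]_z (pnorm 2 (gF x z - grad f x) ^+ 2)%:E <= (sigma ^+ 2)%:E)%E.
Hypothesis F_mean_smooth : forall x y, O x -> O y ->
  (\int[Pxi]_z (pnorm 2 (gF x z - gF y z) ^+ 2)%:E <= (L ^+ 2 * pnorm 2 (x - y) ^+ 2)%:E)%E.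
Hypothesis u_anisotropy : forall g : 'rV[R]_d,
  (\int[Pu]_u (pnorm p (dotv g u *: u) ^+ 2)%:E <= (S * pnorm 2 g ^+ 2)%:E)%E.
Hypothesis u_isotropic : forall i j, (\int[Pu]_u (u 0 i * u 0 j)%:E = ((i == j)%:R)%:E)%E.
Variable E6 : R.
Hypothesis u_moment6 : (\int[Pu]_u (pnorm 2 u ^+ 6)%:E = E6%:E)%E.

Implicit Types (x y g u : 'rV[R]_d).

Let p_gt0 : 0 < p. Proof. exact: lt_le_trans p_ge2. Qed.
Let p_neq0 : p != 0. Proof. exact: lt0r_neq0. Qed.
Let p_ge1 : 1 <= p. Proof. by apply: le_trans p_ge2; rewrite ler1n. Qed.

Let F_diff z x : differentiable (F^~ z) x. Proof. exact: (F_C1 z).1. Qed.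

Let F_cont z : continuous (F^~ z).
Proof. by move=> x; apply: differentiable_continuous; exact: F_diff. Qed.

Lemma measurable_F2 : measurable_fun setT (fun w : 'rV[R]_d * Xi => F w.1 w.2).
Proof. exact: (caratheodory_fun_measurable F_measurable F_cont). Qed.

Lemma measurable_gF2 : measurable_fun setT (fun w : 'rV[R]_d * Xi => gF w.1 w.2).
Proof. by apply: measurable_grad2 => // x z; exact: F_diff. Qed.

Lemma measurable_gF x : measurable_fun setT (gF x).
Proof. by have := measurable_fun_pair2 x measurable_gF2. Qed.

Lemma measurable_zo_grad d' (T : measurableType d') (x u : T -> 'rV[R]_d) (z : T -> Xi) :
  measurable_fun setT x -> measurable_fun setT u -> measurable_fun setT z ->
  measurable_fun setT (fun t => zo_grad F nu (x t) (u t) (z t)).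
Proof.
move=> mx mu mz; apply: measurable_rowZ => //.
apply: measurable_funM; last exact: measurable_cst.
apply: measurable_funB.
  apply: (measurableT_comp measurable_F2
    (_ : measurable_fun setT (fun t => (x t + nu *: u t, z t)))).
  apply: measurable_fun_pair => //; apply: measurable_rowD => //.
  by apply: measurable_rowZ => //; exact: measurable_cst.
by apply: (measurableT_comp measurable_F2 (_ : measurable_fun setT (fun t => (x t, z t))));
  exact: measurable_fun_pair.
Qed.

Definition taylor_rem x (w : 'rV[R]_d * Xi) : R :=
  (F (x + nu *: w.1) w.2 - F x w.2) / nu - dotv (gF x w.2) w.1.

Lemma measurable_taylor_rem x : measurable_fun setT (taylor_rem x).
Proof.
apply: measurable_funB.
  apply: measurable_funM; last exact: measurable_cst.
  apply: measurable_funB.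
    apply: (measurableT_comp measurable_F2
      (_ : measurable_fun setT (fun w : 'rV[R]_d * Xi => (x + nu *: w.1, w.2)))).
    apply: measurable_fun_pair => //; apply: measurable_rowD; first exact: measurable_cst.
    by apply: measurable_rowZ => //; exact: measurable_cst.
  exact: (measurableT_comp (F_measurable x) measurable_snd).
by apply: measurable_dotv => //; exact: (measurableT_comp (measurable_gF x) measurable_snd).
Qed.

(** [L2_remainder] along the segment from x to x + nu u, with mean-square smoothness giving the
    constant L^2 |nu u|^4. The whole segment lies in O because u is in the support. *)
Lemma taylor_rem_second_moment x u : X x -> msupport Pu u ->
  (\int[Pxi]_z (taylor_rem x (u, z) ^+ 2)%:E <= (nu ^+ 2 * L ^+ 2 / 4 * pnorm 2 u ^+ 4)%:E)%E.
Proof.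
move=> Xx su.
pose w := nu *: u.
pose phi (t : R) z := F (x + t *: w) z.
pose dphi (t : R) z := dotv (gF (x + t *: w) z) w.
have wE : pnorm 2 w = nu * pnorm 2 u by rewrite pnormZ ?pnatr_eq0// gtr0_norm.
have Ow (t : R) : 0 <= t <= 1 -> O (x + t *: w).
  by move=> t01; rewrite /w scalerA; exact: O_region.
have A1 z (t : R) : is_derive t 1 (phi^~ z) (dphi t z).
  by apply: is_derive_line; exact: F_diff.
have A2 z : continuous (dphi^~ z).
  move=> t; rewrite /dphi /gF.
  apply: (@continuous_comp _ _ _ (fun t : R => x + t *: w) (fun y => dotv (grad (F^~ z) y) w)).
    by apply: cvgD; [exact: cvg_cst|exact: cvgZr_tmp].
  apply: (@continuous_comp _ _ _ (grad (F^~ z)) (fun y => dotv y w)).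
    exact: (F_C1 z).2.
  apply: (@lipschitz_continuous_row _ _ 2 _ (pnorm 2 w)); first by rewrite ler1n.
  by move=> y y'; rewrite -dotvBl mulrC; exact: cauchy_dotv.
have A3 t : measurable_fun setT (dphi t).
  by apply: measurable_dotv; [exact: measurable_gF|exact: measurable_cst].
have A4 (t : R) : 0 <= t <= 1 ->
    (\int[Pxi]_z ((dphi t z - dphi 0 z) ^+ 2)%:E <= (L ^+ 2 * pnorm 2 w ^+ 4 * t ^+ 2)%:E)%E.
  move=> t01.
  apply: (@le_trans _ _ ((pnorm 2 w ^+ 2)%:E * \int[Pxi]_z (pnorm 2 (gF (x + t *: w) z - gF x z) ^+ 2)%:E)%E).
    apply: ge0_integral_le1 => // [||z|z|z]; rewrite ?sqr_ge0//.
      by apply: measurable_pnorm_sqr; apply: measurable_rowB; exact: measurable_gF.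
    rewrite /dphi scale0r addr0 -dotvBl -real_normK ?num_real// -exprMn.
    by rewrite ler_sqr ?nnegrE ?mulr_ge0 ?pnorm_ge0// mulrC cauchy_dotv.
  have O0 : O x by exact: X_sub_O.
  apply: (le_trans (lee_wpmul2l _ (F_mean_smooth (Ow _ t01) O0))).
    by rewrite lee_fin sqr_ge0.
  rewrite -EFinM lee_fin addrC addKr pnormZ ?pnatr_eq0// exprMn real_normK ?num_real//.
  by apply: le_of_eq; ring.
have H := L2_remainder A1 A2 A3 A4.
apply: (@le_trans _ _ ((nu ^- 2)%:E * \int[Pxi]_z ((phi 1 z - phi 0 z - dphi 0 z) ^+ 2)%:E)%E).
  apply: ge0_integral_le1 => // [||z|z|z]; rewrite ?sqr_ge0//.
  - by rewrite invr_ge0 sqr_ge0.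
  - apply: measurable_funX; apply: measurable_funB.
      by apply: measurable_funB; exact: F_measurable.
    by apply: measurable_dotv; [exact: measurable_gF|exact: measurable_cst].
  - rewrite /phi /dphi /taylor_rem/= !scale0r scale1r addr0 /w dotvZr -exprVn -exprMn.
    by apply: le_of_eq; congr (_ ^+ 2); field; exact: lt0r_neq0.
apply: (le_trans (lee_wpmul2l _ H)); first by rewrite lee_fin invr_ge0 sqr_ge0.
rewrite -EFinM lee_fin wE; apply: le_of_eq; field; exact: lt0r_neq0.
Qed.

Let mE6 n : measurable_fun setT (fun u : 'rV[R]_d => pnorm 2 u ^+ n).
Proof. by apply: measurable_funX; exact: measurable_pnorm. Qed.

Lemma E6_ge0 : 0 <= E6.
Proof.
by rewrite -lee_fin -u_moment6; apply: integral_ge0 => u _; rewrite lee_fin exprn_ge0// pnorm_ge0.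
Qed.

Lemma pnorm_scale_le (a : R) u : pnorm p (a *: u) ^+ 2 <= a ^+ 2 * pnorm 2 u ^+ 2.
Proof.
rewrite pnormZ// exprMn real_normK ?num_real// ler_wpM2l ?sqr_ge0//.
by rewrite ler_sqr ?nnegrE ?pnorm_ge0// pnorm_le.
Qed.

Let PP := (Pu \x Pxi)%E.

Lemma taylor_rem_row_moment x : X x ->
  (\int[PP]_w (pnorm p (taylor_rem x w *: w.1) ^+ 2)%:E <= (nu ^+ 2 * L ^+ 2 * E6 / 4)%:E)%E.
Proof.
move=> Xx.
have mr : measurable_fun setT (fun w : 'rV[R]_d * Xi => taylor_rem x w ^+ 2 * pnorm 2 w.1 ^+ 2).
  apply: measurable_funM; first by apply: measurable_funX; exact: measurable_taylor_rem.
  by apply: measurable_pnorm_sqr; exact: measurable_fst.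
apply: (@le_trans _ _ (\int[PP]_w (taylor_rem x w ^+ 2 * pnorm 2 w.1 ^+ 2)%:E)%E).
  apply: ge0_le_integral_any => w; rewrite lee_fin ?sqr_ge0//.
  exact: pnorm_scale_le.
rewrite fubini_tonelli1; last 2 first.
- exact/measurable_EFinP.
- by move=> w; rewrite lee_fin mulr_ge0 ?sqr_ge0.
(* The remainder bound is known for u in the support only, hence for almost every u. *)
have [N [mN N0 suppN]] := msupport_full Pu.
apply: (@le_trans _ _ (\int[Pu]_u ((nu ^+ 2 * L ^+ 2 / 4)%:E * (pnorm 2 u ^+ 6)%:E))%E).
  apply: (ae_ge0_le_integral_any mN N0).
  - by apply: measurable_funeM; exact/measurable_EFinP.
  - by move=> u; apply: integral_ge0 => z _; rewrite lee_fin mulr_ge0 ?sqr_ge0.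
  - by move=> u; rewrite mule_ge0// lee_fin ?exprn_ge0 ?pnorm_ge0// divr_ge0// mulr_ge0// sqr_ge0.
  move=> u Nu; have su : msupport Pu u by exact: suppN.
  rewrite /fubini_F/=.
  apply: (@le_trans _ _ ((pnorm 2 u ^+ 2)%:E * \int[Pxi]_z (taylor_rem x (u, z) ^+ 2)%:E)%E).
    apply: ge0_integral_le1 => // [||z|z|z]; rewrite ?sqr_ge0//.
    - apply: measurable_funX; exact: (measurable_fun_pair2 u (measurable_taylor_rem x)).
    - by rewrite mulr_ge0 ?sqr_ge0.
    - by rewrite mulrC.
  apply: (le_trans (lee_wpmul2l _ (taylor_rem_second_moment Xx su))); first by rewrite lee_fin sqr_ge0.
  by rewrite -!EFinM lee_fin; apply: le_of_eq; ring.
rewrite ge0_integralZl_EFin//.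
- by rewrite u_moment6 -EFinM lee_fin; apply: le_of_eq; ring.
- by move=> u _; rewrite lee_fin exprn_ge0// pnorm_ge0.
- exact/measurable_EFinP.
- by rewrite divr_ge0// mulr_ge0// sqr_ge0.
Qed.

(** Tonelli with the direction integrated first: for a fixed sample z, [a z] is a constant vector
    and the anisotropy bound applies. *)
Lemma dir_row_moment (a : Xi -> 'rV[R]_d) : measurable_fun setT a ->
  (\int[PP]_w (pnorm p (dotv (a w.2) w.1 *: w.1) ^+ 2)%:E <=
   S%:E * \int[Pxi]_z (pnorm 2 (a z) ^+ 2)%:E)%E.
Proof.
move=> ma.
have mr : measurable_fun setT (fun w : 'rV[R]_d * Xi => pnorm p (dotv (a w.2) w.1 *: w.1) ^+ 2).
  apply: measurable_pnorm_sqr; apply: measurable_rowZ => //.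
  by apply: measurable_dotv => //; exact: measurableT_comp.
rewrite fubini_tonelli2; last 2 first.
- exact/measurable_EFinP.
- by move=> w; rewrite lee_fin sqr_ge0.
rewrite -ge0_integralZl_EFin//.
- apply: ge0_le_integral_any => z; rewrite /fubini_G/=.
    by apply: integral_ge0 => u _; rewrite lee_fin sqr_ge0.
  by rewrite -EFinM; exact: u_anisotropy.
- by move=> z _; rewrite lee_fin sqr_ge0.
- by apply/measurable_EFinP; exact: measurable_pnorm_sqr.
- exact: le_trans S_ge1.
Qed.

Definition G x (w : 'rV[R]_d * Xi) : 'rV[R]_d := zo_grad F nu x w.1 w.2.
Definition gbar x : 'rV[R]_d := mean_row PP (G x).

Lemma G_decomp x w : G x w = dotv (gF x w.2) w.1 *: w.1 + taylor_rem x w *: w.1.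
Proof. by rewrite -scalerDl /taylor_rem subrKC. Qed.

Lemma measurable_G x : measurable_fun setT (G x).
Proof.
apply: measurable_zo_grad; [exact: measurable_cst|exact: measurable_fst|exact: measurable_snd].
Qed.

Lemma grad_f_bound x : X x -> pnorm 2 (grad f x) <= M.
Proof.
move=> Xx; apply: (@lipschitz_grad _ _ f M O) => //; [exact: ltW|exact: X_sub_O].
Qed.

Lemma gF_second_moment x : X x ->
  (\int[Pxi]_z (pnorm 2 (gF x z) ^+ 2)%:E <= (2 * sigma ^+ 2 + 2 * M ^+ 2)%:E)%E.
Proof.
move=> Xx.
apply: (@le_trans _ _ ((2 * M ^+ 2)%:E + 2%:E * \int[Pxi]_z (pnorm 2 (gF x z - grad f x) ^+ 2)%:E)%E).
  apply: ge0_integral_le_cst => // [||z|z|z]; rewrite ?sqr_ge0//.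
  - by rewrite mulr_ge0 ?sqr_ge0.
  - apply: measurable_pnorm_sqr; apply: measurable_rowB; first exact: measurable_gF.
    exact: measurable_cst.
  - rewrite -[X in pnorm 2 X](subrKC (grad f x)).
    have : pnorm 2 (grad f x) ^+ 2 <= M ^+ 2.
      by rewrite ler_sqr ?nnegrE ?pnorm_ge0 ?(ltW M_gt0)// grad_f_bound.
    have := @pnorm_sqrD_le _ _ 2 (grad f x) (gF x z - grad f x); rewrite ler1n => /(_ isT).
    gen_norms; lra.
have -> : ((2 * sigma ^+ 2 + 2 * M ^+ 2)%:E =
    (2 * M ^+ 2)%:E + 2%:E * (sigma ^+ 2)%:E :> \bar R)%E by rewrite -EFinM -EFinD addrC.
apply: leeD => //; apply: lee_wpmul2l; first by rewrite lee_fin.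
by apply: F_variance; exact: X_sub_O.
Qed.

Lemma pnorm_sqrD_weighted (e : R) x y : 0 < e ->
  pnorm p (x + y) ^+ 2 <= (1 + e) * pnorm p x ^+ 2 + (1 + e^-1) * pnorm p y ^+ 2.
Proof.
move=> e0; have := pnormD x y p_ge1; have := pnorm_ge0 p (x + y).
move: (pnorm p (x + y)) (pnorm p x) (pnorm p y) => n n1 n2 n0 H.
have H2 : n ^+ 2 <= (n1 + n2) ^+ 2 by rewrite ler_sqr ?nnegrE// (le_trans n0).
apply: (le_trans H2).
have : 0 <= e * (n1 - e^-1 * n2) ^+ 2 by rewrite mulr_ge0 ?sqr_ge0// ltW.
have -> : e * (n1 - e^-1 * n2) ^+ 2 = e * n1 ^+ 2 + e^-1 * n2 ^+ 2 - 2 * n1 * n2.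
  by field; exact: lt0r_neq0.
rewrite sqrrD; lra.
Qed.

Lemma G_second_moment x : X x ->
  (\int[PP]_w (pnorm p (G x w) ^+ 2)%:E <=
   (nu ^+ 2 * L ^+ 2 * E6 / 2 + 4 * S * (sigma ^+ 2 + M ^+ 2))%:E)%E.
Proof.
move=> Xx.
apply: (@le_trans _ _ (2%:E * \int[PP]_w (pnorm p (dotv (gF x w.2) w.1 *: w.1) ^+ 2)%:E +
   2%:E * \int[PP]_w (pnorm p (taylor_rem x w *: w.1) ^+ 2)%:E)%E).
  apply: ge0_integral_le2 => // [||w|w|w|w]; rewrite ?sqr_ge0//.
  - apply: measurable_pnorm_sqr; apply: measurable_rowZ => //.
    by apply: measurable_dotv => //; exact: (measurableT_comp (measurable_gF x) measurable_snd).
  - apply: measurable_pnorm_sqr; apply: measurable_rowZ => //; exact: measurable_taylor_rem.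
  - by rewrite G_decomp; exact: pnorm_sqrD_le.
have H1 := dir_row_moment (measurable_gF x).
have S0 : (0 <= S%:E)%E by rewrite lee_fin (le_trans _ S_ge1).
have H2 := le_trans H1 (lee_wpmul2l S0 (gF_second_moment Xx)).
have t0 : (0%E <= 2%:E :> \bar R)%E by rewrite lee_fin.
apply: (le_trans (leeD (lee_wpmul2l t0 H2) (lee_wpmul2l t0 (taylor_rem_row_moment Xx)))).
rewrite -!EFinM -EFinD lee_fin; apply: le_of_eq; by field.
Qed.

Lemma square_integrable_G x : X x -> square_integrable PP p (G x).
Proof.
by move=> Xx; split; [exact: measurable_G|exact: le_lt_trans (G_second_moment Xx) (ltry _)].
Qed.

Lemma square_integrable_dir g : square_integrable Pu 2 (fun u => dotv g u *: u).
Proof.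
split.
  by apply: measurable_rowZ => //; apply: measurable_dotv => //; exact: measurable_cst.
apply: (@le_lt_trans _ _ ((pnorm 2 g ^+ 2)%:E + (pnorm 2 g ^+ 2)%:E * \int[Pu]_u (pnorm 2 u ^+ 6)%:E)%E).
  apply: ge0_integral_le_cst => // [||u|u|u]; rewrite ?sqr_ge0 ?exprn_ge0 ?pnorm_ge0//.
  rewrite pnormZ ?pnatr_eq0// exprMn.
  have : `|dotv g u| ^+ 2 <= (pnorm 2 g * pnorm 2 u) ^+ 2.
    by rewrite ler_sqr ?nnegrE ?mulr_ge0 ?pnorm_ge0// cauchy_dotv.
  move=> /(ler_wpM2r (sqr_ge0 (pnorm 2 u))) H; apply: (le_trans H).
  have := sqr_ge0 (pnorm 2 g); have := pnorm_ge0 2 u.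
  rewrite exprMn; move: (pnorm 2 g ^+ 2) (pnorm 2 u) => a b b0 a0.
  rewrite -mulrA -exprD (_ : a + _ = a * (1 + b ^+ 6)); last by ring.
  rewrite ler_wpM2l//.
  (* This yields b^4 <= 1 + b^6, so that the sixth moment controls the fourth. *)
  have : 0 <= (b ^+ 2 - 1) ^+ 2 * (b ^+ 2 + 1) by rewrite mulr_ge0 ?sqr_ge0// addr_ge0// sqr_ge0.
  have : 0 <= b ^+ 2 by rewrite sqr_ge0.
  have -> : b ^+ 6 = (b ^+ 2) ^+ 3 by rewrite -exprM.
  have -> : b ^+ (2 + 2) = (b ^+ 2) ^+ 2 by rewrite -exprM.
  move: (b ^+ 2) => c; nra.
by rewrite u_moment6 -EFinM -EFinD ltry.
Qed.

Lemma mean_row_dir g : mean_row Pu (fun u => dotv g u *: u) = g.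
Proof.
apply/rowP => i; rewrite mxE.
have iu (j k : 'I_d) : Pu.-integrable setT (fun u => (u 0 j * u 0 k)%:E).
  have [_] := square_integrable_dir (delta_mx 0 j).
  have := integrable_coord k (ltr0n R 2) (square_integrable_dir (delta_mx 0 j)).
  move=> + _; apply: eq_integrable => // u _; rewrite !mxE dotvE (bigD1 j)//=.
  rewrite big1 ?addr0; last by move=> l lj; rewrite mxE (negbTE lj) andbF mul0r.
  by rewrite mxE !eqxx mul1r.
rewrite (eq_integral (fun u : 'rV[R]_d => \sum_(j < d) (g 0 j)%:E * (u 0 j * u 0 i)%:E)%E).
  rewrite integral_sum//; last by move=> j; exact: integrableZl.
  under eq_bigr => j _ do rewrite integralZl// u_isotropic -EFinM.
  rewrite sumEFin/= (bigD1 i)//= eqxx mulr1 big1 ?addr0// => j ji.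
  by rewrite (negbTE ji) mulr0.
move=> u _; rewrite mxE dotvE mulr_suml -sumEFin; apply: eq_bigr => j _.
by rewrite -EFinM mulrA.
Qed.

Definition mean_taylor_rem x u : R := (f (x + nu *: u) - f x) / nu - dotv (grad f x) u.

Lemma mean_taylor_rem_bound x u : X x -> msupport Pu u -> `|mean_taylor_rem x u| <= nu * L / 2 * pnorm 2 u ^+ 2.
Proof.
move=> Xx su.
have Hs (t : R) : 0 <= t <= 1 ->
    pnorm 2 (grad f (x + t *: (nu *: u)) - grad f x) <= L * (t * pnorm 2 (nu *: u)).
  move=> t01; have Ox : O x by exact: X_sub_O.
  have Ot : O (x + t *: (nu *: u)) by rewrite scalerA; exact: O_region.
  apply: (le_trans (f_smooth Ot Ox)).
  rewrite addrC addKr (pnormZ t) ?pnatr_eq0// ger0_norm//.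
  by case/andP: t01.
have := smooth_taylor (fun t _ => f_differentiable (x + t *: (nu *: u))) Hs.
rewrite dotvZr pnormZ ?pnatr_eq0// (gtr0_norm nu_gt0) => H.
have -> : mean_taylor_rem x u = nu^-1 * (f (x + nu *: u) - f x - nu * dotv (grad f x) u).
  by rewrite /mean_taylor_rem; field; exact: lt0r_neq0.
rewrite normrM gtr0_norm ?invr_gt0// ler_pdivrMl//.
by apply: (le_trans H); apply: le_of_eq; field.
Qed.

Lemma square_integrable_mean_taylor_rem x : X x ->
  square_integrable Pu 2 (fun u => mean_taylor_rem x u *: u) /\
  (\int[Pu]_u (pnorm 2 (mean_taylor_rem x u *: u) ^+ 2)%:E <= (nu ^+ 2 * L ^+ 2 * E6 / 4)%:E)%E.
Proof.
move=> Xx.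
have mf := differentiable_measurable_row f_differentiable.
have mr : measurable_fun setT (fun u => mean_taylor_rem x u *: u).
  apply: measurable_rowZ => //; apply: measurable_funB.
    apply: measurable_funM; last exact: measurable_cst.
    apply: measurable_funB; last exact: measurable_cst.
    apply: (measurableT_comp mf); apply: measurable_rowD; first exact: measurable_cst.
    by apply: measurable_rowZ => //; exact: measurable_cst.
  by apply: measurable_dotv => //; exact: measurable_cst.
suff H : (\int[Pu]_u (pnorm 2 (mean_taylor_rem x u *: u) ^+ 2)%:E <= (nu ^+ 2 * L ^+ 2 * E6 / 4)%:E)%E.
  by split => //; split => //; exact: le_lt_trans H (ltry _).
have [N [mN N0 suppN]] := msupport_full Pu.
apply: (@le_trans _ _ (\int[Pu]_u ((nu ^+ 2 * L ^+ 2 / 4)%:E * (pnorm 2 u ^+ 6)%:E))%E).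
  apply: (ae_ge0_le_integral_any mN N0).
  - by apply: measurable_funeM; exact/measurable_EFinP.
  - by move=> u; rewrite lee_fin sqr_ge0.
  - by move=> u; rewrite mule_ge0// lee_fin ?exprn_ge0 ?pnorm_ge0// divr_ge0// mulr_ge0// sqr_ge0.
  move=> u Nu; have su : msupport Pu u by exact: suppN.
  rewrite -EFinM lee_fin pnormZ ?pnatr_eq0// exprMn.
  have H : `|mean_taylor_rem x u| ^+ 2 <= (nu * L / 2 * pnorm 2 u ^+ 2) ^+ 2.
    rewrite ler_sqr ?nnegrE//; first exact: mean_taylor_rem_bound.
    by rewrite mulr_ge0 ?sqr_ge0// divr_ge0// (mulr_ge0 (ltW nu_gt0) (ltW L_gt0)).
  apply: (le_trans (ler_wpM2r (sqr_ge0 _) H)); apply: le_of_eq; by field.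
rewrite ge0_integralZl_EFin//.
- by rewrite u_moment6 -EFinM lee_fin; apply: le_of_eq; ring.
- by move=> u _; rewrite lee_fin exprn_ge0// pnorm_ge0.
- exact/measurable_EFinP.
- by rewrite divr_ge0// mulr_ge0// sqr_ge0.
Qed.

(** Integrating over the sample first replaces F by f at both evaluation points; isotropy of u then
    isolates the gradient from the Taylor remainder of f. *)
Lemma gbarE x : X x -> gbar x = grad f x + mean_row Pu (fun u => mean_taylor_rem x u *: u).
Proof.
move=> Xx; have [sf _] := square_integrable_mean_taylor_rem Xx.
rewrite -[X in X + _](mean_row_dir (grad f x)).
rewrite -(mean_rowD (ltr0n R 2) (square_integrable_dir (grad f x)) sf).
apply/rowP => i; rewrite !mxE.
have iG := integrable_coord i p_gt0 (square_integrable_G Xx).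
rewrite -(integral12_prod_meas1 iG); congr fine.
apply: eq_integral => u _; rewrite /fubini_F/=.
under eq_integral => z _.
  rewrite !mxE (_ : (_ / _ * _) = (nu^-1 * u 0 i) * (F (x + nu *: u) z - F x z)); last by ring.
  over.
under eq_integral do rewrite EFinM EFinB.
rewrite integralZl//; last exact: integrableB.
rewrite integralB// !F_mean -EFinB -EFinM -scalerDl /mean_taylor_rem subrKC !mxE.
by congr EFin; ring.
Qed.

Lemma gbar_bias x : X x -> pnorm 2 (gbar x - grad f x) ^+ 2 <= nu ^+ 2 * L ^+ 2 * E6 / 4.
Proof.
move=> Xx; have [sf H] := square_integrable_mean_taylor_rem Xx.
rewrite gbarE// addrC addKr -lee_fin; apply: le_trans H.
exact: jensen_pnorm_sqr.
Qed.

(** The origin of the noise level of the theorem: twice the second moment plus 2 |gbar x|^2, the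
    latter split into the gradient, bounded by M, and the bias. *)
Lemma G_variance x : X x ->
  (\int[PP]_w (pnorm p (G x w - gbar x) ^+ 2)%:E <=
   (2 * (nu ^+ 2 * L ^+ 2 * E6 + (4 * S * (sigma ^+ 2 + M ^+ 2) + 2 * M ^+ 2)))%:E)%E.
Proof.
move=> Xx; apply: (le_trans (centered_pnorm_sqr p_ge2 (square_integrable_G Xx))).
have t0 : (0%E <= 2%:E :> \bar R)%E by rewrite lee_fin.
apply: (le_trans (leeD (lee_wpmul2l t0 (G_second_moment Xx)) (lexx _))).
rewrite -EFinM -EFinD lee_fin -/(gbar x).
have h1 : pnorm p (gbar x) ^+ 2 <= pnorm 2 (gbar x) ^+ 2.
  by rewrite ler_sqr ?nnegrE ?pnorm_ge0// pnorm_le.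
have h2 : pnorm 2 (grad f x) ^+ 2 <= M ^+ 2.
  by rewrite ler_sqr ?nnegrE ?pnorm_ge0 ?(ltW M_gt0)// grad_f_bound.
have h3 := gbar_bias Xx.
have := @pnorm_sqrD_le _ _ 2 (grad f x) (gbar x - grad f x); rewrite ler1n subrKC => /(_ isT).
move: h1 h2 h3; gen_norms; lra.
Qed.

(** Centring costs 4; splitting the difference with weights 3/2 on the directional part and 3 on the
    remainders gives 6 = 4 x 3/2 and 12 = 4 x 3. *)
Lemma G_difference x y : X x -> X y ->
  (\int[PP]_w (pnorm p ((G x w - G y w) - (gbar x - gbar y)) ^+ 2)%:E <=
   (6 * S * L ^+ 2 * pnorm 2 (x - y) ^+ 2 + 12 * (nu ^+ 2 * L ^+ 2 * E6))%:E)%E.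
Proof.
move=> Xx Xy.
have sy : square_integrable PP p (fun w => (-1) *: G y w).
  by apply: square_integrableZ => //; exact: square_integrable_G.
have sxy := square_integrableD p_ge1 (square_integrable_G Xx) sy.
have mxy : mean_row PP (fun w => G x w + (-1) *: G y w) = gbar x - gbar y.
  rewrite (mean_rowD p_gt0 (square_integrable_G Xx) sy).
  by rewrite (mean_rowZ _ p_gt0 (square_integrable_G Xy)) scaleN1r.
have := centered_pnorm_sqr4 p_ge2 sxy; rewrite mxy.
under eq_integral do rewrite scaleN1r.
under [in X in (_ <= X)%E -> _]eq_integral do rewrite scaleN1r.
move/le_trans; apply.
pose a z := gF x z - gF y z.
have ma : measurable_fun setT a by apply: measurable_rowB; exact: measurable_gF.
pose r w := taylor_rem x w *: w.1 - taylor_rem y w *: w.1.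
have mrx z : measurable_fun setT (fun w : 'rV[R]_d * Xi => taylor_rem z w *: w.1).
  by apply: measurable_rowZ => //; exact: measurable_taylor_rem.
have mr : measurable_fun setT r by apply: measurable_rowB.
have GE w : G x w - G y w = dotv (a w.2) w.1 *: w.1 + r w.
  by rewrite !G_decomp opprD addrACA -scalerBl -dotvBl.
have H1 : (\int[PP]_w (pnorm p (r w) ^+ 2)%:E <= (nu ^+ 2 * L ^+ 2 * E6)%:E)%E.
  apply: (@le_trans _ _ (2%:E * \int[PP]_w (pnorm p (taylor_rem x w *: w.1) ^+ 2)%:E +
      2%:E * \int[PP]_w (pnorm p (taylor_rem y w *: w.1) ^+ 2)%:E)%E).
    apply: ge0_integral_le2 => // [||w|w|w|w]; rewrite ?sqr_ge0//.
    - exact: measurable_pnorm_sqr.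
    - exact: measurable_pnorm_sqr.
    - apply: (le_trans (pnorm_sqrD_le _ _ p_ge1)); rewrite (pnormN _ p_neq0).
      exact: lexx.
  have t0 : (0%E <= 2%:E :> \bar R)%E by rewrite lee_fin.
  apply: (le_trans (leeD (lee_wpmul2l t0 (taylor_rem_row_moment Xx)) (lee_wpmul2l t0 (taylor_rem_row_moment Xy)))).
  by rewrite -!EFinM -EFinD lee_fin; apply: le_of_eq; by field.
have H2 : (\int[PP]_w (pnorm p (dotv (a w.2) w.1 *: w.1) ^+ 2)%:E <=
    (S * (L ^+ 2 * pnorm 2 (x - y) ^+ 2))%:E)%E.
  apply: (le_trans (dir_row_moment ma)); rewrite EFinM lee_wpmul2l//.
    by rewrite lee_fin (le_trans _ S_ge1).
  by apply: F_mean_smooth; exact: X_sub_O.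
have H3 : (\int[PP]_w (pnorm p (G x w - G y w) ^+ 2)%:E <=
    (3 / 2)%:E * \int[PP]_w (pnorm p (dotv (a w.2) w.1 *: w.1) ^+ 2)%:E +
    3%:E * \int[PP]_w (pnorm p (r w) ^+ 2)%:E)%E.
  apply: ge0_integral_le2 => // [||w|w|w|w]; rewrite ?sqr_ge0//.
  - apply: measurable_pnorm_sqr; apply: measurable_rowZ => //.
    by apply: measurable_dotv => //; exact: (measurableT_comp ma measurable_snd).
  - exact: measurable_pnorm_sqr.
  - rewrite GE; have := @pnorm_sqrD_weighted 2^-1 (dotv (a w.2) w.1 *: w.1) (r w).
    rewrite invr_gt0 ltr0n invrK => /(_ isT).
    gen_norms; lra.
have t0 : (0%E <= (3 / 2)%:E :> \bar R)%E by rewrite lee_fin.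
have t1 : (0%E <= 3%:E :> \bar R)%E by rewrite lee_fin.
have t4 : (0%E <= 4%:E :> \bar R)%E by rewrite lee_fin.
apply: (le_trans (lee_wpmul2l t4 (le_trans H3 (leeD (lee_wpmul2l t0 H2) (lee_wpmul2l t1 H1))))).
by rewrite -!(EFinM, EFinD) lee_fin; apply: le_of_eq; by field.
Qed.

End gradient_estimator.

(** * Independence *)

Section restricted_law.
Context {R : realType} {d1 d2 : measure_display}.
Context {Omega : measurableType d1} {T : measurableType d2}.
Variables (P : probability Omega R) (Y : {mfun Omega >-> T}).
Variables (W : set Omega) (mW : measurable W).

(** The law of Y on the event W, not normalised, so that W may be null and two such laws can be
    compared as measures. *)
Definition restricted_law : set T -> \bar R := pushforward (mrestr P mW) Y.

Let restricted_law0 : restricted_law set0 = 0%E.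
Proof. exact: measure0. Qed.

Let restricted_law_ge0 A : (0 <= restricted_law A)%E.
Proof. exact: measure_ge0. Qed.

Let restricted_law_sigma_additive : semi_sigma_additive restricted_law.
Proof. exact: measure_semi_sigma_additive. Qed.

HB.instance Definition _ := isMeasure.Build _ _ _ restricted_law
  restricted_law0 restricted_law_ge0 restricted_law_sigma_additive.

End restricted_law.

Definition mfun_of {d1 d2} {T1 : measurableType d1} {T2 : measurableType d2}
    (f : T1 -> T2) (mf : measurable_fun setT f) : {mfun T1 >-> T2} :=
  HB.pack f (isMeasurableFun.Build _ _ _ _ f mf).

Section joint_law.
Context {R : realType} {dO d1 d2 : measure_display}.
Context {Omega : measurableType dO} {T1 : measurableType d1} {T2 : measurableType d2}.
Variables (P : probability Omega R) (Y : {mfun Omega >-> T1}) (Z : {mfun Omega >-> T2}).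

Lemma measurable_mfun_pair : measurable_fun setT (fun w => (Y w, Z w)).
Proof. exact: measurable_fun_pair. Qed.

(** Rectangles form a generating family stable under intersection, on which the two finite measures
    agree. In the application W is an intersection of independent events and c its probability. *)
Lemma joint_law (W : set Omega) (c : {nonneg R}) (E : set (T1 * T2)) :
  measurable W ->
  (forall B C, measurable B -> measurable C ->
    P (Y @^-1` B `&` Z @^-1` C `&` W) = c%:num%:E * (P (Y @^-1` B) * P (Z @^-1` C)))%E ->
  measurable E ->
  P ((fun w => (Y w, Z w)) @^-1` E `&` W) =
  (c%:num%:E * (distribution P Y \x distribution P Z) E)%E.
Proof.
move=> mW PE mE.
pose YZ := mfun_of measurable_mfun_pair.
pose m1 : {measure set (T1 * T2)%type -> \bar R} := restricted_law P YZ mW.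
pose m2 : {measure set (T1 * T2)%type -> \bar R} :=
  mscale c (distribution P Y \x distribution P Z)%E.
pose C : set (set (T1 * T2)) :=
  [set C | exists A, measurable A /\ exists B, measurable B /\ C = A `*` B].
suff : m1 E = m2 E by [].
apply: (measure_unique C (fun=> setT)) => //.
- rewrite measurable_prod_measurableType //; congr (<<s _ >>).
  rewrite predeqE; split => [[A mA [B mB <-]]|[A [mA [B [mB ->]]]]].
    by exists A; split => //; exists B.
  by exists A => //; exists B.
- move=> /= _ _ [X1 [mX1 [X2 [mX2 ->]]]] [Y1 [mY1 [Y2 [mY2 ->]]]].
  rewrite -setXI; exists (X1 `&` Y1); split; first exact: measurableI.
  by exists (X2 `&` Y2); split => //; exact: measurableI.
- by move=> n; exists setT; split => //; exists setT; split => //; rewrite setXTT.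
- by rewrite bigcup_const//; exists 0%N.
- move=> A [A1 [mA1 [A2 [mA2 ->]]]].
  transitivity (c%:num%:E * (distribution P Y \x distribution P Z) (A1 `*` A2))%E => //.
  by rewrite product_measure1E// -PE.
- move=> _; rewrite /m1/= /restricted_law /pushforward /mrestr/=.
  apply: le_lt_trans (ltry 1); apply: probability_le1; apply: measurableI => //.
  by rewrite preimage_setT.
Qed.

End joint_law.

Section independence.
Context {R : realType} {dO : measure_display} {Omega : measurableType dO}.
Variables (P : probability Omega R) (I : choiceType) (G : I -> set (set Omega)).
Hypothesis G_measurable : forall i A, G i A -> measurable A.

(** Independence of Y from the sources in D, together with the mutual independence of the latter,
    phrased on finitely many events so that generated sigma-algebras need not be formed. *)
Definition indep_from {d1} {T : measurableType d1} (D : set I) (Y : Omega -> T) : Prop :=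
  measurable_fun setT Y /\
  forall (B : set T) (J : {fset I}) (A : I -> set Omega), measurable B ->
    [set` J] `<=` D -> (forall i, i \in J -> G i (A i)) ->
    P (Y @^-1` B `&` \bigcap_(i in [set` J]) A i) =
    (P (Y @^-1` B) * (\prod_(i <- J) fine (P (A i)))%:E)%E.

Lemma indep_from_cst {d1} {T : measurableType d1} (D : set I) (y : T) :
  mutually_independent P D G -> indep_from D (fun=> y).
Proof.
move=> ind; split => [|B J A mB JD GA]; first exact: measurable_cst.
rewrite preimage_cst; case: ifPn => _.
  by rewrite setTI probability_setT mul1e; exact: ind.
by rewrite set0I measure0 mul0e.
Qed.

Lemma indep_from_sub {d1} {T : measurableType d1} (D D' : set I) (Y : Omega -> T) :
  D' `<=` D -> indep_from D Y -> indep_from D' Y.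
Proof.
move=> D'D [mY ind]; split => // B J A mB JD; apply: ind => //.
exact: subset_trans D'D.
Qed.

Lemma indep_from_comp {d1 d2} {T1 : measurableType d1} {T2 : measurableType d2}
    (D : set I) (Y : Omega -> T1) (g : T1 -> T2) :
  measurable_fun setT g -> indep_from D Y -> indep_from D (g \o Y).
Proof.
move=> mg [mY ind]; split => [|B J A mB JD GA]; first exact: measurableT_comp.
rewrite comp_preimage; apply: ind => //.
by rewrite -[X in measurable X]setTI; exact: mg.
Qed.

Lemma indep_from_pair {d1 d2} {T1 : measurableType d1} {T2 : measurableType d2}
    (D : set I) (i0 : I) (Y : Omega -> T1) (Z : Omega -> T2) :
  indep_from D Y -> D i0 -> measurable_fun setT Z ->
  G i0 = preimage_set_system setT Z measurable ->
  indep_from (D `\ i0) (fun w => (Y w, Z w)) /\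
  (forall (mY : measurable_fun setT Y) (mZ : measurable_fun setT Z) E, measurable E ->
    P ((fun w => (Y w, Z w)) @^-1` E) =
    (distribution P (mfun_of mY) \x distribution P (mfun_of mZ))%E E).
Proof.
move=> [mY ind] Di0 mZ GZ.
have rect (J : {fset I}) (A : I -> set Omega) B C : measurable B -> measurable C ->
    [set` J] `<=` D `\ i0 -> (forall i, i \in J -> G i (A i)) ->
    (P (Y @^-1` B `&` Z @^-1` C `&` \bigcap_(i in [set` J]) A i) =
    (\prod_(i <- J) fine (P (A i)))%:E * (P (Y @^-1` B) * P (Z @^-1` C)))%E.
  move=> mB mC JD GA.
  have i0J : i0 \notin J by apply/negP => /JD[_]; exact.
  (* The event of Z is inserted at the index i0, which is absent from J. *)
  pose A' i := if i == i0 then Z @^-1` C else A i.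
  have GA' i : i \in (i0 |` J)%fset -> G i (A' i).
    rewrite in_fset1U /A'; case: eqP => [-> _|_ /= /GA//].
    by rewrite GZ; exists C => //; rewrite setTI.
  have JD' : [set` (i0 |` J)%fset] `<=` D.
    by move=> i /=; rewrite in_fset1U => /orP[/eqP->//|/JD[]].
  have := ind B _ A' mB JD' GA'.
  have -> : \bigcap_(i in [set` (i0 |` J)%fset]) A' i = Z @^-1` C `&` \bigcap_(i in [set` J]) A i.
    apply/seteqP; split=> [w Aw|w [Zw Aw] i /=].
      split; first by have := Aw i0; rewrite /A' eqxx; apply; rewrite /= fset1U1.
      move=> i /= iJ; have := Aw i; rewrite /A' /= in_fset1U iJ orbT => /(_ isT).
      by case: eqP => // ii0; rewrite ii0 (negbTE i0J) in iJ.
    by rewrite in_fset1U /A'; case: eqP => //= _ iJ; exact: Aw.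
  rewrite setIA => ->.
  rewrite big_fsetU1//= {1}/A' eqxx.
  rewrite (eq_big_seq (fun i => fine (P (A i)))); last first.
    by move=> i iJ; rewrite /A'; case: eqP => // ii0; rewrite ii0 (negbTE i0J) in iJ.
  rewrite EFinM fineK; last first.
    by apply: fin_num_measure; rewrite -[X in measurable X]setTI; exact: mZ.
  by rewrite muleA muleC.
have mGA (J : {fset I}) (A : I -> set Omega) : (forall i, i \in J -> G i (A i)) ->
    measurable (\bigcap_(i in [set` J]) A i).
  move=> GA; apply: fin_bigcap_measurable; first exact: finite_fset.
  by move=> i /= /GA; exact: G_measurable.
have c0 (J : {fset I}) (A : I -> set Omega) : 0 <= \prod_(i <- J) fine (P (A i)).
  by apply: prodr_ge0 => i _; rewrite fine_ge0.
have law (mY' : measurable_fun setT Y) (mZ' : measurable_fun setT Z) E : measurable E -> P ((fun w => (Y w, Z w)) @^-1` E) =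
    (distribution P (mfun_of mY') \x distribution P (mfun_of mZ'))%E E.
  move=> mE; have PR B C : measurable B -> measurable C ->
      P (mfun_of mY' @^-1` B `&` mfun_of mZ' @^-1` C `&` setT) =
      ((1%:nng : {nonneg R})%:num%:E * (P (mfun_of mY' @^-1` B) * P (mfun_of mZ' @^-1` C)))%E.
    move=> mB mC; rewrite mul1e.
    have := rect fset0 (fun=> set0) B C mB mC.
    rewrite big_seq_fset0 mul1e => <- //.
    have -> : [set` fset0] = set0 :> set I by apply/seteqP; split.
    by rewrite bigcap_set0.
  by have := joint_law measurableT PR mE; rewrite mul1e setIT.
split => //; split; first exact: measurable_fun_pair.
move=> E J A mE JD GA.
have := @joint_law _ _ _ _ _ _ _ P (mfun_of mY) (mfun_of mZ) _ (NngNum (c0 J A)) E (mGA J A GA).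
move=> /(_ _ mE) ->; last by move=> B C mB mC; exact: rect.
by rewrite /= (law mY mZ)// muleC.
Qed.

End independence.

Section expectation_split.
Context {R : realType} {dO d1 d2 : measure_display}.
Context {Omega : measurableType dO} {T1 : measurableType d1} {T2 : measurableType d2}.
Variables (P : probability Omega R) (Y : Omega -> T1) (Z : Omega -> T2) (Q : probability T2 R).

Lemma integral_product_law (mY : measurable_fun setT Y) (mZ : measurable_fun setT Z)
    (phi : T1 * T2 -> \bar R) :
  (forall E, measurable E -> P ((fun w => (Y w, Z w)) @^-1` E) =
    (distribution P (mfun_of mY) \x distribution P (mfun_of mZ))%E E) ->
  (forall A, measurable A -> P (Z @^-1` A) = Q A) ->
  measurable_fun setT phi -> (forall w, 0 <= phi w)%E ->
  (\int[P]_w phi (Y w, Z w) = \int[P]_w \int[Q]_z phi (Y w, z))%E.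
Proof.
move=> law lawZ mphi phi0.
have mYZ : measurable_fun setT (fun w => (Y w, Z w)) by exact: measurable_fun_pair.
transitivity (\int[distribution P (mfun_of mYZ)]_y phi y)%E.
  by rewrite ge0_integral_pushforward//= preimage_setT.
transitivity (\int[(distribution P (mfun_of mY) \x distribution P (mfun_of mZ))%E]_y phi y)%E.
  by apply: eq_measure_integral => E mE _; exact: law.
rewrite fubini_tonelli1// /fubini_F.
transitivity (\int[distribution P (mfun_of mY)]_y \int[Q]_z phi (y, z))%E.
  apply: eq_integral => y _; apply: eq_measure_integral => A mA _; exact: lawZ.
rewrite ge0_integral_pushforward//= ?preimage_setT//.
- exact: (measurable_fun_fubini_tonelli_F phi).
- by move=> y _; apply: integral_ge0.
Qed.

End expectation_split.

(** * Averaging a batch of fresh samples *)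

Section fresh_sample.
Context {R : realType} {dO : measure_display} {Omega : measurableType dO}.
Variables (P : probability Omega R) (I : choiceType) (G : I -> set (set Omega)).
Hypothesis G_measurable : forall i A, G i A -> measurable A.

(* Drawing W uses up the sources in D but not in D'. *)
Definition fresh_sample {dS} {S : measurableType dS} (D D' : set I) (Q : probability S R)
    (W : Omega -> S) : Prop :=
  forall d1 (T : measurableType d1) (Y : Omega -> T), indep_from P G D Y ->
    indep_from P G D' (fun w => (Y w, W w)) /\
    forall phi : T * S -> \bar R, measurable_fun setT phi -> (forall t, 0 <= phi t)%E ->
      (\int[P]_w phi (Y w, W w) = \int[P]_w \int[Q]_t phi (Y w, t))%E.

Lemma fresh_sample1 {dS} {S : measurableType dS} (D : set I) (i : I)
    (Q : probability S R) (W : Omega -> S) :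
  D i -> measurable_fun setT W -> G i = preimage_set_system setT W measurable ->
  (forall A, measurable A -> P (W @^-1` A) = Q A) -> fresh_sample D (D `\ i) Q W.
Proof.
move=> Di mW GW lawW d1 T Y iY; have [iYW law] := indep_from_pair G_measurable iY Di mW GW.
split=> // phi mphi phi0.
exact: (@integral_product_law _ _ _ _ _ _ _ P Y W Q iY.1 mW phi (law iY.1 mW)).
Qed.

(** The second sample is integrated out with the first one counted as part of the state, then the
    first; Tonelli reassembles the product law. *)
Lemma fresh_sample_pair {d1 d2} {S1 : measurableType d1} {S2 : measurableType d2}
    (D1 D2 D3 : set I) (Q1 : probability S1 R) (Q2 : probability S2 R)
    (W1 : Omega -> S1) (W2 : Omega -> S2) :
  fresh_sample D1 D2 Q1 W1 -> fresh_sample D2 D3 Q2 W2 ->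
  fresh_sample D1 D3 (Q1 \x Q2)%E (fun w => (W1 w, W2 w)).
Proof.
move=> f1 f2 d0 T Y iY; have [i1 E1] := f1 _ _ _ iY; have [i2 E2] := f2 _ _ _ i1.
have massoc : measurable_fun setT (fun t : (T * S1) * S2 => (t.1.1, (t.1.2, t.2))).
  apply: measurable_fun_pair; first exact: measurableT_comp measurable_fst _.
  apply: measurable_fun_pair => //; exact: measurableT_comp measurable_snd _.
split; first exact: (indep_from_comp massoc i2).
move=> phi mphi phi0.
pose psi (t : (T * S1) * S2) := phi (t.1.1, (t.1.2, t.2)).
have mpsi : measurable_fun setT psi by exact: (measurableT_comp mphi massoc).
have psi0 t : (0 <= psi t)%E by exact: phi0.
have := E2 psi mpsi psi0; rewrite /psi/= => ->.
have := E1 (fun t => \int[Q2]_z psi (t, z))%E; rewrite /psi/= => ->.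
- apply: eq_integral => w _; rewrite fubini_tonelli1//.
  by apply: measurable_fun_pair2; exact: mphi.
- exact: (measurable_fun_fubini_tonelli_F psi).
- by move=> t; apply: integral_ge0.
Qed.

Lemma fresh_sample_sub {dS} {S : measurableType dS} (D D' D'' : set I)
    (Q : probability S R) (W : Omega -> S) :
  D'' `<=` D' -> fresh_sample D D' Q W -> fresh_sample D D'' Q W.
Proof.
move=> DD f d1 T Y /f[iYW E]; split=> //; exact: indep_from_sub iYW.
Qed.

End fresh_sample.

Section batch_average.
Context {R : realType} {dO dT dS : measure_display} {Omega : measurableType dO}.
Context {T : measurableType dT} {S : measurableType dS} {d : nat}.
Variables (P : probability Omega R) (I : choiceType) (G : I -> set (set Omega)).
Variables (Q : probability S R) (D : nat -> set I) (W : nat -> Omega -> S) (N : nat).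
Hypothesis W_fresh : forall j, (j < N)%N -> fresh_sample P G (D j) (D j.+1) Q (W j).
Variables (p : R) (Y : Omega -> T) (a mm : T -> 'rV[R]_d) (inc : T -> S -> 'rV[R]_d).
Variable b : T -> R.
Hypothesis p_ge2 : 2 <= p.
Hypothesis Y_indep : indep_from P G (D 0%N) Y.
Hypothesis a_measurable : measurable_fun setT a.
Hypothesis mm_measurable : measurable_fun setT mm.
Hypothesis inc_measurable : measurable_fun setT (fun t : T * S => inc t.1 t.2).
Hypothesis inc_square : forall w, square_integrable Q p (inc (Y w)).
Hypothesis inc_mean : forall w, mean_row Q (inc (Y w)) = mm (Y w).
Hypothesis b_measurable : measurable_fun setT b.
Hypothesis b_ge0 : forall y, 0 <= b y.
Hypothesis inc_variance : forall w,
  (\int[Q]_t (pnorm p (inc (Y w) t - mm (Y w)) ^+ 2)%:E <= (b (Y w))%:E)%E.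

(** Only j samples are drawn, yet the normalisation is that of the full batch: these are the partial
    sums of a martingale, conditionally on Y. *)
Definition batch_sum j w : 'rV[R]_d :=
  a (Y w) + N%:R^-1 *: \sum_(i < j) (inc (Y w) (W i w) - mm (Y w)).

Let p_gt0 : 0 < p. Proof. exact: lt_le_trans p_ge2. Qed.
Let p_ge1 : 1 <= p. Proof. by apply: le_trans p_ge2; rewrite ler1n. Qed.

Lemma batch_sum_indep j : (j <= N)%N -> indep_from P G (D j) (fun w => (Y w, batch_sum j w)).
Proof.
elim: j => [_|j IH jN].
  have m0 : measurable_fun setT (fun y => (y, a y)) by exact: measurable_fun_pair.
  have -> : (fun w => (Y w, batch_sum 0 w)) = (fun y => (y, a y)) \o Y.
    by apply/funext => w; rewrite /batch_sum/= big_ord0 scaler0 addr0.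
  exact: indep_from_comp m0 Y_indep.
have [i1 _] := W_fresh jN (IH (ltnW jN)).
have m1 : measurable_fun setT (fun t : (T * 'rV[R]_d) * S =>
    (t.1.1, t.1.2 + N%:R^-1 *: (inc t.1.1 t.2 - mm t.1.1))).
  have mf : measurable_fun setT (fun t : (T * 'rV[R]_d) * S => t.1.1).
    exact: measurableT_comp measurable_fst _.
  apply: measurable_fun_pair => //; apply: measurable_rowD.
    exact: measurableT_comp measurable_snd _.
  apply: measurable_rowZ; first exact: measurable_cst.
  apply: measurable_rowB; last exact: measurableT_comp mm_measurable _.
  apply: (measurableT_comp inc_measurable
    (_ : measurable_fun setT (fun t : (T * 'rV[R]_d) * S => (t.1.1, t.2)))).
  exact: measurable_fun_pair.
have := indep_from_comp m1 i1; rewrite (_ : _ \o _ = fun w => (Y w, batch_sum j.+1 w))//.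
by apply/funext => w; rewrite /batch_sum/= big_ord_recr/= [in RHS]scalerDr [in RHS]addrA.
Qed.

(** Sample j is fresh with respect to Y and the partial sum, so [pnorm_sqrD_mean0] adds (p - 1) b /
    N^2 and leaves the previous square with coefficient 1. *)
Lemma batch_sum_bound j : (j <= N)%N ->
  (\int[P]_w (pnorm p (batch_sum j w) ^+ 2)%:E <=
   \int[P]_w (pnorm p (a (Y w)) ^+ 2)%:E +
   (j%:R * (N%:R^-1 ^+ 2 * (p - 1)))%:E * \int[P]_w (b (Y w))%:E)%E.
Proof.
have mY := Y_indep.1.
have mbY : measurable_fun setT (fun w => b (Y w)) by exact: measurableT_comp.
elim: j => [_|j IH jN].
  rewrite mul0r mul0e adde0 le_eqVlt; apply/orP; left; apply/eqP.
  by apply: eq_integral => w _; rewrite /batch_sum big_ord0 scaler0 addr0.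
have iS := batch_sum_indep (ltnW jN).
have [_ E] := W_fresh jN iS.
pose phi (t : (T * 'rV[R]_d) * S) :=
  (pnorm p (t.1.2 + N%:R^-1 *: (inc t.1.1 t.2 - mm t.1.1)) ^+ 2)%:E.
have mphi : measurable_fun setT phi.
  apply/measurable_EFinP; apply: measurable_pnorm_sqr.
  have mf : measurable_fun setT (fun t : (T * 'rV[R]_d) * S => t.1.1).
    exact: measurableT_comp measurable_fst _.
  apply: measurable_rowD; first exact: measurableT_comp measurable_snd _.
  apply: measurable_rowZ; first exact: measurable_cst.
  apply: measurable_rowB; last exact: measurableT_comp mm_measurable _.
  apply: (measurableT_comp inc_measurable
    (_ : measurable_fun setT (fun t : (T * 'rV[R]_d) * S => (t.1.1, t.2)))).
  exact: measurable_fun_pair.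
have phi0 t : (0 <= phi t)%E by rewrite lee_fin sqr_ge0.
have -> : (\int[P]_w (pnorm p (batch_sum j.+1 w) ^+ 2)%:E =
    \int[P]_w phi ((Y w, batch_sum j w), W j w))%E.
  by apply: eq_integral => w _; rewrite /phi /batch_sum/= big_ord_recr/= scalerDr addrA.
rewrite (E phi mphi phi0).
have C0 : 0 <= N%:R^-1 ^+ 2 * (p - 1) :> R by rewrite mulr_ge0 ?sqr_ge0// subr_ge0.
apply: (@le_trans _ _ (\int[P]_w ((pnorm p (batch_sum j w) ^+ 2)%:E +
    (N%:R^-1 ^+ 2 * (p - 1))%:E * (b (Y w))%:E))%E).
  apply: ge0_le_integral_any => w; first by apply: integral_ge0.
  have [sc mc] := mean_row_center p_gt0 p_ge1 (inc_square w).
  rewrite inc_mean in sc mc.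
  have sZ := square_integrableZ N%:R^-1 (lt0r_neq0 p_gt0) sc.
  have mZ : mean_row Q (fun t => N%:R^-1 *: (inc (Y w) t - mm (Y w))) = 0.
    by rewrite (mean_rowZ _ p_gt0 sc) mc scaler0.
  apply: (le_trans (pnorm_sqrD_mean0 (batch_sum j w) p_ge2 sZ mZ)).
  rewrite leeD2l// mulrC EFinM -muleA.
  apply: lee_wpmul2l; first by rewrite lee_fin subr_ge0.
  apply: (@le_trans _ _ ((N%:R^-1 ^+ 2)%:E *
      \int[Q]_t (pnorm p (inc (Y w) t - mm (Y w)) ^+ 2)%:E)%E).
    apply: ge0_integral_le1 => // [|t|t|t]; rewrite ?sqr_ge0//.
      by apply: measurable_pnorm_sqr; exact: sc.1.
    by rewrite pnormZ ?(lt0r_neq0 p_gt0)// exprMn real_normK ?num_real.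
  by apply: lee_wpmul2l; rewrite ?lee_fin ?sqr_ge0.
have mS : measurable_fun setT (fun w => batch_sum j w).
  by apply: (measurableT_comp measurable_snd iS.1).
rewrite ge0_integralD//; last first.
- apply: emeasurable_funM; first exact: measurable_cst.
  exact/measurable_EFinP.
- by move=> w _; rewrite -EFinM lee_fin mulr_ge0.
- by apply/measurable_EFinP; exact: measurable_pnorm_sqr.
- by move=> w _; rewrite lee_fin sqr_ge0.
rewrite ge0_integralZl_EFin//; last first.
- exact/measurable_EFinP.
- by move=> w _; rewrite lee_fin.
apply: (le_trans (leeD (IH (ltnW jN)) (lexx _))).
have p10 : 0 <= p - 1 by rewrite subr_ge0.
rewrite -addeA -ge0_muleDl ?lee_fin ?mulr_ge0//.
by rewrite -EFinD -[X in (_ + X)%:E]mul1r -mulrDl natr1.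
Qed.

Lemma batch_average_bound : (0 < N)%N ->
  (\int[P]_w (pnorm p (batch_sum N w) ^+ 2)%:E <=
   \int[P]_w (pnorm p (a (Y w)) ^+ 2)%:E +
   ((p - 1) / N%:R)%:E * \int[P]_w (b (Y w))%:E)%E.
Proof.
move=> N0; have := batch_sum_bound (leqnn N).
by rewrite mulrA expr2 mulrA divff ?pnatr_eq0 -?lt0n// mul1r mulrC.
Qed.

Lemma batch_sumE w : (0 < N)%N ->
  batch_sum N w = a (Y w) - mm (Y w) + N%:R^-1 *: \sum_(i < N) inc (Y w) (W i w).
Proof.
move=> N0; rewrite /batch_sum sumrB sumr_const card_ord scalerBr -[mm _ *+ N]scaler_nat scalerA.
by rewrite mulVf ?pnatr_eq0 -?lt0n// scale1r [in RHS]addrAC -addrA.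
Qed.

End batch_average.

(** * Solving the recursion *)

Ltac nonneg := repeat first [ done | exact: sqr_ge0 | exact: ler0n | (apply: ltW; done)
  | rewrite invr_ge0 | apply: addr_ge0 | apply: mulr_ge0 ].

Section complexity_arithmetic.
Context {R : realType}.
Variables (p alpha eta L S M Sg Delta n n0 : R) (K : nat) (a b e : nat -> R).
Hypotheses (p_ge2 : 2 <= p) (alpha_gt0 : 0 < alpha) (alpha_le1 : alpha <= 1).
Hypotheses (eta_gt0 : 0 < eta) (L_gt0 : 0 < L) (S_ge1 : 1 <= S) (M_ge0 : 0 <= M).
Hypotheses (Sg_ge0 : 0 <= Sg) (Delta_ge0 : 0 <= Delta) (n_gt0 : 0 < n) (n0_gt0 : 0 < n0).
Hypothesis K_gt0 : (0 < K)%N.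
Hypothesis n_large : 96 * (p - 1) * S * eta ^+ 2 * L ^+ 2 / alpha <= n.
Hypotheses (a_ge0 : forall k, 0 <= a k) (b_ge0 : forall k, 0 <= b k).
Hypothesis a0_le : a 0%N <= (p - 1) / n0 * (2 * Sg).
Hypothesis aS_le : forall k, (k.+1 < K)%N -> a k.+1 <= (1 - alpha) ^+ 2 * a k +
  (p - 1) / n * (2 * alpha ^+ 2 * (2 * Sg) +
    2 * (1 - alpha) ^+ 2 * (6 * S * L ^+ 2 * b k + 12 * (L ^+ 2 * M))).
Hypothesis e_le : forall k, (k < K)%N -> e k <= 2 * a k + L ^+ 2 * M / 2.
Hypothesis descent_sum : 3 / 8 * eta^-1 * \sum_(k < K) b k <=
  Delta + 2 / 3 * eta * \sum_(k < K) e k.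

Let p1_ge0 : 0 <= p - 1.
Proof. by rewrite subr_ge0 (le_trans _ p_ge2)// ler1n. Qed.

Let y := eta ^- 2.
Let A := \sum_(k < K) a k.
Let B := \sum_(k < K) b k.
Let r := (p - 1) / n.
Let Kr : R := K%:R.
Let Q := (p - 1) / n0 * (2 * Sg) / alpha + 2 * alpha * Kr * r * (2 * Sg).

Let sum_a_recursion : A <= a 0%N + (1 - alpha) ^+ 2 * A +
  Kr * (r * (2 * alpha ^+ 2 * (2 * Sg) + 2 * (1 - alpha) ^+ 2 * (12 * (L ^+ 2 * M)))) +
  r * (12 * (1 - alpha) ^+ 2 * S * L ^+ 2) * B.
Proof.
rewrite /Kr /A /B; move: K_gt0 aS_le; case: (K) => // k _ H.
rewrite {1}big_ord_recl/= -!addrA lerD2l.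
have r0 : 0 <= r by rewrite /r divr_ge0 ?p1_ge0 ?(ltW n_gt0).
have c0 : 0 <= r * (2 * alpha ^+ 2 * (2 * Sg) + 2 * (1 - alpha) ^+ 2 * (12 * (L ^+ 2 * M))).
  by nonneg.
have d0 : 0 <= r * (12 * (1 - alpha) ^+ 2 * S * L ^+ 2).
  by have S0 : 0 <= S := le_trans ler01 S_ge1; nonneg.
apply: (@le_trans _ _ (\sum_(i < k) ((1 - alpha) ^+ 2 * a i +
   (r * (2 * alpha ^+ 2 * (2 * Sg) + 2 * (1 - alpha) ^+ 2 * (12 * (L ^+ 2 * M))) +
   r * (12 * (1 - alpha) ^+ 2 * S * L ^+ 2) * b i)))).
  apply: ler_sum => i _; apply: (le_trans (H i _)); first by rewrite ltnS.
  by apply: le_of_eq; rewrite /r; ring.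
rewrite !big_split/= -!mulr_sumr sumr_const card_ord.
have le_ord (z : nat -> R) : (forall k, 0 <= z k) -> \sum_(i < k) z i <= \sum_(i < k.+1) z i.
  by move=> z0; rewrite big_ord_recr/= lerDl.
apply: lerD; first by rewrite ler_wpM2l ?sqr_ge0// le_ord.
apply: lerD; last by rewrite ler_wpM2l// le_ord.
by rewrite mulrnAr -[leLHS]mulr_natl ler_wpM2r// ler_nat.
Qed.

(** The lower bound on n, solved for the coefficient of B. As 96 is 12 times 8 and the recursion
    carries a factor 12, B will reach A only with weight y / 16. *)
Let rSL : r * S * L ^+ 2 <= alpha * y / 96.
Proof.
have e2 : 0 < eta ^+ 2 by rewrite exprn_gt0.
rewrite /r /y; move: n_large; rewrite ler_pdivrMr// => H.
have -> : (p - 1) / n * S * L ^+ 2 = (p - 1) * S * L ^+ 2 / n by ring.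
rewrite ler_pdivrMr//.
have -> : alpha / eta ^+ 2 / 96 * n = (n * alpha / 96) / eta ^+ 2.
  by move: (eta ^+ 2)^-1 => z; ring.
rewrite ler_pdivlMr//; lra.
Qed.

(* Summing the recursion gives alpha (2 - alpha) A <= ...; then use              *)
(* 2 (1 - alpha)^2 <= 2 - alpha and, for B, the lower bound on n through rSL.    *)
Let A_le : A <= Q + Kr * M * y / 8 + B * y / 16.
Proof.
have r0 : 0 <= r by rewrite /r divr_ge0 ?p1_ge0 ?(ltW n_gt0).
have B0 : 0 <= B by exact: sumr_ge0.
have K0 : 0 <= Kr by exact: ler0n.
have y0 : 0 <= y by rewrite invr_ge0 sqr_ge0.
have s0 : 0 <= (1 - alpha) ^+ 2 by exact: sqr_ge0.
have rL : r * L ^+ 2 <= alpha * y / 96.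
  apply: le_trans rSL; rewrite ler_wpM2r ?sqr_ge0//; exact: ler_peMr.
have Q0 : 0 <= Q.
  by rewrite /Q /r; nonneg.
have a1 : 1 <= 2 - alpha by move: (alpha) alpha_le1 => z z1; lra.
set U := A - Kr * M * y / 8 - B * y / 16.
suff : U <= Q by rewrite /U; lra.
suff H : (2 - alpha) * U <= Q.
  have [U0|U0] := leP U 0; first exact: le_trans U0 Q0.
  by apply: le_trans H; rewrite ler_peMl ?(ltW U0).
rewrite -(ler_pM2l alpha_gt0).
have QE : alpha * Q = (p - 1) / n0 * (2 * Sg) + 2 * alpha ^+ 2 * Kr * r * (2 * Sg).
  by rewrite /Q mulrDr mulrCA divff ?lt0r_neq0// mulr1; ring.
have h1 : (1 - alpha) ^+ 2 * (24 * Kr * M) * (r * L ^+ 2) <=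
    (1 - alpha) ^+ 2 * (24 * Kr * M) * (alpha * y / 96).
  by rewrite ler_wpM2l//; nonneg.
have h2 : (1 - alpha) ^+ 2 * (12 * B) * (r * S * L ^+ 2) <=
    (1 - alpha) ^+ 2 * (12 * B) * (alpha * y / 96).
  by rewrite ler_wpM2l//; nonneg.
have h3 : (1 - alpha) ^+ 2 * (alpha * (Kr * M * y / 4 + B * y / 8)) <=
    (2 - alpha) / 2 * (alpha * (Kr * M * y / 4 + B * y / 8)).
  rewrite ler_wpM2r//; last first.
    by move: (alpha) alpha_gt0 alpha_le1 => z z0 z1; nra.
  by nonneg.
rewrite QE /U.
move: sum_a_recursion a0_le h1 h2 h3.
move: A B y Kr r (L ^+ 2) => A' B' y' K' r' L2; lra.
Qed.

(** Insert [A_le] and [DE] into [EA]: E is bounded by 2/9 E plus data, so E <= 18/7 Q + 3/7 Delta /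
    eta + 9/7 (K M y / 4 + K L^2 M / 2). The target is at most 49/9 E + 14/3 Delta / eta, hence at
    most 14 Q + 7 Delta / eta plus (7/4 y + 7/2 L^2) K M, which the stated constants dominate. *)
Lemma complexity_arithmetic :
  Kr^-1 * \sum_(k < K) (7 / 3 * e k + 7 / 4 * (y * b k)) <=
  (4 * L ^+ 2 + 3 * y) * M + 30 * (p - 1) / (n0 * alpha * Kr) * Sg +
  60 * alpha * (p - 1) / n * Sg + 27 / (eta * Kr) * Delta.
Proof.
have K0 : 0 < Kr by rewrite ltr0n.
have y0 : 0 <= y by rewrite invr_ge0 sqr_ge0.
rewrite big_split/= -!mulr_sumr -/B; set E := \sum_(k < K) e k.
have EA : E <= 2 * A + Kr * (L ^+ 2 * M / 2).
  rewrite /E /A /Kr mulr_sumr mulr_natl -[X in _ + _ *+ X](card_ord K) -sumr_const -big_split/=.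
  by apply: ler_sum => i _; exact: e_le.
have DE : 3 / 8 * (y * B) <= Delta / eta + 2 / 3 * E.
  have i0 : 0 < eta^-1 by rewrite invr_gt0.
  have := descent_sum; rewrite -(ler_pM2l i0) -/B -/E.
  have -> : eta^-1 * (3 / 8 * eta^-1 * B) = 3 / 8 * (y * B) by rewrite /y; field; exact: lt0r_neq0.
  suff -> : eta^-1 * (Delta + 2 / 3 * eta * E) = Delta / eta + 2 / 3 * E by [].
  by field; exact: lt0r_neq0.
rewrite mulrC ler_pdivrMr//.
have -> : ((4 * L ^+ 2 + 3 * y) * M + 30 * (p - 1) / (n0 * alpha * Kr) * Sg +
  60 * alpha * (p - 1) / n * Sg + 27 / (eta * Kr) * Delta) * Kr =
  (4 * L ^+ 2 + 3 * y) * M * Kr + 15 * Q + 27 * (Delta / eta).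
  rewrite /Q /r; field.
  by rewrite !lt0r_neq0.
have h1 : 0 <= L ^+ 2 * M * Kr by rewrite !mulr_ge0 ?sqr_ge0// ltW.
have h2 : 0 <= y * M * Kr by rewrite !mulr_ge0 ?sqr_ge0// ltW.
have h3 : 0 <= Delta / eta by rewrite divr_ge0 ?(ltW eta_gt0).
have Q0 : 0 <= Q.
  by rewrite /Q /r; nonneg.
move: A_le EA DE h1 h2 h3 Q0.
move: A B y Kr Q (L ^+ 2) E (Delta / eta) => A' B' y' K' Q' L2 E' D'; lra.
Qed.

End complexity_arithmetic.

(** * Recursive momentum *)

(** Tonelli makes the integrals of the positive and of the negative part measurable in the
    parameter; no integrability is required. *)
Lemma measurable_mean_row {R : realType} {d : nat} {d1 d2 : measure_display}
    {T : measurableType d1} {S : measurableType d2} (Q : probability S R)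
    (Z : T -> S -> 'rV[R]_d) :
  measurable_fun setT (fun t : T * S => Z t.1 t.2) ->
  measurable_fun setT (fun y => mean_row Q (Z y)).
Proof.
move=> mZ; apply: measurable_rowP => i; under eq_fun do rewrite mxE.
have mg : measurable_fun setT (fun t : T * S => (Z t.1 t.2 0 i)%:E).
  by apply/measurable_EFinP; exact: measurable_row_coord.
apply: measurableT_comp => //.
pose g (t : T * S) := (Z t.1 t.2 0 i)%:E.
have -> : (fun y => \int[Q]_t (Z y t 0 i)%:E)%E =
    (fubini_F Q (g^\+) \- fubini_F Q (g^\-))%E.
  apply/funext => y; rewrite integralE; congr (_ - _)%E; apply: eq_integral => t _.
    by rewrite !funeposE.
  by rewrite !funenegE.
apply: emeasurable_funB; apply: measurable_fun_fubini_tonelli_F.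
- exact: measurable_funepos.
- by move=> t; exact: funepos_ge0.
- exact: measurable_funeneg.
- by move=> t; exact: funeneg_ge0.
Qed.

Section recursive_momentum.
Context {R : realType} {d m : nat} {dO dS : measure_display}.
Context {Omega : measurableType dO} {S : measurableType dS}.
Variables (P : probability Omega R) (I : choiceType) (Gs : I -> set (set Omega)).
Variables (Q : probability S R) (D : nat -> nat -> set I) (W : nat -> nat -> Omega -> S).
Variables (X : set 'rV[R]_d) (p q : R) (G : 'rV[R]_d -> S -> 'rV[R]_d).
Variables (gbar gf : 'rV[R]_d -> 'rV[R]_d).
Let T : Type := ('rV[R]_d * ('rV[R]_m * 'rV[R]_d))%type.
Variables (next : T -> 'rV[R]_d) (upd : nat -> T -> 'rV[R]_m).
Variables (alpha eta L Sp M Sg Delta D_X : R) (n0 n K : nat).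
Variables (x0 : 'rV[R]_d) (Y : nat -> Omega -> T).
Hypotheses (p_ge2 : 2 <= p) (q_ge1 : 1 <= q) (q_le2 : q <= 2).
Hypotheses (alpha_gt0 : 0 < alpha) (alpha_le1 : alpha <= 1).
Hypotheses (eta_gt0 : 0 < eta) (L_gt0 : 0 < L) (Sp_ge1 : 1 <= Sp) (M_ge0 : 0 <= M).
Hypotheses (Sg_ge0 : 0 <= Sg) (Delta_ge0 : 0 <= Delta).
Hypotheses (n0_gt0 : (0 < n0)%N) (n_gt0 : (0 < n)%N) (K_gt0 : (0 < K)%N).
Hypothesis n_large : 96 * (p - 1) * Sp * eta ^+ 2 * L ^+ 2 / alpha <= n%:R.
Hypothesis X_bounded : forall x, X x -> pnorm q x <= D_X.
Hypothesis x0X : X x0.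
Hypothesis W_fresh : forall k j, (k < K)%N -> (j < batch n0 n k)%N ->
  fresh_sample P Gs (D k j) (D k j.+1) Q (W k j).
Hypothesis D_step : forall k, D k.+1 0%N `<=` D k (batch n0 n k).
Hypothesis D_start : indep_from P Gs (D 0%N 0%N) (fun=> tt).
Hypothesis G_measurable2 : measurable_fun setT (fun t : 'rV[R]_d * S => G t.1 t.2).
Hypothesis gbar_measurable : measurable_fun setT gbar.
Hypothesis gf_measurable : measurable_fun setT gf.
Hypothesis G_square : forall x, X x -> square_integrable Q p (G x).
Hypothesis G_mean : forall x, X x -> mean_row Q (G x) = gbar x.
Hypothesis G_var : forall x, X x ->
  (\int[Q]_t (pnorm p (G x t - gbar x) ^+ 2)%:E <= (2 * Sg)%:E)%E.
Hypothesis G_diff : forall x y, X x -> X y ->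
  (\int[Q]_t (pnorm p ((G x t - G y t) - (gbar x - gbar y)) ^+ 2)%:E <=
   (6 * Sp * L ^+ 2 * pnorm 2 (x - y) ^+ 2 + 12 * (L ^+ 2 * M))%:E)%E.
Hypothesis G_bias : forall x, X x -> pnorm p (gbar x - gf x) ^+ 2 <= L ^+ 2 * M / 4.
Hypothesis next_in : forall y, X (next y).
Hypothesis next_measurable : measurable_fun setT next.
Hypothesis upd_measurable : forall k, measurable_fun setT (upd k).
Hypothesis Y0 : forall w, Y 0%N w = (x0, (0, n0%:R^-1 *: \sum_(j < n0) G x0 (W 0%N j w))).
Hypothesis YS : forall k w, Y k.+1 w = (next (Y k w), (upd k (Y k w),
  n%:R^-1 *: \sum_(j < n) (G (next (Y k w)) (W k.+1 j w) +
    (1 - alpha) *: ((Y k w).2.2 - G (Y k w).1 (W k.+1 j w))))).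

Let p_gt0 : 0 < p. Proof. exact: lt_le_trans p_ge2. Qed.
Let p_neq0 : p != 0. Proof. exact: lt0r_neq0. Qed.
Let p_ge1 : 1 <= p. Proof. by apply: le_trans p_ge2; rewrite ler1n. Qed.
Let q_gt0 : 0 < q. Proof. exact: lt_le_trans q_ge1. Qed.

(** The new s is the average of [inc], whose mean is [mm], the smoothed gradient at the next point
    plus [a]. Subtracting that gradient, the new error is [a] plus an average of centred increments,
    exactly the shape of [batch_sum]. *)
Let inc (y : T) t := G (next y) t + (1 - alpha) *: (y.2.2 - G y.1 t).
Let eps (y : T) := y.2.2 - gbar y.1.
Let a (y : T) := (1 - alpha) *: eps y.
Let mm (y : T) := gbar (next y) + a y.
Let dx2 (y : T) := pnorm q (y.1 - next y) ^+ 2.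
Let b (y : T) := 2 * alpha ^+ 2 * (2 * Sg) +
  2 * (1 - alpha) ^+ 2 * (6 * Sp * L ^+ 2 * dx2 y + 12 * (L ^+ 2 * M)).

Let mT1 : measurable_fun setT (fun y : T => y.1). Proof. exact: measurable_fst. Qed.
Let mT3 : measurable_fun setT (fun y : T => y.2.2).
Proof. exact: (measurableT_comp measurable_snd measurable_snd). Qed.

Let mG d' (T' : measurableType d') (f : T' -> 'rV[R]_d) (g : T' -> S) :
  measurable_fun setT f -> measurable_fun setT g ->
  measurable_fun setT (fun t => G (f t) (g t)).
Proof.
move=> mf mg; apply: (measurableT_comp G_measurable2
  (_ : measurable_fun setT (fun t => (f t, g t)))).
exact: measurable_fun_pair.
Qed.

Let minc : measurable_fun setT (fun t : T * S => inc t.1 t.2).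
Proof.
have m1 : measurable_fun setT (fun t : T * S => t.1.1) by exact: measurableT_comp mT1 measurable_fst.
have m3 : measurable_fun setT (fun t : T * S => t.1.2.2) by exact: measurableT_comp mT3 measurable_fst.
apply: measurable_rowD.
  by apply: mG => //; exact: measurableT_comp next_measurable measurable_fst.
apply: measurable_rowZ; first exact: measurable_cst.
by apply: measurable_rowB => //; exact: mG.
Qed.

Let meps : measurable_fun setT eps.
Proof. by apply: measurable_rowB => //; exact: measurableT_comp gbar_measurable mT1. Qed.

Let ma : measurable_fun setT a.
Proof. by apply: measurable_rowZ => //; exact: measurable_cst. Qed.

Let mmm : measurable_fun setT mm.
Proof. by apply: measurable_rowD => //; exact: measurableT_comp gbar_measurable next_measurable. Qed.

Let mdx2 : measurable_fun setT dx2.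
Proof. by apply: measurable_pnorm_sqr; exact: measurable_rowB. Qed.

Let mb : measurable_fun setT b.
Proof.
apply: measurable_funD; first exact: measurable_cst.
apply: measurable_funM; first exact: measurable_cst.
apply: measurable_funD; last exact: measurable_cst.
by apply: measurable_funM => //; exact: measurable_cst.
Qed.

Let dx2_ge0 y : 0 <= dx2 y. Proof. exact: sqr_ge0. Qed.

Let Sp_ge0 : 0 <= Sp. Proof. exact: le_trans Sp_ge1. Qed.

Let b_ge0 y : 0 <= b y.
Proof. by have := dx2_ge0 y; rewrite /b => ?; nonneg. Qed.

Lemma state_in k w : X (Y k w).1.
Proof. by case: k => [|k]; rewrite ?Y0 ?YS//=. Qed.

Let inc_mean y : X y.1 -> square_integrable Q p (inc y) /\ mean_row Q (inc y) = mm y.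
Proof.
move=> yX; have s1 := G_square (next_in y); have s2 := G_square yX.
have s3 := square_integrableZ (-1) p_neq0 s2.
have s4 := square_integrableD p_ge1 (square_integrable_cst Q p y.2.2) s3.
have s5 := square_integrableZ (1 - alpha) p_neq0 s4.
have -> : inc y = fun t => G (next y) t + (1 - alpha) *: (y.2.2 + (-1) *: G y.1 t).
  by apply/funext => t; rewrite /inc scaleN1r.
split; first exact: square_integrableD.
rewrite (mean_rowD p_gt0 s1 s5) (mean_rowZ _ p_gt0 s4).
rewrite (mean_rowD p_gt0 (square_integrable_cst Q p y.2.2) s3) (mean_rowZ _ p_gt0 s2).
by rewrite mean_row_cst !G_mean// scaleN1r.
Qed.

(* The centred increment is alpha (G x' - gbar x') +                            *)
(* (1 - alpha) ((G x' - G x) - (gbar x' - gbar x)), with x' = next y.            *)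
Let inc_var y : X y.1 ->
  (\int[Q]_t (pnorm p (inc y t - mm y) ^+ 2)%:E <= (b y)%:E)%E.
Proof.
move=> yX; have Nx := next_in y.
have [a2 b2] : 0 <= 2 * alpha ^+ 2 /\ 0 <= 2 * (1 - alpha) ^+ 2.
  by split; nonneg.
have mGx x : measurable_fun setT (G x).
  by apply: mG => //; exact: measurable_cst.
apply: (@le_trans _ _ ((2 * alpha ^+ 2)%:E * \int[Q]_t (pnorm p (G (next y) t - gbar (next y)) ^+ 2)%:E +
  (2 * (1 - alpha) ^+ 2)%:E * \int[Q]_t (pnorm p ((G (next y) t - G y.1 t) -
     (gbar (next y) - gbar y.1)) ^+ 2)%:E)%E).
  apply: ge0_integral_le2 => // [||t|t|t|t]; rewrite ?sqr_ge0//.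
  - apply: measurable_pnorm_sqr; apply: measurable_rowB => //; exact: measurable_cst.
  - apply: measurable_pnorm_sqr; apply: measurable_rowB; last exact: measurable_cst.
    exact: measurable_rowB.
  have -> : inc y t - mm y = alpha *: (G (next y) t - gbar (next y)) +
    (1 - alpha) *: ((G (next y) t - G y.1 t) - (gbar (next y) - gbar y.1)).
    by apply/rowP => i; rewrite /inc /mm /a /eps !mxE; ring.
  apply: (le_trans (pnorm_sqrD_le _ _ p_ge1)).
  rewrite !pnormZ// !exprMn !real_normK ?num_real// !mulrA; exact: lexx.
rewrite EFinD [X in (_ <= X + _)%E]EFinM [X in (_ <= _ + X)%E]EFinM.
apply: leeD; apply: lee_wpmul2l => //; first exact: G_var.
apply: (le_trans (G_diff Nx yX)); rewrite lee_fin lerD2r.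
rewrite ler_wpM2l//; first by nonneg.
rewrite ler_sqr ?nnegrE ?pnorm_ge0// pnorm_distC ?(lt0r_neq0 q_gt0) ?pnatr_eq0//.
exact: pnorm_le.
Qed.

(* The first batch is an instance of batch_average with trivial state space.     *)
Lemma initial_round :
  indep_from P Gs (D 0%N n0) (Y 0%N) /\
  (\int[P]_w (pnorm p (eps (Y 0%N w)) ^+ 2)%:E <= ((p - 1) / n0%:R * (2 * Sg))%:E)%E.
Proof.
have fr j : (j < n0)%N -> fresh_sample P Gs (D 0%N j) (D 0%N j.+1) Q (W 0%N j).
  by move=> jn; exact: W_fresh.
have m1 : measurable_fun setT (fun _ : unit => 0 : 'rV[R]_d) by exact: measurable_cst.
have m2 : measurable_fun setT (fun _ : unit => gbar x0) by exact: measurable_cst.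
have m3 : measurable_fun setT (fun t : unit * S => G x0 t.2).
  by apply: mG; [exact: measurable_cst|exact: measurable_snd].
have i0 := batch_sum_indep (inc := fun _ : unit => G x0) fr D_start m1 m2 m3 (leqnn n0).
have E w : batch_sum (W 0%N) n0 (fun=> tt) (fun=> 0) (fun=> gbar x0) (fun=> G x0) n0 w = eps (Y 0%N w).
  by rewrite batch_sumE// Y0 /eps/= sub0r addrC.
split.
  have mg : measurable_fun setT (fun t : unit * 'rV[R]_d =>
      ((x0, (0, t.2 + gbar x0)) : T)).
    apply: measurable_fun_pair; first exact: measurable_cst.
    apply: measurable_fun_pair; first exact: measurable_cst.
    by apply: measurable_rowD; [exact: measurable_snd|exact: measurable_cst].
  have := indep_from_comp mg i0; rewrite (_ : _ \o _ = Y 0%N)//.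
  by apply/funext => w /=; rewrite E /eps Y0/= subrK.
have mb0 : measurable_fun setT (fun _ : unit => 2 * Sg) by exact: measurable_cst.
have b00 (y : unit) : 0 <= 2 * Sg by rewrite mulr_ge0.
have := batch_average_bound (inc := fun _ : unit => G x0) fr p_ge2 D_start m1 m2 m3 (fun=> G_square x0X)
  (fun=> G_mean x0X) mb0 b00 (fun=> G_var x0X) n0_gt0.
under eq_integral do rewrite E; move=> /le_trans; apply.
rewrite integral_probability_cst (eq_integral (fun=> 0%:E)); last first.
  by move=> w _; rewrite pnorm0// expr0n.
by rewrite integral_probability_cst add0e -EFinM.
Qed.

(** The averaging bounds applied to the state Y k; the next state is a measurable function of Y k
    and of the new error, so it inherits independence from the sources left. *)
Lemma next_round k : (k.+1 < K)%N -> indep_from P Gs (D k (batch n0 n k)) (Y k) ->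
  indep_from P Gs (D k.+1 n) (Y k.+1) /\
  (\int[P]_w (pnorm p (eps (Y k.+1 w)) ^+ 2)%:E <=
   \int[P]_w (pnorm p (a (Y k w)) ^+ 2)%:E +
   ((p - 1) / n%:R)%:E * \int[P]_w (b (Y k w))%:E)%E.
Proof.
move=> kK /(indep_from_sub (@D_step k)) iY.
have fr j : (j < n)%N -> fresh_sample P Gs (D k.+1 j) (D k.+1 j.+1) Q (W k.+1 j).
  by move=> jn; exact: W_fresh.
have i0 := batch_sum_indep fr iY ma mmm minc (leqnn n).
have E w : batch_sum (W k.+1) n (Y k) a mm inc n w = eps (Y k.+1 w).
  rewrite batch_sumE// YS /eps/= /mm opprD addrCA subrr addr0 addrC; congr (_ - _).
split.
  have mg : measurable_fun setT (fun t : T * 'rV[R]_d =>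
      ((next t.1, (upd k t.1, t.2 + gbar (next t.1))) : T)).
    have mn : measurable_fun setT (fun t : T * 'rV[R]_d => next t.1).
      exact: measurableT_comp next_measurable measurable_fst.
    apply: measurable_fun_pair => //; apply: measurable_fun_pair.
      exact: measurableT_comp (upd_measurable k) measurable_fst.
    apply: measurable_rowD; first exact: measurable_snd.
    exact: measurableT_comp gbar_measurable mn.
  have := indep_from_comp mg i0; rewrite (_ : _ \o _ = Y k.+1)//.
  by apply/funext => w /=; rewrite E /eps YS/= subrK.
have sq w := inc_mean (state_in k w).
have := batch_average_bound fr p_ge2 iY ma mmm minc (fun w => (sq w).1)
  (fun w => (sq w).2) mb b_ge0 (fun w => inc_var (state_in k w)) n_gt0.
by under eq_integral do rewrite E.
Qed.

Lemma state_indep k : (k < K)%N -> indep_from P Gs (D k (batch n0 n k)) (Y k).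
Proof.
elim: k => [_|k IH kK]; first by have [] := initial_round.
by have [] := next_round kK (IH (ltnW kK)).
Qed.

Let mY k : (k < K)%N -> measurable_fun setT (Y k).
Proof. by move=> /state_indep[]. Qed.

Let B k : R := fine (\int[P]_w (dx2 (Y k w))%:E).
Let A k : R := fine (\int[P]_w (pnorm p (eps (Y k w)) ^+ 2)%:E).

(** The integral is finite because X is bounded. *)
Let BE k : (k < K)%N -> (\int[P]_w (dx2 (Y k w))%:E = (B k)%:E)%E.
Proof.
move=> kK; rewrite /B fineK// ge0_fin_numE; last first.
  by apply: integral_ge0 => w _; rewrite lee_fin.
apply: (@le_lt_trans _ _ (\int[P]_w ((D_X + D_X) ^+ 2)%:E)%E).
  apply: ge0_le_integral_any => w; rewrite ?lee_fin//.
  rewrite ler_sqr ?nnegrE ?pnorm_ge0//; last first.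
    by rewrite addr_ge0// (le_trans (pnorm_ge0 q x0)) ?X_bounded.
  apply: (le_trans (pnormB _ _ q_ge1)).
  by rewrite lerD// X_bounded//; exact: state_in.
by rewrite integral_probability_cst ltry.
Qed.

Let c1 := 2 * alpha ^+ 2 * (2 * Sg) + 2 * (1 - alpha) ^+ 2 * (12 * (L ^+ 2 * M)).
Let c2 := 2 * (1 - alpha) ^+ 2 * (6 * Sp * L ^+ 2).

Let AS k : (k.+1 < K)%N ->
  (\int[P]_w (pnorm p (eps (Y k.+1 w)) ^+ 2)%:E <=
   ((1 - alpha) ^+ 2)%:E * \int[P]_w (pnorm p (eps (Y k w)) ^+ 2)%:E +
   ((p - 1) / n%:R)%:E * (c1 + c2 * B k)%:E)%E.
Proof.
move=> kK; have kK' := ltnW kK.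
have [_ /le_trans] := next_round kK (state_indep kK'); apply.
have me : measurable_fun setT (fun w => pnorm p (eps (Y k w)) ^+ 2).
  by apply: measurable_pnorm_sqr; exact: measurableT_comp meps (mY kK').
apply: leeD.
  apply: ge0_integral_le1 => // [|w|w|w]; rewrite ?sqr_ge0//.
  by rewrite /a pnormZ// exprMn real_normK ?num_real.
apply: lee_wpmul2l.
  by rewrite lee_fin divr_ge0// subr_ge0.
have cc : 0 <= c1 /\ 0 <= c2 by split; rewrite /c1 /c2; nonneg.
rewrite EFinD EFinM -BE//.
apply: ge0_integral_le_cst; rewrite ?cc.1 ?cc.2//.
- exact: measurableT_comp mdx2 (mY kK').
- by move=> w; rewrite /b /c1 /c2; apply: le_of_eq; ring.
Qed.

(** Finiteness propagates along the recursion [AS] from the first batch; only then can the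
    inequalities be read in the reals. *)
Let AE k : (k < K)%N -> (\int[P]_w (pnorm p (eps (Y k w)) ^+ 2)%:E = (A k)%:E)%E.
Proof.
move=> kK; rewrite /A fineK// ge0_fin_numE; last first.
  by apply: integral_ge0 => w _; rewrite lee_fin sqr_ge0.
elim: k kK => [_|k IH kK]; first by apply: (le_lt_trans initial_round.2); rewrite ltry.
apply: (le_lt_trans (AS kK)); apply: lte_add_pinfty; last by rewrite ltry.
by apply: lte_mul_pinfty; rewrite ?lee_fin ?sqr_ge0//; exact/IH/ltnW.
Qed.

Let A_ge0 k : 0 <= A k.
Proof. by apply: fine_ge0; apply: integral_ge0 => w _; rewrite lee_fin sqr_ge0. Qed.

Let B_ge0 k : 0 <= B k.
Proof. by apply: fine_ge0; apply: integral_ge0 => w _; rewrite lee_fin. Qed.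

Let e2 (y : T) := pnorm p (y.2.2 - gf y.1) ^+ 2.
Let me2 : measurable_fun setT e2.
Proof.
apply: measurable_pnorm_sqr; apply: measurable_rowB => //.
exact: measurableT_comp gf_measurable mT1.
Qed.

Let E k : R := fine (\int[P]_w (e2 (Y k w))%:E).

(** The error around grad f is the error around the smoothed gradient plus the bias, whose square is
    at most L^2 M / 4; M will be nu^2 E|u|^6. *)
Let e2_le k : (k < K)%N -> (\int[P]_w (e2 (Y k w))%:E <= (2 * A k + L ^+ 2 * M / 2)%:E)%E.
Proof.
move=> kK; rewrite addrC EFinD [X in (_ <= _ + X)%E]EFinM -AE//.
apply: ge0_integral_le_cst => //.
- by nonneg.
- by apply: measurable_pnorm_sqr; exact: measurableT_comp meps (mY kK).
- by move=> w; exact: sqr_ge0.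
- by move=> w; exact: sqr_ge0.
move=> w; have yX := state_in k w.
have -> : L ^+ 2 * M / 2 = 2 * (L ^+ 2 * M / 4) by field.
have : pnorm p ((gbar (Y k w).1 - gf (Y k w).1) + eps (Y k w)) ^+ 2 <= _ :=
  pnorm_sqrD_le _ _ p_ge1.
rewrite {1}/eps (addrC _ ((Y k w).2.2 - _)) addrA subrK -/(e2 _) => /le_trans; apply.
by rewrite lerD2r ler_pM2l// G_bias.
Qed.

Let EE k : (k < K)%N -> (\int[P]_w (e2 (Y k w))%:E = (E k)%:E)%E.
Proof.
move=> kK; rewrite /E fineK// ge0_fin_numE; last first.
  by apply: integral_ge0 => w _; rewrite lee_fin sqr_ge0.
exact: le_lt_trans (e2_le kK) (ltry _).
Qed.

Hypothesis descent_path : forall w, 3 / 8 * eta^-1 * \sum_(k < K) dx2 (Y k w) <=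
  Delta + 2 / 3 * eta * \sum_(k < K) e2 (Y k w).

Let integral_sumE (g : T -> R) : measurable_fun setT g -> (forall y, 0 <= g y) ->
  (\int[P]_w (\sum_(k < K) g (Y k w))%:E = \sum_(k < K) \int[P]_w (g (Y k w))%:E)%E.
Proof.
move=> mg g0; under eq_integral do rewrite -sumEFin.
rewrite ge0_integral_sum// => [k|k w _]; last by rewrite lee_fin.
by apply/measurable_EFinP; exact: measurableT_comp mg (mY (ltn_ord k)).
Qed.

Let descent_mean : 3 / 8 * eta^-1 * \sum_(k < K) B k <= Delta + 2 / 3 * eta * \sum_(k < K) E k.
Proof.
have c0 : 0 <= 3 / 8 * eta^-1 by nonneg.
have c0' : 0 <= 2 / 3 * eta by nonneg.
have e20 y : 0 <= e2 y by exact: sqr_ge0.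
have mS (g : T -> R) : measurable_fun setT g ->
    measurable_fun setT (fun w => \sum_(k < K) g (Y k w)).
  by move=> mg; apply: measurable_sum => k; exact: measurableT_comp mg (mY (ltn_ord k)).
rewrite -lee_fin EFinM EFinD [X in (_ <= _ + X)%E]EFinM -!sumEFin.
under eq_bigr => k _ do rewrite -BE//.
under [X in (_ <= _ + _ * X)%E]eq_bigr => k _ do rewrite -EE//.
rewrite -!integral_sumE// -ge0_integralZl_EFin//; last 2 first.
- by move=> w _; rewrite lee_fin sumr_ge0.
- by apply/measurable_EFinP; exact: mS.
apply: ge0_integral_le_cst => //; first exact: mS.
- by move=> w; rewrite mulr_ge0// sumr_ge0.
- by move=> w; rewrite sumr_ge0.
Qed.

Lemma recursive_momentum_bound :
  ((K%:R^-1)%:E * \sum_(k < K) \int[P]_w (7 / 3 * e2 (Y k w) + 7 / 4 * (eta ^- 2 * dx2 (Y k w)))%:E <=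
   ((4 * L ^+ 2 + 3 * eta ^- 2) * M + 30 * (p - 1) / (n0%:R * alpha * K%:R) * Sg +
    60 * alpha * (p - 1) / n%:R * Sg + 27 / (eta * K%:R) * Delta)%:E)%E.
Proof.
have nr : 0 < n%:R :> R by rewrite ltr0n.
have n0r : 0 < n0%:R :> R by rewrite ltr0n.
have h0 : A 0%N <= (p - 1) / n0%:R * (2 * Sg).
  by rewrite -lee_fin -AE//; exact: initial_round.2.
have hS k : (k.+1 < K)%N -> A k.+1 <= (1 - alpha) ^+ 2 * A k +
    (p - 1) / n%:R * (2 * alpha ^+ 2 * (2 * Sg) +
    2 * (1 - alpha) ^+ 2 * (6 * Sp * L ^+ 2 * B k + 12 * (L ^+ 2 * M))).
  move=> kK; have := AS kK; rewrite !AE ?(ltnW kK)// -!EFinM -EFinD lee_fin.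
  by move=> /le_trans; apply; rewrite lerD2l /c1 /c2; apply: le_of_eq; ring.
have hE k : (k < K)%N -> E k <= 2 * A k + L ^+ 2 * M / 2.
  by move=> kK; rewrite -lee_fin -EE//; exact: e2_le.
have := complexity_arithmetic p_ge2 alpha_gt0 alpha_le1 eta_gt0 L_gt0 Sp_ge1 M_ge0 Sg_ge0
  Delta_ge0 nr n0r K_gt0 n_large A_ge0 B_ge0 h0 hS hE descent_mean.
rewrite -lee_fin => /(le_trans _); apply.
rewrite EFinM -sumEFin; apply: lee_wpmul2l; first by rewrite lee_fin invr_ge0.
apply: lee_sum => k _; rewrite mulrA [X in (_ <= X)%E]EFinD !EFinM -EE// -BE// -EFinM.
apply: ge0_integral_le2 => //.
- by nonneg.
- exact: measurableT_comp me2 (mY (ltn_ord k)).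
- exact: measurableT_comp mdx2 (mY (ltn_ord k)).
- by move=> w; have := dx2_ge0 (Y k w); have : 0 <= e2 (Y k w) := sqr_ge0 _ => ? ?; nonneg.
- by move=> w; exact: sqr_ge0.
- by move=> w; rewrite mulrA.
Qed.

End recursive_momentum.

(** * The algorithm *)

Section algorithm.
Context {R : realType} {d m : nat} {dX dO : measure_display}.
Context {Xi : measurableType dX} {Omega : measurableType dO}.
Variables (Pxi : probability Xi R) (Pu : probability 'rV[R]_d R) (P : probability Omega R).
Variables (p q : R) (F : 'rV[R]_d -> Xi -> R) (f : 'rV[R]_d -> R) (h : 'rV[R]_d -> \bar R).
Variables (c : 'rV[R]_d -> 'rV[R]_m) (v : 'rV[R]_d -> R) (X O : set 'rV[R]_d).
Variables (D_X M_h eta mu nu rho alpha L_f M_f Mbar_c M_c L_c Phi_inf sigma S_p E6 : R).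
Variables (K n0 n : nat) (rho_ : nat -> R) (x0 : 'rV[R]_d).
Variables (u : nat -> nat -> Omega -> 'rV[R]_d) (xi : nat -> nat -> Omega -> Xi).
Variable idx : Omega -> nat.
Hypotheses (p_ge2 : 2 <= p) (q_ge1 : 1 <= q) (q_le2 : q <= 2) (pq : p^-1 + q^-1 = 1).
Hypothesis F_measurable : forall x, measurable_fun setT (F x).
Hypothesis F_integrable : forall x, Pxi.-integrable setT (fun z => (F x z)%:E).
Hypothesis F_mean : forall x, (\int[Pxi]_z (F x z)%:E = (f x)%:E)%E.
Hypothesis F_C1 : forall z, cont_diff (F^~ z).
Hypothesis f_differentiable : forall x, differentiable f x.
Hypothesis c_differentiable : forall i x, differentiable (fun y => c y 0 i) x.
Hypothesis h_convex : econvex h.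
Hypothesis nu_gt0 : 0 < nu.
Hypothesis O_open : open O.
Hypothesis O_region : forall x (t : R) w, X x -> 0 <= t <= 1 -> msupport Pu w ->
  O (x + (t * nu) *: w).
Hypothesis X_sub_O : X `<=` O.
Hypotheses (L_f_gt0 : 0 < L_f) (M_f_gt0 : 0 < M_f) (Mbar_c_gt0 : 0 < Mbar_c) (L_c_gt0 : 0 < L_c).
Hypotheses (X_neq0 : X !=set0) (X_closed : closed X) (X_convex : convex_set X).
Hypothesis X_bounded : forall x, X x -> pnorm q x <= D_X.
Hypothesis f_smooth : forall x y, O x -> O y ->
  pnorm 2 (grad f x - grad f y) <= L_f * pnorm 2 (x - y).
Hypothesis f_lipschitz : forall x y, O x -> O y -> `|f x - f y| <= M_f * pnorm 2 (x - y).
Hypothesis h_subdifferential_neq0 : forall x, X x -> subdifferential h x !=set0.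
Hypothesis h_subdifferential_bounded : forall x g, X x -> subdifferential h x g ->
  pnorm 2 g <= M_h.
Hypothesis c_bounded : forall i x, X x -> `|c x 0 i| <= Mbar_c.
Hypothesis grad_c_bounded : forall i x, X x -> pnorm 2 (grad (fun z => c z 0 i) x) <= M_c.
Hypothesis c_smooth : forall i x y, X x -> X y ->
  pnorm 2 (grad (fun z => c z 0 i) x - grad (fun z => c z 0 i) y) <= L_c * pnorm 2 (x - y).
Hypothesis Phi_bounded : forall x, X x -> (Phi_inf%:E <= (f x)%:E + h x)%E.
Let gF x z := grad (F^~ z) x.
Hypothesis F_variance : forall x, O x ->
  (\int[Pxi]_z (pnorm 2 (gF x z - grad f x) ^+ 2)%:E <= (sigma ^+ 2)%:E)%E.
Hypothesis F_mean_smooth : forall x y, O x -> O y ->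
  (\int[Pxi]_z (pnorm 2 (gF x z - gF y z) ^+ 2)%:E <= (L_f ^+ 2 * pnorm 2 (x - y) ^+ 2)%:E)%E.
Hypothesis S_p_ge1 : 1 <= S_p.
Hypothesis u_anisotropy : forall g : 'rV[R]_d,
  (\int[Pu]_u (pnorm p (dotv g u *: u) ^+ 2)%:E <= (S_p * pnorm 2 g ^+ 2)%:E)%E.
Hypothesis u_isotropic : forall i j, (\int[Pu]_u (u 0 i * u 0 j)%:E = ((i == j)%:R)%:E)%E.
Hypothesis u_moment6 : (\int[Pu]_u (pnorm 2 u ^+ 6)%:E = E6%:E)%E.
Hypothesis v_differentiable : forall x, differentiable v x.
Hypothesis v_strongly_convex : forall x y,
  pnorm q (x - y) ^+ 2 <= dotv (x - y) (grad v x - grad v y).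
Hypothesis x0X : X x0.
Hypotheses (mu_gt0 : 0 < mu) (eta_gt0 : 0 < eta) (alpha_gt0 : 0 < alpha) (alpha_le1 : alpha <= 1).
Hypotheses (K_gt0 : (0 < K)%N) (n0_gt0 : (0 < n0)%N) (n_gt0 : (0 < n)%N).
Hypothesis u_measurable : forall k j, measurable_fun setT (u k j).
Hypothesis xi_measurable : forall k j, measurable_fun setT (xi k j).
Hypothesis idx_measurable : measurable_fun setT idx.
Hypothesis u_law : forall k j, (k < K)%N -> (j < batch n0 n k)%N ->
  forall A, measurable A -> P (u k j @^-1` A) = Pu A.
Hypothesis xi_law : forall k j, (k < K)%N -> (j < batch n0 n k)%N ->
  forall A, measurable A -> P (xi k j @^-1` A) = Pxi A.
Hypothesis idx_law : forall k, (k < K)%N -> P (idx @^-1` [set k]) = (K%:R^-1)%:E.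
Let Gs := source_sigma_algebra u xi idx.
Hypothesis independent : mutually_independent P (sources K n0 n) Gs.
Hypothesis rho_gt0 : 0 < rho.
Hypothesis rho_def : forall k, (k < K)%N -> rho_ k = rho / K%:R.
Let L_mu := L_f + m%:R * (mu * M_c ^+ 2 + mu * Mbar_c * L_c + rho * Mbar_c * L_c).
Hypothesis eta_L_mu : eta * L_mu <= 2^-1.
Hypothesis n_large : 96 * (p - 1) * S_p * eta ^+ 2 * L_f ^+ 2 / alpha <= n%:R.

Let it k w := mdlal F h c v X x0 mu eta nu alpha rho_ n0 n (fun k j => u k j w) (fun k j => xi k j w) k.
Let T : Type := ('rV[R]_d * ('rV[R]_m * 'rV[R]_d))%type.
Definition state k w : T := (it_x (it k w), (it_lambda (it k w), it_s (it k w))).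
Let direction (y : T) := y.2.2 + grad_constr c y.1 (y.2.1 + mu *: c y.1).
Definition next_point (y : T) := mirror_step X h v eta y.1 (direction y).
Let upd k (y : T) := y.2.1 + rho_ k *: c y.1.

(* Sources not yet used when sample j of iteration k is drawn. *)
Definition unused_sources (k j : nat) : set source :=
  sources K n0 n `&` [set i | match i with
    | inl (inl (k', j')) | inl (inr (k', j')) => (k < k')%N || ((k' == k) && (j <= j')%N)
    | inr _ => true
    end].

Let Gs_measurable i A : Gs i A -> measurable A.
Proof.
have pm d' (T' : measurableType d') (g : Omega -> T') : measurable_fun setT g ->
    preimage_set_system setT g measurable A -> measurable A.
  by move=> mg [B mB <-]; exact: mg.
by case: i => [[[k j]|[k j]]|[]]; exact: pm.
Qed.

Let u_fresh k j : (k < K)%N -> (j < batch n0 n k)%N ->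
  fresh_sample P Gs (unused_sources k j)
    (unused_sources k j `\ inl (inl (k, j))) Pu (u k j).
Proof.
move=> kK jn; apply: fresh_sample1 => //; last exact: u_law.
by split; rewrite /= ?kK// eqxx leqnn orbT.
Qed.

Lemma pair_fresh k j : (k < K)%N -> (j < batch n0 n k)%N ->
  fresh_sample P Gs (unused_sources k j) (unused_sources k j.+1) (Pu \x Pxi)%E
    (fun w => (u k j w, xi k j w)).
Proof.
move=> kK jn; apply: (fresh_sample_pair (u_fresh kK jn)).
apply: (@fresh_sample_sub _ _ _ _ _ _ _ _ _ (unused_sources k j `\ inl (inl (k, j)) `\ inl (inr (k, j)))).
  have lt i : (k < i.1)%N || ((i.1 == k) && (j < i.2)%N) ->
      ((k < i.1)%N || ((i.1 == k) && (j <= i.2)%N)) /\ i != (k, j).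
    move=> H; split; first by case/orP: H => [->//|/andP[-> /ltnW->]]; rewrite orbT.
    by apply: contraL H => /eqP->/=; rewrite eqxx !ltnn.
  move=> [[[k' j']|[k' j']]|[]] [s].
  - move=> /(lt (_, _))[H ne]; split => //; split => //.
    by move=> /= [k'E j'E]; rewrite k'E j'E eqxx in ne.
  - move=> /(lt (_, _))[H ne]; split => //.
    by move=> /= [k'E j'E]; rewrite k'E j'E eqxx in ne.
  - by [].
apply: fresh_sample1 => //; last exact: xi_law.
by split => //; split; rewrite /= ?kK// eqxx leqnn orbT.
Qed.

Let unused_step k : unused_sources k.+1 0 `<=` unused_sources k (batch n0 n k).
Proof.
have lt (i : nat * nat) : (k.+1 < i.1)%N || ((i.1 == k.+1) && (0 <= i.2)%N) ->
    (k < i.1)%N || ((i.1 == k) && (batch n0 n k <= i.2)%N).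
  by case/orP => [/ltnW->//|/andP[/eqP-> _]]; rewrite ltnSn.
by move=> [[[k' j']|[k' j']]|[]] [s H]; split => //; exact: (lt (_, _)).
Qed.

Let start_indep : indep_from P Gs (unused_sources 0 0) (fun=> tt).
Proof. by apply: (@indep_from_sub _ _ _ _ _ _ _ _ (sources K n0 n)) => [i []//|]; exact: indep_from_cst. Qed.

Let G := fun x (w : 'rV[R]_d * Xi) => zo_grad F nu x w.1 w.2.
Let gbar := fun x => mean_row (Pu \x Pxi)%E (G x).

Let state0 w : state 0%N w = (x0, (0, n0%:R^-1 *: \sum_(j < n0) G x0 (u 0%N j w, xi 0%N j w))).
Proof. by []. Qed.

Let stateS k w : state k.+1 w = (next_point (state k w), (upd k (state k w),
  n%:R^-1 *: \sum_(j < n) (G (next_point (state k w)) (u k.+1 j w, xi k.+1 j w) +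
    (1 - alpha) *: ((state k w).2.2 - G (state k w).1 (u k.+1 j w, xi k.+1 j w))))).
Proof. by rewrite /state /it/=; case: (mdlal _ _ _ _ _ _ _ _ _ _ _ _ _ _ _ k). Qed.

Let mc : measurable_fun setT c.
Proof. by apply: measurable_rowP => i; apply: differentiable_measurable_row. Qed.

Let mT1 : measurable_fun setT (fun y : T => y.1). Proof. exact: measurable_fst. Qed.
Let mT2 : measurable_fun setT (fun y : T => y.2.1).
Proof. exact: (measurableT_comp measurable_fst measurable_snd). Qed.
Let mT3 : measurable_fun setT (fun y : T => y.2.2).
Proof. exact: (measurableT_comp measurable_snd measurable_snd). Qed.
Let mcT : measurable_fun setT (fun y : T => c y.1).
Proof. exact: measurableT_comp mc mT1. Qed.

Let mupd k : measurable_fun setT (upd k).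
Proof. by apply: measurable_rowD => //; apply: measurable_rowZ => //; exact: measurable_cst. Qed.

Let p_gt0 : 0 < p. Proof. exact: lt_le_trans p_ge2. Qed.

Let mnext : measurable_fun setT next_point.
Proof.
apply: (@measurable_mirror_step _ _ p q _ _ _ D_X M_h) => //.
apply: measurable_rowD => //; apply: measurable_row_sum => i; apply: measurable_rowZ.
  apply: measurable_row_coord; apply: measurable_rowD => //.
  by apply: measurable_rowZ => //; exact: measurable_cst.
by apply: measurableT_comp mT1; exact: measurable_grad.
Qed.

Let next_in y : X (next_point y).
Proof. exact: (@mirror_step_in _ _ q _ _ _ D_X M_h). Qed.

Let hr x := fine (h x).
Definition initial_gap := f x0 + hr x0 + mu / 2 * pnorm 2 (c x0) ^+ 2 - Phi_inf
  + 2 * m%:R * rho * Mbar_c ^+ 2.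

Definition output_bound (y : T) := 7 / 3 * pnorm p (y.2.2 - grad f y.1) ^+ 2 +
  7 / 4 * (eta ^- 2 * pnorm q (y.1 - next_point y) ^+ 2).

Let f_smoothX x y : X x -> X y -> pnorm 2 (grad f x - grad f y) <= L_f * pnorm 2 (x - y).
Proof. by move=> Xx Xy; apply: f_smooth; exact: X_sub_O. Qed.

Let descent_path w : 3 / 8 * eta^-1 * \sum_(k < K) pnorm q ((state k w).1 - next_point (state k w)) ^+ 2 <=
  initial_gap + 2 / 3 * eta * \sum_(k < K) pnorm p ((state k w).2.2 - grad f (state k w).1) ^+ 2.
Proof.
have E : \sum_(k < K) pnorm q ((state k w).1 - next_point (state k w)) ^+ 2 =
    \sum_(k < K) pnorm q ((state k w).1 - (state k.+1 w).1) ^+ 2.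
  by apply: eq_bigr => k _; rewrite stateS.
rewrite E.
apply: (@trajectory_sum R d m p q X h v f c D_X M_h eta mu rho L_f Mbar_c M_c L_c Phi_inf
  p_ge2 q_ge1 q_le2 pq X_neq0 X_closed X_convex X_bounded h_convex h_subdifferential_neq0
  h_subdifferential_bounded v_differentiable v_strongly_convex f_differentiable
  c_differentiable f_smoothX c_bounded grad_c_bounded c_smooth Phi_bounded
  eta_gt0 mu_gt0 rho_gt0 Mbar_c_gt0 eta_L_mu K (fun k => (state k w).1) (fun k => (state k w).2.1) (fun k => (state k w).2.2)) => //.
  by move=> k _; rewrite stateS.
by move=> k kK; rewrite stateS /upd/= rho_def.
Qed.

Let E6_ge0 : 0 <= E6.
Proof. by rewrite -lee_fin -u_moment6; apply: integral_ge0 => w _; rewrite lee_fin exprn_ge0 ?pnorm_ge0. Qed.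

Let initial_gap_ge0 : 0 <= initial_gap.
Proof.
have := Phi_bounded x0X.
rewrite (@h_fin _ _ X h)// -EFinD lee_fin -/(hr x0) => H.
rewrite /initial_gap addr_ge0//; last by nonneg.
by rewrite addrAC addr_ge0 ?subr_ge0//; nonneg.
Qed.

Let sigma2 := nu ^+ 2 * L_f ^+ 2 * E6 + (4 * S_p * (sigma ^+ 2 + M_f ^+ 2) + 2 * M_f ^+ 2).

Let gb x : X x -> pnorm p (gbar x - grad f x) ^+ 2 <= L_f ^+ 2 * (nu ^+ 2 * E6) / 4.
Proof.
move=> Xx; apply: (@le_trans _ _ (pnorm 2 (gbar x - grad f x) ^+ 2)).
  by rewrite ler_sqr ?nnegrE ?pnorm_ge0// pnorm_le.
rewrite mulrA (mulrC (L_f ^+ 2)).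
exact: (@gbar_bias _ _ _ _ Pxi Pu F f X O p nu L_f M_f sigma S_p).
Qed.

Let mG2 : measurable_fun setT (fun t : 'rV[R]_d * ('rV[R]_d * Xi) => G t.1 t.2).
Proof.
exact: (@measurable_zo_grad _ _ _ _ F nu F_measurable F_C1 _ _
  (fun t : 'rV[R]_d * ('rV[R]_d * Xi) => t.1) (fun t => t.2.1) (fun t => t.2.2)
  measurable_fst (measurableT_comp measurable_fst measurable_snd)
  (measurableT_comp measurable_snd measurable_snd)).
Qed.

Let mgb : measurable_fun setT gbar.
Proof. exact: (measurable_mean_row (Pu \x Pxi)%E mG2). Qed.

Let Gsq x : X x -> square_integrable (Pu \x Pxi)%E p (G x).
Proof.
move=> Xx; apply: (@square_integrable_G _ _ _ _ Pxi Pu F f X O p nu L_f M_f sigma S_p) => //.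
exact: u_moment6.
Qed.

Let Gvar x : X x ->
  (\int[(Pu \x Pxi)%E]_t (pnorm p (G x t - gbar x) ^+ 2)%:E <= (2 * sigma2)%:E)%E.
Proof. exact: (@G_variance _ _ _ _ Pxi Pu F f X O p nu L_f M_f sigma S_p). Qed.

Let Gdiff x y : X x -> X y ->
  (\int[(Pu \x Pxi)%E]_t (pnorm p ((G x t - G y t) - (gbar x - gbar y)) ^+ 2)%:E <=
   (6 * S_p * L_f ^+ 2 * pnorm 2 (x - y) ^+ 2 + 12 * (L_f ^+ 2 * (nu ^+ 2 * E6)))%:E)%E.
Proof.
rewrite [X in 12 * X]mulrA (mulrC (L_f ^+ 2) (nu ^+ 2)).
exact: (@G_difference _ _ _ _ Pxi Pu F f X O p nu L_f M_f sigma S_p).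
Qed.

Let sigma2_ge0 : 0 <= sigma2.
Proof.
have S0 : 0 <= S_p by exact: le_trans S_p_ge1.
by rewrite /sigma2; nonneg.
Qed.

Let M_ge0 : 0 <= nu ^+ 2 * E6. Proof. by rewrite mulr_ge0 ?sqr_ge0. Qed.

Lemma output_bound_mean :
  ((K%:R^-1)%:E * \sum_(k < K) \int[P]_w (output_bound (state k w))%:E <=
   ((4 * L_f ^+ 2 + 3 * eta ^- 2) * (nu ^+ 2 * E6) +
    30 * (p - 1) / (n0%:R * alpha * K%:R) * sigma2 +
    60 * alpha * (p - 1) / n%:R * sigma2 + 27 / (eta * K%:R) * initial_gap)%:E)%E.
Proof.
have mgf := measurable_grad f_differentiable.
apply: (@recursive_momentum_bound _ _ _ _ _ _ _ P source Gs (Pu \x Pxi)%E unused_sources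
  (fun k j w => (u k j w, xi k j w)) X p q G gbar (grad f) next_point upd alpha eta L_f S_p
  (nu ^+ 2 * E6) sigma2 initial_gap D_X n0 n K x0 state) => //.
exact: pair_fresh.
Qed.

Lemma state_indep_idx k : (k < K)%N -> indep_from P Gs [set inr tt] (state k).
Proof.
move=> kK.
have sub : [set inr tt] `<=` unused_sources k (batch n0 n k) by move=> _ ->.
apply: (indep_from_sub sub).
apply: (@state_indep _ _ _ _ _ _ _ P source Gs (Pu \x Pxi)%E unused_sources
  (fun k j w => (u k j w, xi k j w)) X p q G gbar next_point upd alpha L_f S_p
  (nu ^+ 2 * E6) sigma2 n0 n K x0 state) => //.
exact: pair_fresh.
Qed.

Lemma grad_mapping_output_bound y :
  pnorm q (grad_mapping X h v y.1 (grad f y.1 + grad_constr c y.1 (y.2.1 + mu *: c y.1)) eta) ^+ 2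
    <= output_bound y.
Proof.
exact: (@grad_mapping_le _ _ _ p q _ _ _ _ _ D_X M_h).
Qed.

Let output_bound_ge0 y : 0 <= output_bound y.
Proof. by rewrite /output_bound; nonneg. Qed.

Let output_bound_measurable : measurable_fun setT output_bound.
Proof.
have mgf := measurableT_comp (measurable_grad f_differentiable) mT1.
apply: measurable_funD; apply: measurable_funM; try exact: measurable_cst.
  by apply: measurable_pnorm_sqr; exact: measurable_rowB.
apply: measurable_funM; first exact: measurable_cst.
by apply: measurable_pnorm_sqr; exact: measurable_rowB.
Qed.

(* Summed over k < K, this is output_bound at the iterate of index idx.           *)
Definition selected k (t : T * nat) := if t.2 == k then output_bound t.1 else 0.

Let selected_measurable k : measurable_fun setT (selected k).
Proof.
apply: measurable_fun_ifT.
- have ms : measurable_fun setT (fun t : T * nat => t.2) by exact: measurable_snd.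
  by apply: (measurableT_comp (_ : measurable_fun setT (fun i : nat => i == k))).
- exact: measurableT_comp output_bound_measurable measurable_fst.
- exact: measurable_cst.
Qed.

Lemma selected_ge0 k t : 0 <= selected k t.
Proof. by rewrite /selected; case: ifP. Qed.

Lemma measurable_selected k : (k < K)%N ->
  measurable_fun setT (fun w => selected k (state k w, idx w)).
Proof.
move=> kK; have mk := (state_indep_idx kK).1.
apply: (measurableT_comp (selected_measurable k)
  (_ : measurable_fun setT (fun w => (state k w, idx w)))).
exact: measurable_fun_pair.
Qed.

(** Each state is independent of the index, so integrating the index out of the k-th selected term
    leaves the factor 1/K; the sum over k is [output_bound_mean]. *)
Lemma output_bound_le :
  (\int[P]_w (\sum_(k < K) selected k (state k w, idx w))%:E <=
   ((4 * L_f ^+ 2 + 3 * eta ^- 2) * (nu ^+ 2 * E6) +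
    30 * (p - 1) / (n0%:R * alpha * K%:R) * sigma2 +
    60 * alpha * (p - 1) / n%:R * sigma2 + 27 / (eta * K%:R) * initial_gap)%:E)%E.
Proof.
have ob0 := output_bound_ge0; have mob := output_bound_measurable.
pose idx_mfun := mfun_of idx_measurable.
pose phi k (t : T * nat) := (selected k t)%:E.
have mphi k : measurable_fun setT (phi k) by exact/measurable_EFinP.
have phi0 k t : (0 <= phi k t)%E by rewrite lee_fin selected_ge0.
have E (k : 'I_K) : (\int[P]_w phi k (state k w, idx w) =
    (K%:R^-1)%:E * \int[P]_w (output_bound (state k w))%:E)%E.
  have ik := state_indep_idx (ltn_ord k).
  have fi : fresh_sample P Gs [set inr tt] ([set inr tt] `\ inr tt) (distribution P idx_mfun) idx.
    by apply: fresh_sample1.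
  have [_ ->//] := fi _ _ _ ik.
  rewrite -ge0_integralZl_EFin//; last 2 first.
  - by move=> w _; rewrite lee_fin.
  - by apply/measurable_EFinP; exact: measurableT_comp mob ik.1.
  apply: eq_integral => w _.
  transitivity (\int[distribution P idx_mfun]_t ((output_bound (state k w))%:E * (\1_[set nat_of_ord k] t)%:E))%E.
    apply: eq_integral => t _; rewrite /phi /selected/= indicE -EFinM.
    have -> : (t \in [set nat_of_ord k]) = (t == k) by apply/idP/eqP; rewrite inE.
    by case: eqP => _; rewrite ?mulr1 ?mulr0.
  rewrite ge0_integralZl_EFin//.
  rewrite integral_indic// setIT muleC; congr (_ * _)%E.
  exact: idx_law.
rewrite -(_ : (K%:R^-1)%:E * \sum_(k < K) \int[P]_w (output_bound (state k w))%:E =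
  \int[P]_w (\sum_(k < K) selected k (state k w, idx w))%:E)%E.
  exact: output_bound_mean.
rewrite ge0_sume_distrr; last by move=> k _; apply: integral_ge0 => w _; rewrite lee_fin.
under eq_bigr do rewrite -E.
rewrite -ge0_integral_sum//.
- by apply: eq_integral => w _; rewrite sumEFin.
- by move=> k; apply/measurable_EFinP; exact: measurable_selected.
Qed.

End algorithm.

(** * Reduction to everywhere smooth integrands *)

Lemma mdlal_ext {R : realType} {d m : nat} {Xi : Type} (F F' : 'rV[R]_d -> Xi -> R)
    (h : 'rV[R]_d -> \bar R) (c : 'rV[R]_d -> 'rV[R]_m) (v : 'rV[R]_d -> R) (X : set 'rV[R]_d)
    (x0 : 'rV[R]_d) (mu eta nu alpha : R) (rho_ : nat -> R) (n0 n : nat)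
    (u : nat -> nat -> 'rV[R]_d) (xi : nat -> nat -> Xi) (k : nat) :
  (forall i j, (i <= k)%N -> (j < batch n0 n i)%N -> forall x, F x (xi i j) = F' x (xi i j)) ->
  mdlal F h c v X x0 mu eta nu alpha rho_ n0 n u xi k =
  mdlal F' h c v X x0 mu eta nu alpha rho_ n0 n u xi k.
Proof.
elim: k => [|k IH] FF'.
  by congr (Iterate _ _ (_ *: _)); apply: eq_bigr => j _; rewrite /zo_grad !FF'.
rewrite /= IH; last by move=> i j ik; apply: FF'; exact: leqW.
case: (mdlal _ _ _ _ _ _ _ _ _ _ _ _ _ _ _ k) => x l s.
by congr (Iterate _ _ (_ *: _)); apply: eq_bigr => j _; rewrite /zo_grad !FF'.
Qed.

Section null_modification.
Context {R : realType} {d : measure_display} {T : measurableType d}.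
Variable mu : {measure set T -> \bar R}.
Variable N : set T.
Hypotheses (mN : measurable N) (N0 : mu N = 0%E).

(** The function g need not be measurable, as nothing is known of it on N. Multiplying g' by the
    indicator of the complement of N changes no integral and puts it below g everywhere. *)
Lemma null_le_integral (g g' : T -> R) : measurable_fun setT g' ->
  (forall x, 0 <= g x) -> (forall x, 0 <= g' x) -> (forall x, ~ N x -> g' x = g x) ->
  (\int[mu]_x (g' x)%:E <= \int[mu]_x (g x)%:E)%E.
Proof.
move=> mg g0 g0' gg'.
apply: (@le_trans _ _ (\int[mu]_x (g' x * \1_(~` N) x)%:E)%E).
  apply: (ae_ge0_le_integral_any mN N0) => [|x|x|x Nx]; rewrite ?lee_fin ?mulr_ge0//.
  - apply/measurable_EFinP; apply: measurable_funM => //.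
    by apply: measurable_indic; exact: measurableC.
  - by rewrite indicE mem_set ?mulr1.
apply: ge0_le_integral_any => x; rewrite lee_fin ?mulr_ge0// indicE.
by case: (pselect (N x)) => Nx; [rewrite memNset ?mulr0//|rewrite mem_set// mulr1 gg'].
Qed.

End null_modification.

Lemma poweR_half_le {R : realType} (x : \bar R) (y : R) : (0 <= x)%E -> 0 <= y ->
  (x `^ 2^-1 <= y%:E)%E -> (x <= (y ^+ 2)%:E)%E.
Proof.
case: x => [r|_ _|//]; last by rewrite poweRyr ?invr_eq0 ?pnatr_eq0.
rewrite !lee_fin => r0 y0; rewrite powR12_sqrt// => ry.
by rewrite -(sqr_sqrtr r0) ler_sqr ?nnegrE ?sqrtr_ge0.
Qed.

Lemma cont_diff_cst {R : realType} {d : nat} (a : R) : cont_diff (fun _ : 'rV[R]_d => a).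
Proof.
split=> [x|]; first exact: differentiable_cst.
have -> : grad (fun _ : 'rV[R]_d => a) = fun=> 0.
  by apply/funext => x; apply/rowP => i; rewrite !mxE derive_cst.
exact: cst_continuous.
Qed.

(** The K atoms of mass 1/K already exhaust the total mass 1. *)
Lemma uniform_index_range {R : realType} {d : measure_display} {T : measurableType d}
    (P : probability T R) (idx : T -> nat) (K : nat) : (0 < K)%N ->
  measurable_fun setT idx -> (forall k, (k < K)%N -> P (idx @^-1` [set k]) = (K%:R^-1)%:E) ->
  P.-negligible (idx @^-1` [set k | (K <= k)%N]).
Proof.
move=> K0 midx idx_law.
have mp (A : set nat) : measurable (idx @^-1` A).
  by rewrite -[X in measurable X]setTI; exact: midx.
have H k : (k <= K)%N -> P (idx @^-1` [set i | (i < k)%N]) = (k%:R / K%:R)%:E.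
  elim: k => [_|k IH kK].
    by rewrite (_ : _ @^-1` _ = set0) ?measure0 ?mul0r// -subset0 => w.
  rewrite (_ : _ @^-1` _ = idx @^-1` [set i | (i < k)%N] `|` idx @^-1` [set k]).
    rewrite measureU//; last by rewrite -subset0 => w /= [+ wk]; rewrite wk ltnn.
    rewrite -natr1 mulrDl mul1r EFinD; congr (_ + _)%E; last exact: idx_law.
    exact/IH/ltnW.
  apply/seteqP; split => w /=; last by case=> [/ltnW|->]; rewrite ltnS.
  by rewrite ltnS leq_eqVlt => /orP[/eqP->|->]; [right|left].
exists (idx @^-1` [set k | (K <= k)%N]); split => //.
have -> : idx @^-1` [set k | (K <= k)%N] = ~` (idx @^-1` [set i | (i < K)%N]).
  by apply/seteqP; split => w /=; [rewrite leqNgt => /negP|move=> /negP; rewrite -leqNgt].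
have := H K (leqnn K); rewrite divff ?pnatr_eq0 -?lt0n// => H1.
transitivity (1 - 1 : \bar R)%E; last by rewrite subee.
by rewrite (probability_setC P (mp _)); congr (1 - _)%E; exact: H1.
Qed.

Lemma expectation_integral {R : realType} {d : measure_display} {T : measurableType d}
    (P : probability T R) (Z : T -> R) : ('E_P[Z] = \int[P]_w (Z w)%:E)%E.
Proof. by rewrite unlock. Qed.

(** F is set to 0 on the null set of bad samples; that set is common to all x, so the whole function
    of x is constant there. *)
Lemma cont_diff_version {R : realType} {d : nat} {dX : measure_display}
    {Xi : measurableType dX} (Pxi : probability Xi R) (F : 'rV[R]_d -> Xi -> R) :
  (forall x, Pxi.-integrable setT (fun z => (F x z)%:E)) ->
  {ae Pxi, forall z, cont_diff (F^~ z)} ->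
  exists F' N, [/\ measurable N /\ Pxi N = 0%E,
    forall z, ~ N z -> F^~ z = F'^~ z, forall z, cont_diff (F'^~ z),
    forall x, Pxi.-integrable setT (fun z => (F' x z)%:E) &
    forall x, (\int[Pxi]_z (F' x z)%:E = \int[Pxi]_z (F x z)%:E)%E].
Proof.
move=> iF [N [mN N0 C1N]].
pose F' x z := F x z * \1_(~` N) z.
have off z : ~ N z -> F^~ z = F'^~ z.
  by move=> Nz; apply/funext => x; rewrite /F' indicE mem_set// mulr1.
have mF x : measurable_fun setT (F x) by apply/measurable_EFinP; exact: measurable_int (iF x).
have mF' x : measurable_fun setT (F' x).
  by apply: measurable_funM => //; apply: measurable_indic; exact: measurableC.
exists F', N; split => // [z|x|x].
- case: (pselect (N z)) => Nz; last first.
    by rewrite -off//; apply: contrapT => H; exact/Nz/C1N.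
  rewrite (_ : F'^~ z = fun=> 0); first exact: cont_diff_cst.
  by apply/funext => x; rewrite /F' indicE memNset ?mulr0//; exact.
- apply: le_integrable (iF x) => //; first exact/measurable_EFinP.
  move=> z _ /=; rewrite lee_fin normrM ler_piMr// ger0_norm ?indicE//.
  by rewrite ?ler0n// lern1 leq_b1.
apply: ae_eq_integral => //; try exact/measurable_EFinP.
exists N; split=> // z /= H; apply: contrapT => Nz; apply: H => _.
by have /(congr1 (fun g => g x)) := off _ Nz => ->.
Qed.

Lemma msupport_neq0 {R : realType} {d : nat} (P : probability 'rV[R]_d R) :
  msupport P !=set0.
Proof.
have [N [mN N0 NP]] := msupport_full P.
apply/set0P/eqP => P0; rewrite P0 subset0 in NP.
have : P (~` N) = 1%E by rewrite probability_setC// N0 sube0.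
by rewrite NP measure0 => /esym/eqP; rewrite onee_eq0.
Qed.

Lemma conjugate_exponent_bounds {R : realType} (p q : R) :
  2 <= p -> p^-1 + q^-1 = 1 -> 1 <= q /\ q <= 2.
Proof.
move=> p2 pq; have p0 : 0 < p by lra.
have i0 : 0 < p^-1 by rewrite invr_gt0.
have i2 : p^-1 <= 2^-1 by rewrite lef_pV2 ?posrE.
have qE : q^-1 = 1 - p^-1 by lra.
have q0 : 0 < q by rewrite -invr_gt0 qE; lra.
split; first by rewrite -(invrK q) invr_ge1 ?unitfE ?lt0r_neq0 ?invr_gt0// qE; lra.
by rewrite -lef_pV2 ?posrE// qE; lra.
Qed.

Theorem theorem5p1
  (R : realType) (d m : nat) (hd : (3 <= d)%N) (hm : (1 <= m)%N)
  (p q : R) (hp : 2 <= p) (hpq : p^-1 + q^-1 = 1)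
  (* problem *)
  (dX : measure_display) (Xi : measurableType dX) (Pxi : probability Xi R)
  (F : 'rV[R]_d -> Xi -> R) (f : 'rV[R]_d -> R) (h : 'rV[R]_d -> \bar R)
  (c : 'rV[R]_d -> 'rV[R]_m) (X : set 'rV[R]_d)
  (F_integrable : forall x, Pxi.-integrable setT (fun z => (F x z)%:E))
  (f_expectation : forall x, ('E_Pxi[F x] = (f x)%:E)%E)
  (f_C1 : cont_diff f)
  (c_C1 : forall i, cont_diff (fun x => c x 0 i))
  (F_C1 : {ae Pxi, forall z, cont_diff (fun x => F x z)})
  (h_Nninfty : forall x, (h x != -oo)%E)
  (h_convex : econvex h)
  (* sampling distribution and smoothing region *)
  (Pu : probability 'rV[R]_d R) (nu : R) (nu_gt0 : 0 < nu)
  (O_nu : set 'rV[R]_d) (O_open : open O_nu)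
  (O_region : smoothing_region X Pu nu `<=` O_nu)
  (* (A1) *)
  (D_X L_f M_f M_h Mbar_c M_c L_c Phi_inf : R)
  (D_X_gt0 : 0 < D_X) (L_f_gt0 : 0 < L_f) (M_f_gt0 : 0 < M_f)
  (M_h_gt0 : 0 < M_h) (Mbar_c_gt0 : 0 < Mbar_c) (M_c_gt0 : 0 < M_c)
  (L_c_gt0 : 0 < L_c)
  (X_neq0 : X !=set0) (X_closed : closed X) (X_convex : convex_set X)
  (X_bounded : forall x, X x -> lpnorm q x <= D_X)
  (f_smooth : forall x y, O_nu x -> O_nu y ->
    lpnorm 2 (grad f x - grad f y) <= L_f * lpnorm 2 (x - y))
  (f_lipschitz : forall x y, O_nu x -> O_nu y ->
    `|f x - f y| <= M_f * lpnorm 2 (x - y))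
  (h_proper : exists2 x, X x & (h x < +oo)%E)
  (h_lsc : lower_semicontinuous_on X h)
  (h_subdifferential_neq0 : forall x, X x -> subdifferential h x !=set0)
  (h_subdifferential_bounded : forall x g, X x -> subdifferential h x g ->
    lpnorm 2 g <= M_h)
  (c_bounded : forall i x, X x -> `|c x 0 i| <= Mbar_c)
  (grad_c_bounded : forall i x, X x ->
    lpnorm 2 (grad (fun z => c z 0 i) x) <= M_c)
  (c_smooth : forall i x y, X x -> X y ->
    lpnorm 2 (grad (fun z => c z 0 i) x - grad (fun z => c z 0 i) y)
      <= L_c * lpnorm 2 (x - y))
  (Phi_bounded : forall x, X x -> (Phi_inf%:E <= (f x)%:E + h x)%E)
  (* (A2) *)
  (sigma : R) (sigma_gt0 : 0 < sigma)
  (F_unbiased : forall x i, O_nu x ->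
    ('E_Pxi[fun z => (grad (fun y => F y z) x 0 i)%R] = (grad f x 0 i)%R%:E)%E)
  (F_variance : forall x, O_nu x ->
    ('E_Pxi[fun z => (lpnorm 2 (grad (fun y => F y z) x - grad f x)%R ^+ 2)%R]
      <= (sigma ^+ 2)%:E)%E)
  (* (A3) *)
  (F_mean_smooth : forall x y, O_nu x -> O_nu y ->
    ('E_Pxi[fun z => (lpnorm 2 (grad (fun w => F w z) x
                               - grad (fun w => F w z) y)%R ^+ 2)%R] `^ 2^-1
      <= (L_f * lpnorm 2 (x - y)%R)%:E)%E)
  (* (A4) *)
  (S_p : R) (S_p_ge1 : 1 <= S_p)
  (u_anisotropy : forall g : 'rV[R]_d,
    ('E_Pu[fun u => (lpnorm p (dotv g u *: u)%R ^+ 2)%R]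
      <= (S_p * lpnorm 2 g ^+ 2)%:E)%E)
  (u_isotropic : forall i j,
    ('E_Pu[fun u => (u 0 i * u 0 j)%R] = ((i == j)%:R)%R%:E)%E)
  (u_moment6 : ('E_Pu[fun u => (lpnorm 2 u ^+ 6)%R] < +oo)%E)
  (* (A5) *)
  (v : 'rV[R]_d -> R) (L_v : R)
  (v_differentiable : forall x, differentiable v x)
  (v_strongly_convex : forall x y,
    lpnorm q (x - y) ^+ 2 <= dotv (x - y) (grad v x - grad v y))
  (v_smooth : forall x y, X x -> X y ->
    lpnorm p (grad v x - grad v y) <= L_v * lpnorm q (x - y))
  (* inputs of the algorithm *)
  (x0 : 'rV[R]_d) (x0X : X x0)
  (mu eta alpha : R) (mu_gt0 : 0 < mu) (eta_gt0 : 0 < eta)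
  (alpha_gt0 : 0 < alpha) (alpha_le1 : alpha <= 1)
  (K n0 n : nat) (K_ge2 : (2 <= K)%N) (n0_gt0 : (0 < n0)%N) (n_gt0 : (0 < n)%N)
  (rho_ : nat -> R) (rho_range : forall k, (k < K)%N -> 0 < rho_ k < mu)
  (* random directions, samples and output index *)
  (dO : measure_display) (Omega : measurableType dO) (P : probability Omega R)
  (u : nat -> nat -> {RV P >-> 'rV[R]_d}) (xi : nat -> nat -> {RV P >-> Xi})
  (idx : {RV P >-> nat})
  (u_law : forall k j, (k < K)%N -> (j < batch n0 n k)%N ->
    forall A, measurable A -> distribution P (u k j) A = Pu A)
  (xi_law : forall k j, (k < K)%N -> (j < batch n0 n k)%N ->
    forall A, measurable A -> distribution P (xi k j) A = Pxi A)
  (idx_law : forall k, (k < K)%N ->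
    distribution P idx [set k] = (K%:R^-1)%:E)
  (independent : mutually_independent P (sources K n0 n)
    (source_sigma_algebra (fun k j => u k j) (fun k j => xi k j) idx))
  (* choice of the parameters *)
  (rho : R) (rho_gt0 : 0 < rho)
  (rho_def : forall k, (k < K)%N -> rho_ k = rho / K%:R) :
  let L_mu :=
    L_f + m%:R * (mu * M_c ^+ 2 + mu * Mbar_c * L_c + rho * Mbar_c * L_c) in
  let Delta0 :=
    (aug_lagrangian f h c x0 0 mu - Phi_inf%:E
      + (2 * m%:R * rho * Mbar_c ^+ 2)%:E)%E in
  let E_u6 := ('E_Pu[fun w => (lpnorm 2 w ^+ 6)%R])%E in
  let sigma2 :=
    ((nu ^+ 2 * L_f ^+ 2)%:E * E_u6
      + (4 * S_p * (sigma ^+ 2 + M_f ^+ 2) + 2 * M_f ^+ 2)%:E)%E in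
  let it k w :=
    mdlal F h c v X x0 mu eta nu alpha rho_ n0 n
      (fun k' j => u k' j w) (fun k' j => xi k' j w) k in
  let x_R w := it_x (it (idx w) w) in
  let lambda_R w := it_lambda (it (idx w) w) + mu *: c (x_R w) in
  eta * L_mu <= 2^-1 ->
  96 * (p - 1) * S_p * eta ^+ 2 * L_f ^+ 2 / alpha <= n%:R ->
  ('E_P[fun w =>
      (lpnorm q (grad_mapping X h v (x_R w)
        (grad f (x_R w) + grad_constr c (x_R w) (lambda_R w)) eta)%R ^+ 2)%R]
    <= ((4 * L_f ^+ 2 + 3 * eta ^- 2) * nu ^+ 2)%:E * E_u6
       + (30 * (p - 1) / (n0%:R * alpha * K%:R))%:E * sigma2
       + (60 * alpha * (p - 1) / n%:R)%:E * sigma2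
       + (27 / (eta * K%:R))%:E * Delta0)%E.
Proof.
move=> L_mu Delta0 E_u6 sigma2 it x_R lambda_R etaL n_large.
rewrite !lpnormE ?expectation_integral in X_bounded f_smooth f_lipschitz h_subdifferential_bounded
  grad_c_bounded c_smooth F_variance F_mean_smooth u_anisotropy u_moment6 v_strongly_convex |- *.
have [q_ge1 q_le2] := conjugate_exponent_bounds hp hpq.
have p_ge1 : 1 <= p by apply: le_trans hp; rewrite ler1n.
have K_gt0 : (0 < K)%N by exact: ltnW.
have f_diff x : differentiable f x by exact: f_C1.1.
have c_diff i x : differentiable (fun y => c y 0 i) x by exact: (c_C1 i).1.
have [F' [N [[mN N0] offN C1' iF' meanF']]] := cont_diff_version F_integrable F_C1.
have mF' x : measurable_fun setT (F' x).
  by apply/measurable_EFinP; exact: measurable_int (iF' x).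
have F'_mean x : (\int[Pxi]_z (F' x z)%:E = (f x)%:E)%E.
  by rewrite meanF' -expectation_integral.
have mgF' x : measurable_fun setT (fun z => grad (F'^~ z) x).
  have := measurable_grad2 mF' (fun y z => (C1' z).1 y).
  by move=> /measurable_fun_pair2 => /(_ x).
have F'_variance x : O_nu x ->
    (\int[Pxi]_z (pnorm 2 (grad (F'^~ z) x - grad f x) ^+ 2)%:E <= (sigma ^+ 2)%:E)%E.
  move=> Ox; have := F_variance x Ox; rewrite expectation_integral; apply: le_trans.
  apply: (null_le_integral mN N0) => [|z|z|z Nz]; rewrite ?sqr_ge0 ?offN//.
  by apply: measurable_pnorm_sqr; apply: measurable_rowB => //; exact: measurable_cst.
have F'_mean_smooth x y : O_nu x -> O_nu y ->
    (\int[Pxi]_z (pnorm 2 (grad (F'^~ z) x - grad (F'^~ z) y) ^+ 2)%:E <=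
     (L_f ^+ 2 * pnorm 2 (x - y) ^+ 2)%:E)%E.
  move=> Ox Oy; have := F_mean_smooth x y Ox Oy; rewrite expectation_integral => H.
  rewrite -exprMn; apply: le_trans (poweR_half_le _ _ H).
  - apply: (null_le_integral mN N0) => [|z|z|z Nz]; rewrite ?sqr_ge0 ?offN//.
    by apply: measurable_pnorm_sqr; exact: measurable_rowB.
  - by apply: integral_ge0 => z _; rewrite lee_fin sqr_ge0.
  - by rewrite mulr_ge0 ?pnorm_ge0// ltW.
have aniso g : (\int[Pu]_u (pnorm p (dotv g u *: u) ^+ 2)%:E <= (S_p * pnorm 2 g ^+ 2)%:E)%E.
  by rewrite -expectation_integral.
have iso i j : (\int[Pu]_u (u 0 i * u 0 j)%:E = ((i == j)%:R)%:E)%E.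
  by rewrite -expectation_integral.
have [E6 u6E] : exists E6, (\int[Pu]_w (pnorm 2 w ^+ 6)%:E = E6%:E)%E.
  exists (fine (\int[Pu]_w (pnorm 2 w ^+ 6)%:E)); rewrite fineK// ge0_fin_numE//.
  by apply: integral_ge0 => w _; rewrite lee_fin exprn_ge0 ?pnorm_ge0.
have O_reg x t w : X x -> 0 <= t <= 1 -> msupport Pu w -> O_nu (x + (t * nu) *: w).
  by move=> Xx t01 sw; apply: O_region; exists x, t, w.
(* Take t = 0 in the smoothing region; this needs a point of the support, which is nonempty. *)
have X_sub_O : X `<=` O_nu.
  move=> x Xx; have [w sw] := msupport_neq0 Pu.
  have := O_reg x 0 w Xx _ sw; rewrite mul0r scale0r addr0; apply.
  by rewrite lexx ler01.
have mu_ k j : measurable_fun setT (u k j) by exact: measurable_funP.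
have mxi k j : measurable_fun setT (xi k j) by exact: measurable_funP.
have midx : measurable_fun setT idx by exact: measurable_funP.
(* The realisations where the index is out of range or some sample actually drawn falls in N: a
   countable union of null sets. *)
pose bad := idx @^-1` [set k | (K <= k)%N] `|` \bigcup_k \bigcup_j
  (if (k < K)%N && (j < batch n0 n k)%N then xi k j @^-1` N else set0).
have [A [mA A0 badA]] : P.-negligible bad.
  apply: negligibleU; first exact: uniform_index_range.
  apply: negligible_bigcup => k; apply: negligible_bigcup => j.
  case: ifP => [/andP[kK jn]|_]; last exact: negligible_set0.
  exists (xi k j @^-1` N); split => //.
    by rewrite -[X in measurable X]setTI; exact: mxi.
  by have := xi_law k j kK jn N mN; rewrite N0.
have bound := @output_bound_le R d m dX dO Xi Omega Pxi Pu P p q F' f h c v X O_nu D_X M_h eta mu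
  nu rho alpha L_f M_f Mbar_c M_c L_c Phi_inf sigma S_p E6 K n0 n rho_ x0
  (fun k j => u k j) (fun k j => xi k j) idx hp q_ge1 q_le2 hpq mF' iF' F'_mean C1' f_diff c_diff
  h_convex nu_gt0 O_open O_reg X_sub_O L_f_gt0 M_f_gt0 Mbar_c_gt0 X_neq0 X_closed X_convex
  X_bounded f_smooth f_lipschitz h_subdifferential_neq0 h_subdifferential_bounded c_bounded
  grad_c_bounded c_smooth Phi_bounded F'_variance F'_mean_smooth S_p_ge1 aniso iso u6E
  v_differentiable v_strongly_convex x0X mu_gt0 eta_gt0 alpha_gt0 alpha_le1 K_gt0 n0_gt0 n_gt0
  mu_ mxi midx u_law xi_law idx_law independent rho_gt0 rho_def etaL n_large.
have hx0 : h x0 = (fine (h x0))%:E by exact: (@h_fin _ _ X h).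
have Delta0E : Delta0 = (initial_gap f h c mu rho Mbar_c Phi_inf x0)%:E.
  rewrite /Delta0 /aug_lagrangian lpnormE hx0 dotv0l /initial_gap.
  by rewrite -!EFinN -!EFinD addr0.
have E6E : E_u6 = E6%:E by rewrite /E_u6 lpnormE expectation_integral.
have rhsE : (((4 * L_f ^+ 2 + 3 * eta ^- 2) * nu ^+ 2)%:E * E_u6
       + (30 * (p - 1) / (n0%:R * alpha * K%:R))%:E * sigma2
       + (60 * alpha * (p - 1) / n%:R)%:E * sigma2
       + (27 / (eta * K%:R))%:E * Delta0)%E =
  ((4 * L_f ^+ 2 + 3 * eta ^- 2) * (nu ^+ 2 * E6) +
    30 * (p - 1) / (n0%:R * alpha * K%:R) *
      (nu ^+ 2 * L_f ^+ 2 * E6 + (4 * S_p * (sigma ^+ 2 + M_f ^+ 2) + 2 * M_f ^+ 2)) +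
    60 * alpha * (p - 1) / n%:R *
      (nu ^+ 2 * L_f ^+ 2 * E6 + (4 * S_p * (sigma ^+ 2 + M_f ^+ 2) + 2 * M_f ^+ 2)) +
    27 / (eta * K%:R) * initial_gap f h c mu rho Mbar_c Phi_inf x0)%:E.
  by rewrite /sigma2 Delta0E E6E -!EFinM -!EFinD [in RHS]mulrA.
rewrite rhsE; apply: le_trans bound.
(* Off A the run with F coincides with the run with F'. Only the dominating sum has to be
   measurable. *)
apply: (ae_ge0_le_integral_any mA A0).
- apply/measurable_EFinP; apply: measurable_sum => k.
  exact: (@measurable_selected R d m dX dO Xi Omega Pxi Pu P p q F' f h c v X O_nu D_X M_h eta mu
    nu alpha L_f M_f sigma S_p E6 K n0 n).
- by move=> w; rewrite lee_fin sqr_ge0.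
- by move=> w; rewrite lee_fin sumr_ge0// => k _; exact: selected_ge0.
move=> w Aw; rewrite lee_fin.
have idxK : (idx w < K)%N.
  by rewrite ltnNge; apply/negP => H; apply/Aw/badA; left.
have itE : it (idx w) w = mdlal F' h c v X x0 mu eta nu alpha rho_ n0 n
    (fun k j => u k j w) (fun k j => xi k j w) (idx w).
  apply: mdlal_ext => i j ii jn x.
  have Nw : ~ N (xi i j w).
    move=> H; apply/Aw/badA; right; exists i => //; exists j => //.
    by rewrite (leq_ltn_trans ii idxK) jn.
  by have /(congr1 (fun g => g x)) := offN _ Nw.
(* The term k = idx w is the bound for the output iterate; the others are nonnegative. *)
rewrite (bigD1 (Ordinal idxK))//= [X in _ <= X + _]/selected/= eqxx.
apply: ler_wpDr; first by apply: sumr_ge0 => k _; exact: selected_ge0.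
rewrite /lambda_R /x_R itE.
exact: (grad_mapping_output_bound f c mu hp q_ge1 hpq h_convex X_neq0 X_closed X_convex X_bounded
  h_subdifferential_neq0 h_subdifferential_bounded v_differentiable v_strongly_convex eta_gt0
  (state F' h c v X eta mu nu alpha n0 n rho_ x0 (fun k j => u k j) (fun k j => xi k j) (idx w) w)).
Qed.
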